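(* For every fixed $k\ge 3$, the $k$-angulation flip walk on the convex $((k-2)n+2)$-point set has mixing time $n^{O(k\log n)}$ (asymptotically in $n$).
   Context: Fix $k\ge 3$ and let $P_{(k-2)n+2}$ be a convex polygon with $(k-2)n+2$ vertices. A $k$-angulation of it is a maximal subdivision of the polygon into $k$-gons all of whose vertices are vertices of the polygon. Each diagonal of a $k$-angulation belongs to two $k$-gons, which together form a $(2k-2)$-gon, and it connects two opposite vertices of that $(2k-2)$-gon. A flip replaces this diagonal by one of the $k-2$ other diagonals connecting opposite vertices of the $(2k-2)$-gon. The $k$-angulation flip graph has the $k$-angulations as vertices and the flips as edges. The $k$-angulation flip walk is the natural lazy random walk on this graph: at each step, with probability $1/2$ do nothing; otherwise choose a diagonal of the current $k$-angulation uniformly at random and replace it by one of its $k-2$ possible replacements chosen uniformly at random. Its stationary distribution $\pi^*$ is uniform. The total variation distance between distributions $\mu,\nu$ on a finite set $\Omega$ is $d(\mu,\nu)=\frac12\sum_{S\in\Omega}|\mu(S)-\nu(S)|$. The mixing time is the minimum $t$ such that, regardless of the starting state, the distribution $\pi_t$ of the chain at time $t$ satisfies $d(\pi_t,\pi^* )<1/4$. *)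

(* Defs.v *)
From HB Require Import structures.
From mathcomp Require Import all_boot all_order all_algebra.

Set Implicit Arguments.
Unset Strict Implicit.
Unset Printing Implicit Defensive.

Import Order.TTheory GRing.Theory Num.Theory.

(* The vertices of a convex m-gon are numbered 0, ..., m-1 in cyclic order;
   everything about k-angulations depends only on this cyclic order.
   A segment between two vertices is encoded as a pair (a, b) with a < b. *)

Notation chord m := ('I_m * 'I_m)%type.

Section Polygon.
Variable m : nat.
Implicit Types (p q e : chord m) (F U : {set 'I_m}) (T : {set chord m}).

Definition polygon_side p : bool :=
  (p.1.+1 == p.2 :> nat) || ((p.1 == 0 :> nat) && (p.2.+1 == m)).

Definition diagonal p : bool := (p.1 < p.2)%N && ~~ polygon_side p.

(* The relative interiors of p and q meet; sharing an endpoint is allowed. *)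
Definition crossing p q : bool :=
  [&& p.1 < q.1, q.1 < p.2 & p.2 < q.2]%N ||
  [&& q.1 < p.1, p.1 < q.2 & q.2 < p.2]%N.

(* Number of vertices in F lying strictly on each of the two sides of p. *)
Definition inner_count F p : nat :=
  #|[set v in F | (p.1 < v)%N && (v < p.2)%N]|.

Definition outer_count F p : nat :=
  #|[set v in F | (v < p.1)%N || (p.2 < v)%N]|.

(* p is a side of the convex hull of F. *)
Definition side_of F p : bool :=
  [&& p.1 \in F, p.2 \in F, (p.1 < p.2)%N &
      (inner_count F p == 0) || (outer_count F p == 0)].

(* p joins two opposite vertices of the convex hull of F. *)
Definition opposite_in F p : bool :=
  [&& p.1 \in F, p.2 \in F, (p.1 < p.2)%N &
      inner_count F p == outer_count F p].

(* F is the vertex set of a cell of the subdivision of the polygon by the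
   non-crossing diagonals T: the sides of the hull of F are drawn, and no drawn
   segment cuts through that hull. *)
Definition cell T F : bool :=
  (2 < #|F|)%N &&
  [forall p : chord m,
    [&& p.1 \in F, p.2 \in F & (p.1 < p.2)%N] ==>
    (side_of F p == (polygon_side p || (p \in T)))].

(* A k-angulation is encoded by its set of diagonals.  A subdivision all of
   whose cells are k-gons is automatically a maximal one with that property. *)
Definition is_kangulation (k : nat) T : bool :=
  [&& [forall p in T, diagonal p],
      [forall p in T, forall q in T, ~~ crossing p q] &
      [forall F : {set 'I_m}, cell T F ==> (#|F| == k)]].

(* Vertex set of the (2k-2)-gon formed by the two cells containing e. *)
Definition flip_region T e : {set 'I_m} :=
  \bigcup_(F : {set 'I_m} | cell T F && side_of F e) F.

Definition replacements T e : {set chord m} :=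
  [set e' | opposite_in (flip_region T e) e' & e' != e].

Definition flip T e e' : {set chord m} := e' |: (T :\ e).

End Polygon.

Record kangulation (k m : nat) := KAngulation {
  diagonals :> {set chord m};
  _ : is_kangulation k diagonals
}.

HB.instance Definition _ k m := [isSub for @diagonals k m].
HB.instance Definition _ k m := [Finite of kangulation k m by <:].

Local Open Scope ring_scope.

Section Chain.
Variables (R : realFieldType) (Omega : finType).
Implicit Types (P : Omega -> Omega -> R) (mu nu : Omega -> R).

Definition point_mass (S0 S : Omega) : R := (S == S0)%:R.

Definition uniform_dist (S : Omega) : R := (#|Omega|%:R)^-1.

Definition chain_step P mu (S : Omega) : R := \sum_(S' : Omega) mu S' * P S' S.

Definition dist_at P (S0 : Omega) (t : nat) : Omega -> R :=
  iter t (chain_step P) (point_mass S0).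

Definition tv_dist mu nu : R := 2^-1 * \sum_(S : Omega) `|mu S - nu S|.

Definition mixed_at P (pi : Omega -> R) (t : nat) : Prop :=
  forall S0 : Omega, tv_dist (dist_at P S0 t) pi < 4^-1.

Definition is_mixing_time P (pi : Omega -> R) (t : nat) : Prop :=
  mixed_at P pi t /\ forall s : nat, mixed_at P pi s -> (t <= s)%N.

End Chain.

(* Transition probability from S to S'. *)
Definition flip_walk (R : realFieldType) (k m : nat) (S S' : kangulation k m) : R :=
  2^-1 * (S' == S)%:R +
  2^-1 * \sum_(e in diagonals S) (#|diagonals S|%:R)^-1 *
         \sum_(e' in replacements (diagonals S) e)
            (#|replacements (diagonals S) e|%:R)^-1 *
            (diagonals S' == flip (diagonals S) e e')%:R.

(* Main.v *)
From mathcomp Require Import all_boot all_order all_algebra.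
From mathcomp Require Import all_classical all_reals all_analysis.
From mathcomp Require Import fintype finset zify ring lra.
Require Import Defs.

Set Implicit Arguments.
Unset Strict Implicit.
Unset Printing Implicit Defensive.

(** Put q = k - 2.  Reading a k-angulation of the (qn+2)-gon from a fixed side, and
    descending through each cell from the side by which it was entered to its q + 1
    other sides, gives a plane tree with n internal nodes of arity q + 1; a chord
    corresponds to the interval of leaves below a node ([dissection_inj],
    [dissection_surj]).  Moving an internal node along the q + 1 positions that it can
    take in the (2q+2)-gon that it forms with its parent is a flip ([rotation_flip]), so
    it is enough to study rotations of trees.

    The quantity to bound is the constant A(n) in a Poincare inequality
      sum over all w, w' of (f w - f w')^2
         <= A(n) * (number of trees) * sum over rotations w -> w' of (f w - f w')^2.
    Every tree has a subtree of balanced size: between n/(2k) and (1 - 1/(2k)) n internal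
    nodes ([balanced_subtree]).  Prescribe the size a of this subtree and the number u of
    leaves to its left.  The class of trees obtained in this way is a product: a tree of
    size a grafted into a tree of size n - a, and rotations in either factor are rotations
    of the whole.  So on each class the inequality holds with max (A(a), A(n-a))
    ([msd_grafts]).  There are polynomially many classes, and they cover all trees.

    Classes are glued to each other by overlaps.  Two classes whose prescribed subtrees
    are disjoint, or nested, share a family of trees, and because the number of trees is
    the exponential G^n up to a polynomial factor ([ntrees_submult]) this family makes
    up a polynomial fraction of each class.  Three fixed classes suffice as intermediate
    stations: their prescribed subtrees have size n/3 and stand at the left end, next to
    it, and at the right end ([hubs]).  With the triangle inequality for mean square
    distances this yields A(n) <= poly(n) * max A(n') over n' <= (1 - 1/(2k)) n
    ([poincare_step]); the recursion has depth O(k log n), hence A(n) = n^O(k log n).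

    The flip walk is symmetric, because a flip can be undone and keeps the numbers of
    diagonals and of replacements ([flip_kernel_sym]), and the probability of each flip is
    at least an inverse polynomial ([flip_walk_ge]).  For a lazy symmetric chain a
    Poincare inequality contracts the squared distance to the uniform distribution at
    each step ([step_contraction]); as the number of trees is at most exponential in n,
    O(n) relaxation times are enough. *)

(** * Plane trees as preorder words *)

(** A word lists the nodes of an ordered forest in preorder: [true] is an internal node,
    of arity q + 1 below, and [false] is a leaf. *)
Definition leaves (w : bitseq) := count negb w.
Definition nodes (w : bitseq) := count id w.
Arguments leaves : simpl never.
Arguments nodes : simpl never.

Section Words.
Variable q : nat.
Implicit Types (j i n : nat) (w u v s t : bitseq).

(** The parser of preorder words: [j] counts the subtrees still to be read, and an
    internal node trades one of them for its q + 1 children.  A word that continues after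
    all subtrees are complete is rejected. *)
Fixpoint run j w : option nat :=
  match w with
  | [::] => Some j
  | b :: w' => if j is j'.+1 then run (if b then q.+1 + j' else j') w' else None
  end.

Definition forest j w := run j w == Some 0.

Lemma run_cat j u v : run j (u ++ v) = obind (run^~ v) (run j u).
Proof. by elim: u j => [|b u IH] [|j] //=. Qed.

Lemma run_addl j i l w : run j w = Some i -> run (l + j) w = Some (l + i).
Proof.
elim: w j => [|b w IH] j /=; first by case=> ->.
case: j => // j; rewrite addnS; case: b => /IH //.
by rewrite addnCA.
Qed.

Lemma run_count j i w : run j w = Some i -> i + leaves w = j + q * nodes w.
Proof.
elim: w j => [|b w IH] j /=; first by case=> ->; rewrite muln0 addn0.
by case: j => // j; case: b => /IH; rewrite /leaves /nodes /=; lia.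
Qed.

Lemma leaves_forest j w : forest j w -> leaves w = j + q * nodes w.
Proof. by move/eqP/run_count. Qed.

Lemma size_leaves_nodes w : size w = leaves w + nodes w.
Proof. by rewrite addnC -(count_predC id w). Qed.

Lemma leaves_cat u v : leaves (u ++ v) = leaves u + leaves v.
Proof. exact: count_cat. Qed.

Lemma nodes_cat u v : nodes (u ++ v) = nodes u + nodes v.
Proof. exact: count_cat. Qed.

Lemma leaves_cons b u : leaves (b :: u) = ~~ b + leaves u. Proof. by []. Qed.
Lemma nodes_cons b u : nodes (b :: u) = b + nodes u. Proof. by []. Qed.

Definition lnE := (leaves_cat, nodes_cat, leaves_cons, nodes_cons).

Lemma forest0 w : forest 0 w -> w = [::].
Proof. by case: w. Qed.

Lemma forest_nil j : forest j [::] -> j = 0.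
Proof. by case/eqP. Qed.

Lemma forest_leaf j w : forest j.+1 (false :: w) = forest j w.
Proof. by []. Qed.

Lemma forest_node j w : forest j.+1 (true :: w) = forest (q.+1 + j) w.
Proof. by []. Qed.

Lemma forest_cat i j u v : forest i u -> forest j v -> forest (i + j) (u ++ v).
Proof.
move=> /eqP hu hv; rewrite /forest run_cat addnC (run_addl j hu) addn0 /=.
exact: hv.
Qed.

Lemma forest_cat_r i j u v : forest i u -> forest (i + j) (u ++ v) -> forest j v.
Proof.
by move=> /eqP hu; rewrite /forest run_cat addnC (run_addl j hu) addn0.
Qed.

Lemma forest_split i j w : forest (i + j) w ->
  exists u v, [/\ w = u ++ v, forest i u & forest j v].
Proof.
elim: w i => [|b w IH] i.
  move/forest_nil/eqP; rewrite addn_eq0 => /andP[/eqP -> /eqP ->].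
  by exists [::], [::].
case: i => [|i]; first by exists [::], (b :: w).
rewrite addSn; case: b; rewrite ?forest_leaf ?forest_node ?addnA => /IH[u [v [-> hu hv]]].
  by exists (true :: u), v.
by exists (false :: u), v.
Qed.

Lemma forest_prefix i u u' v v' :
  forest i u -> forest i u' -> u ++ v = u' ++ v' -> u = u' /\ v = v'.
Proof.
elim: u i u' => [|b u IH] i u'.
  by move/forest_nil => -> /forest0 ->.
case: u' => [|b' u']; first by move=> hu /forest_nil i0; rewrite i0 in hu.
case: i => [//|i] /=; move=> hu hu' [bb']; subst b'.
case: b hu hu'; rewrite ?forest_leaf ?forest_node => hu hu' /(IH _ _ hu hu');
  by case=> -> ->.
Qed.

Lemma forest_suffix i s r : forest i (s ++ r) ->
  exists2 j, run i s = Some j & forest j r.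
Proof.
rewrite /forest run_cat; case: (run i s) => [j|] //= hj.
by exists j.
Qed.

Lemma forest_ind (P : nat -> bitseq -> Prop) :
  P 0 [::] ->
  (forall j w, forest j w -> P j w -> P j.+1 (false :: w)) ->
  (forall j u v, forest q.+1 u -> P q.+1 u -> forest j v -> P j v ->
    P j.+1 (true :: u ++ v)) ->
  forall j w, forest j w -> P j w.
Proof.
move=> P0 Pl Pn j w; move: {2}(size w) (leqnn (size w)) => l.
elim: l j w => [|l IH] j w.
  by rewrite leqn0 => /nilP -> /forest_nil ->.
case: w => [_ /forest_nil -> //|b w] /= hl.
case: j => [//|j]; case: b; last by rewrite forest_leaf => hw; apply/Pl/IH.
rewrite forest_node => /forest_split[u [v [ew hu hv]]]; rewrite ew.
by apply: Pn => //; apply: IH => //; move: hl; rewrite ew size_cat; lia.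
Qed.

Lemma tree_cases w : forest 1 w ->
  w = [:: false] \/ exists2 u, w = true :: u & forest q.+1 u.
Proof.
case: w => [//|b w]; case: b; rewrite ?forest_leaf ?forest_node.
  by rewrite addn0; right; exists w.
by move/forest0 ->; left.
Qed.

Lemma tree_split j w : forest j.+1 w ->
  exists t v, [/\ w = t ++ v, forest 1 t & forest j v].
Proof. by rewrite -add1n => /forest_split. Qed.

(** The parse of a tree stops exactly at its last letter, so a subtree that begins inside
    [t] also ends inside [t]. *)
Lemma subtree_nested x t y x' t' y' :
  x ++ t ++ y = x' ++ t' ++ y' -> forest 1 t -> forest 1 t' ->
  size x <= size x' ->
  (exists z, x' = x ++ t ++ z /\ y = z ++ t' ++ y') \/
  (exists z z', [/\ x' = x ++ z, t = z ++ t' ++ z' & y' = z' ++ y]).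
Proof.
move=> e ht ht' hs.
have [z ex'] : exists z, x' = x ++ z.
  exists (drop (size x) x'); rewrite -{1}(cat_take_drop (size x) x'); congr (_ ++ _).
  by have := congr1 (take (size x)) e; rewrite take_size_cat // takel_cat.
subst x'; move: e; rewrite -catA => /eqP; rewrite eqseq_cat // eqxx /= => /eqP e.
case: (leqP (size t) (size z)) => hz.
  have [z1 ez] : exists z1, z = t ++ z1.
    exists (drop (size t) z); rewrite -{1}(cat_take_drop (size t) z); congr (_ ++ _).
    by have := congr1 (take (size t)) e; rewrite take_size_cat // takel_cat.
  left; exists z1; rewrite ez; split=> //.
  by move: e; rewrite ez -catA => /eqP; rewrite eqseq_cat // eqxx => /eqP.
right.
have [r et] : exists r, t = z ++ r.
  exists (drop (size z) t); rewrite -{1}(cat_take_drop (size z) t); congr (_ ++ _).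
  by have := congr1 (take (size z)) e; rewrite takel_cat ?(ltnW hz) // take_size_cat.
subst t; move: e; rewrite -catA => /eqP; rewrite eqseq_cat // eqxx /= => /eqP e.
have [j hj hr] := forest_suffix ht.
case: j hj hr => [|j] hj hr.
  by move: hz; rewrite (forest0 hr) cats0 ltnn.
have [t2 [z' [er ht2 hz']]] := tree_split hr.
have [e1 e2] : t2 = t' /\ z' ++ y = y'.
  by apply: (forest_prefix ht2 ht'); rewrite catA -er.
by exists z, z'; rewrite er e1 e2.
Qed.

End Words.

(** * Counting trees *)

Section Count.
Variable q : nat.
Implicit Types (j i n : nat) (w u v s t : bitseq).

(** Enumeration: a forest of [j] trees with [n] internal nodes is a word of length
    (q + 1) n + j. *)
Definition forests j n : seq bitseq :=
  [seq w <- map val (enum {: (q.+1 * n + j).-tuple bool}) | forest q j w].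

Lemma mem_forests j n w :
  (w \in forests j n) = forest q j w && (size w == q.+1 * n + j).
Proof.
rewrite mem_filter; congr (_ && _); apply/mapP/eqP => [[t _ ->]|hw].
  by rewrite size_tuple.
by exists (Tuple (introT eqP hw)); rewrite ?mem_enum.
Qed.

Lemma uniq_forests j n : uniq (forests j n).
Proof. by rewrite filter_uniq // map_inj_uniq ?enum_uniq //; apply: val_inj. Qed.

Lemma forests_nodes j n w : w \in forests j n -> nodes w = n.
Proof.
rewrite mem_forests => /andP[/leaves_forest h /eqP]; rewrite size_leaves_nodes h; nia.
Qed.

Lemma forestsP j n w : reflect (forest q j w /\ nodes w = n) (w \in forests j n).
Proof.
apply: (iffP idP) => [h|[h <-]].
  by split; [move: h; rewrite mem_forests => /andP[] | apply: forests_nodes h].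
rewrite mem_forests h /= size_leaves_nodes (leaves_forest h); apply/eqP; nia.
Qed.

Definition nforests j n := size (forests j n).

Lemma nforests_n0 j : nforests j 0 = 1.
Proof.
rewrite /nforests -[RHS]/(size [:: nseq j false]); apply: perm_size.
apply: uniq_perm; rewrite ?uniq_forests // => w; rewrite mem_seq1.
apply/forestsP/eqP => [[hw nw]|->].
  have := leaves_forest hw; rewrite nw muln0 addn0 => <-.
  elim: w nw {hw} => [//|b w IH]; rewrite lnE; case: b => //= /IH {1}->.
  by [].
split; first by elim: j => // j IH; rewrite /= forest_leaf.
by rewrite /nodes count_nseq.
Qed.

Lemma nforests_0n n : nforests 0 n.+1 = 0.
Proof.
rewrite /nforests; case E: (forests 0 n.+1) => [//|w l].
have /forestsP[/forest0 ->] : w \in forests 0 n.+1 by rewrite E mem_head.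
by [].
Qed.

Lemma nforestsSS j n : nforests j.+1 n.+1 = nforests j n.+1 + nforests (q.+1 + j) n.
Proof.
rewrite /nforests.
rewrite -(size_map (cons false) (forests j n.+1)) -(size_map (cons true) (forests (q.+1 + j) n)).
rewrite -size_cat; apply: perm_size; apply: uniq_perm; first exact: uniq_forests.
  rewrite cat_uniq !map_inj_uniq ?uniq_forests ?andbT /=; try by move=> ? ? [].
  by apply/hasPn => w /mapP[u _ ->]; apply/mapP => -[].
move=> w; rewrite mem_cat; apply/forestsP/orP => [[]|].
  case: w => [//|b w] hw; rewrite nodes_cons.
  case: b hw => hw nw; [right|left]; apply/map_f/forestsP; split=> //.
  by case: nw.
by case=> /mapP[u /forestsP[hu nu] ->]; split=> //; rewrite nodes_cons nu.
Qed.

(** The ballot formula, which the first-letter recursion [nforestsSS] determines. *)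
Lemma nforestsE j n : (q.+1 * n + j) * nforests j n = j * 'C(q.+1 * n + j, n).
Proof.
elim: n j => [|n IHn] j; first by rewrite nforests_n0 bin0 muln0 add0n.
elim: j => [|j IHj]; first by rewrite nforests_0n muln0.
rewrite nforestsSS; set M := q.+1 * n + (q.+1 + j).
have eM : q.+1 * n.+1 + j = M by rewrite /M; nia.
have := IHn (q.+1 + j); rewrite -/M => e1; move: IHj; rewrite eM => e2.
have -> : q.+1 * n.+1 + j.+1 = M.+1 by rewrite -eM; nia.
have h1 := mul_bin_left M n; have h2 := mul_bin_diag M.+1 n.
set x := nforests j n.+1 in e2 *; set y := nforests _ n in e1 *.
set b := 'C(M, n) in e1 h1 h2 *; set c := 'C(M, n.+1) in e2 h1 *.
set d := 'C(M.+1, n.+1) in h2 *; rewrite /= -/b in h2.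
have hM : 0 < M by rewrite /M; lia.
have hn : n <= M by rewrite /M; nia.
apply/eqP; rewrite -(eqn_pmul2l hM) -(eqn_pmul2l (ltn0Sn n)); apply/eqP.
have {}h1 : n.+1 * c + n * b = M * b by rewrite h1 -mulnDl subnK.
transitivity (M.+1 * (n.+1 * (M * x) + n.+1 * (M * y))); first by ring.
rewrite e1 e2.
transitivity (M * j.+1 * (n.+1 * d)); last by ring.
rewrite -h2.
transitivity (M.+1 * (j * (n.+1 * c + n * b) + (j + q.+1 * n.+1) * b)); first by ring.
by rewrite h1 (addnC j) eM; ring.
Qed.

Definition trees n := forests 1 n.
Definition ntrees n := nforests 1 n.

(** The Fuss-Catalan numbers. *)
Lemma ntrees_bin n : (q * n).+1 * ntrees n = 'C(q.+1 * n, n).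
Proof.
have h := nforestsE 1 n; rewrite mul1n addn1 in h.
have h2 := mul_bin_down (q.+1 * n).+1 n; rewrite /= -h in h2.
have e : (q.+1 * n).+1 - n = (q * n).+1 by nia.
rewrite e in h2; apply/eqP.
by rewrite -(eqn_pmul2l (ltn0Sn (q.+1 * n))) h2 /ntrees; apply/eqP; ring.
Qed.

Lemma ntrees_gt0 n : 0 < ntrees n.
Proof.
have := ntrees_bin n; case: (ntrees n) => // /esym; rewrite muln0 => /eqP.
by rewrite -leqn0 leqNgt bin_gt0 leq_pmull.
Qed.

(** The binomial expansion of (1 + q)^((q+1)n) has (q + 1) n + 1 terms, and the term of
    index n is the largest: n is the mean number of successes in (q + 1) n trials with
    success rate 1 / (q + 1). *)
Lemma bin_exp_ge n : q.+1 ^ (q.+1 * n) <=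
  (q.+1 * n).+1 * ('C(q.+1 * n, n) * q ^ (q * n)).
Proof.
set N := q.+1 * n; pose T j := 'C(N, j) * q ^ (N - j).
have eT : T n = 'C(N, n) * q ^ (q * n) by rewrite /T; congr (_ * q ^ _); rewrite /N; nia.
rewrite -eT.
have step j : j < N -> j.+1 * T j.+1 * q = (N - j) * T j.
  move=> hj; rewrite /T; have -> : q ^ (N - j) = q * q ^ (N - j.+1).
    by rewrite -expnS -subSn.
  transitivity (j.+1 * 'C(N, j.+1) * (q * q ^ (N - j.+1))); first by ring.
  by rewrite mul_bin_left; ring.
have up d : d <= n -> T (n - d) <= T n.
  elim: d => [|d IH] hd; first by rewrite subn0.
  apply: leq_trans (IH (ltnW hd)).
  have hj : n - d.+1 < N by rewrite /N; nia.
  have := step _ hj; rewrite -subSn // subSS => e.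
  have h0 : 0 < (n - d) * q \/ q = 0 by case: (q) => [|?]; [right|left; nia].
  case: h0 => [h0|q0].
    rewrite -(leq_pmul2l h0); have -> : (n - d) * q * T (n - d) = (n - d) * T (n - d) * q by ring.
    by rewrite e leq_mul2r /N; apply/orP; right; nia.
  rewrite /T {1}q0 exp0n ?muln0 //; rewrite subn_gt0 //.
have down d : n + d <= N -> T (n + d) <= T n.
  elim: d => [|d IH] hd; first by rewrite addn0.
  rewrite addnS in hd *; apply: leq_trans (IH (ltnW hd)).
  have e := step _ hd.
  have h0 : 0 < q by move: hd; rewrite /N; case: (q) => //; lia.
  have h1 : 0 < (n + d).+1 * q by rewrite muln_gt0.
  rewrite -(leq_pmul2l h1) mulnAC e leq_mul2r; apply/orP; right.
  by rewrite /N; nia.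
have hT j : j <= N -> T j <= T n.
  move=> hj; case: (leqP j n) => h.
    by rewrite -(subKn h) up // leq_subr.
  by rewrite -(subnKC (ltnW h)) down // subnKC // ltnW.
have -> : q.+1 ^ N = \sum_(i < N.+1) T i.
  by rewrite -addn1 expnDn; apply: eq_bigr => i _; rewrite exp1n muln1.
apply: leq_trans (_ : \sum_(i < N.+1) T n <= _).
  by apply: leq_sum => i _; apply: hT; rewrite -ltnS.
by rewrite sum_nat_const card_ord.
Qed.

Lemma bin_exp_le n : 'C(q.+1 * n, n) * q ^ (q * n) <= q.+1 ^ (q.+1 * n).
Proof.
set N := q.+1 * n.
have hn : n < N.+1 by rewrite /N; nia.
rewrite -[q.+1 in leqRHS]addn1 expnDn (bigD1 (Ordinal hn)) //= exp1n muln1.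
have -> : N - n = q * n by rewrite /N; nia.
exact: leq_addr.
Qed.

(** By [bin_exp_ge] and [bin_exp_le] the count is G^n up to a polynomial factor, with
    G = (q + 1)^(q + 1) / q^q, so cutting n into two parts costs only such a factor. *)
Lemma ntrees_submult n b : 0 < q -> b <= n ->
  ntrees n <= (q.+1 * n).+1 ^ 4 * (ntrees b * ntrees (n - b)).
Proof.
move=> q0 hb; set M := (q.+1 * n).+1.
have h : 'C(q.+1 * n, n) <= M * M * ('C(q.+1 * b, b) * 'C(q.+1 * (n - b), n - b)).
  have hq : 0 < q ^ (q * n) by rewrite expn_gt0 q0.
  rewrite -(leq_pmul2r hq); apply: leq_trans (bin_exp_le n) _.
  rewrite -{1}(subnKC hb) mulnDr expnD.
  apply: leq_trans (leq_mul (bin_exp_ge b) (bin_exp_ge (n - b))) _.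
  have e : q ^ (q * n) = q ^ (q * b) * q ^ (q * (n - b)).
    by rewrite -expnD -mulnDr subnKC.
  rewrite e.
  set x := 'C(_, b); set y := 'C(_, _); set z := q ^ _; set z' := q ^ _.
  apply: leq_trans (_ : M * M * (x * z * (y * z')) <= _); last by apply/eq_leq; ring.
  rewrite mulnACA leq_mul2r leq_mul ?orbT // ltnS leq_mul2l ?leq_subr ?hb ?orbT //.
apply: leq_trans (_ : 'C(q.+1 * n, n) <= _).
  by rewrite -ntrees_bin leq_pmull.
apply: leq_trans h _; rewrite -!ntrees_bin.
apply: leq_trans (_ : M * M * (M * ntrees b * (M * ntrees (n - b))) <= _); last by apply/eq_leq; rewrite /expn /=; ring.
rewrite leq_mul2l; apply/orP; right.
by apply: leq_mul; rewrite leq_mul2r ltnS; apply/orP; right; nia.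
Qed.

Lemma ntrees_le_exp n : ntrees n <= 2 ^ (q.+1 * n).+1.
Proof.
rewrite /ntrees /nforests size_filter; apply: leq_trans (count_size _ _) _.
by rewrite size_map -cardE card_tuple card_bool addn1.
Qed.

End Count.

(** * Grafting, and trees with a prescribed subtree *)

Section Graft.
Variable q : nat.
Implicit Types (j i n : nat) (w s t x y A B : bitseq).

(** Replaces leaf number [u] of [s], counted from 0, by [t]. *)
Fixpoint graft s u t : bitseq :=
  match s with
  | [::] => [::]
  | true :: s' => true :: graft s' u t
  | false :: s' => if u is u'.+1 then false :: graft s' u' t else t ++ s'
  end.

Lemma graft_cat x y u t :
  graft (x ++ y) u t =
    if u < leaves x then graft x u t ++ y else x ++ graft y (u - leaves x) t.
Proof.
elim: x u => [|[] x IH] u /=; rewrite ?subn0 //.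
  by rewrite lnE IH add0n; case: ifP.
by case: u => [|u]; rewrite lnE ?catA //= add1n ltnS subSS IH; case: ifP.
Qed.

Lemma graft_mid x y t : graft (x ++ false :: y) (leaves x) t = x ++ t ++ y.
Proof. by rewrite graft_cat ltnn subnn. Qed.

Lemma leaf_split s u : u < leaves s ->
  exists x y, s = x ++ false :: y /\ leaves x = u.
Proof.
elim: s u => [//|[] s IH] u; rewrite lnE /=.
  by move=> /IH[x [y [-> <-]]]; exists (true :: x), y.
case: u => [|u]; first by exists [::], s.
by rewrite add1n ltnS => /IH[x [y [-> <-]]]; exists (false :: x), y.
Qed.

Lemma nodes_graft s u t : u < leaves s -> nodes (graft s u t) = nodes s + nodes t.
Proof. by move=> /leaf_split[x [y [-> <-]]]; rewrite graft_mid !lnE /=; lia. Qed.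

Lemma forest_graft j s u t : forest q j s -> forest q 1 t -> forest q j (graft s u t).
Proof.
move=> hs ht; case: (ltnP u (leaves s)) => hu.
  move: hs; have [x [y [-> <-]]] := leaf_split hu; rewrite graft_mid -cat1s.
  rewrite /forest !run_cat; case: (run q j x) => [l|] //=.
  case: l => [//|l]; rewrite -/(forest q l y) => /(forest_cat ht).
  by rewrite add1n /forest run_cat.
suff -> : graft s u t = s by [].
elim: s u hu {hs} => [//|[] s IH] u; rewrite lnE /=; first by move/IH ->.
by case: u => // u; rewrite add1n ltnS => /IH ->.
Qed.

Lemma graft_tree s u t a b : u < leaves s ->
  s \in trees q b -> t \in trees q a -> graft s u t \in trees q (a + b).
Proof.
move=> hu /forestsP[hs ns] /forestsP[ht nt]; apply/forestsP; split.
  exact: forest_graft.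
by rewrite nodes_graft // ns nt addnC.
Qed.

Lemma leaves_trees n w : w \in trees q n -> leaves w = (q * n).+1.
Proof. by case/forestsP=> /leaves_forest -> <-; rewrite add1n. Qed.

(** Two subtrees with the same first leaf are nested, hence equal when they have the same
    size. *)
Lemma subtree_unique x t y x' t' y' : x ++ t ++ y = x' ++ t' ++ y' ->
  forest q 1 t -> forest q 1 t' -> leaves x = leaves x' -> nodes t = nodes t' ->
  [/\ x = x', t = t' & y = y'].
Proof.
wlog hs : x t y x' t' y' / size x <= size x'.
  move=> IH e ht ht' hl hn; case: (leqP (size x) (size x')) => h; first exact: IH.
  by case: (IH x' t' y' x t y) => //; apply: ltnW.
move=> e ht ht' hl hn; have [[z [ez _]]|[z [z' [ez et ey]]]] := subtree_nested e ht ht' hs.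
  by move: hl; rewrite ez !lnE (leaves_forest ht); lia.
have e0 : z ++ z' = [::].
  apply/nilP; rewrite /nilp size_cat !size_leaves_nodes.
  move: hl hn (leaves_forest ht) (leaves_forest ht'); rewrite ez et !lnE; lia.
by case: z z' e0 ez et ey => [|//] [|//] _ -> -> ->; rewrite !cats0.
Qed.

Lemma graft_inj s t s' t' u : u < leaves s -> u < leaves s' ->
  forest q 1 t -> forest q 1 t' -> nodes t = nodes t' ->
  graft s u t = graft s' u t' -> s = s' /\ t = t'.
Proof.
move=> /leaf_split[x [y [-> hx]]] /leaf_split[x' [y' [-> hx']]] ht ht' hn.
rewrite -{1}hx -{1}hx' !graft_mid => e.
by have [||-> -> ->] := subtree_unique e ht ht'; rewrite ?hx ?hx'.
Qed.

(** Grafting [t] at [u] shifts the later leaf [u'] by the number of leaves of [t] less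
    one. *)
Lemma graft_comm s u t u' t' : u < u' < leaves s ->
  graft (graft s u' t') u t = graft (graft s u t) (u' + leaves t - 1) t'.
Proof.
case/andP=> hu hu'; have [x [y [es hx]]] := leaf_split hu'; subst s.
rewrite -hx in hu *; have [x1 [y1 [ex hx1]]] := leaf_split hu; subst x; rewrite -hx1.
rewrite graft_mid -!catA cat_cons graft_mid.
rewrite cat_cons graft_mid.
rewrite (_ : x1 ++ t ++ y1 ++ false :: y = (x1 ++ t ++ y1) ++ false :: y); last by rewrite -!catA.
have -> : leaves (x1 ++ false :: y1) + leaves t - 1 = leaves (x1 ++ t ++ y1) by rewrite !lnE /=; lia.
by rewrite graft_mid -!catA.
Qed.

Lemma graft_nest s u t v t' : u < leaves s -> v < leaves t ->
  graft s u (graft t v t') = graft (graft s u t) (u + v) t'.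
Proof.
move=> /leaf_split[x [y [-> <-]]] hv; rewrite !graft_mid.
rewrite graft_cat ltnNge leq_addr /= addKn; congr (_ ++ _).
by rewrite graft_cat hv.
Qed.

(** For a legal [slot] (u, a) these are the trees with [n] internal nodes having a
    subtree with [a] internal nodes whose first leaf has number [u] ([mem_grafts]). *)
Definition grafts n u a : seq bitseq :=
  [seq graft s u t | s <- trees q (n - a), t <- trees q a].

(** The leaf number [u] exists in a tree with n - a internal nodes. *)
Definition slot n (d : nat * nat) := (d.2 <= n) && (d.1 <= q * (n - d.2)).

Lemma size_grafts n u a : size (grafts n u a) = ntrees q a * ntrees q (n - a).
Proof. by rewrite size_allpairs mulnC. Qed.

Lemma mem_grafts n u a w : slot n (u, a) ->
  (w \in grafts n u a) <->
  exists x t y, [/\ w = x ++ t ++ y, forest q 1 t, nodes t = a, leaves x = u & w \in trees q n].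
Proof.
move=> /andP[/= ha hu]; split.
  case/allpairsP=> -[s t] /= [hs ht ->].
  have hus : u < leaves s by rewrite (leaves_trees hs) ltnS.
  have hw : graft s u t \in trees q n by rewrite -(subnKC ha); apply: graft_tree.
  have [x [y [es hx]]] := leaf_split hus.
  case/forestsP: ht => ft nt; exists x, t, y; split=> //; by rewrite es -hx graft_mid.
case=> x [t [y [ew ft nt hx /forestsP[fw nw]]]].
apply/allpairsP; exists (x ++ false :: y, t); split=> /=; last by rewrite -hx graft_mid.
  apply/forestsP; split; last by rewrite -nw ew !lnE; lia.
  move: fw; rewrite ew /forest !run_cat; case E: (run q 1 x) => [l|] //=.
  rewrite run_cat; case: l E => [|l] _; last first.
    by move/eqP: ft => /(run_addl l); rewrite addn1 addn0 => ->.
  by case: (t) ft.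
exact/forestsP.
Qed.

Lemma sub_grafts n u a : slot n (u, a) -> {subset grafts n u a <= trees q n}.
Proof. by move=> h w /(mem_grafts _ h)[x [t [y []]]]. Qed.

Lemma uniq_grafts n u a : slot n (u, a) -> uniq (grafts n u a).
Proof.
move=> /andP[/= ha hu]; apply: allpairs_uniq; rewrite ?uniq_forests //.
move=> [s t] [s' t'] /allpairsP[[? ?] [/= hs ht [-> ->]]] /allpairsP[[? ?] [/= hs' ht' [-> ->]]].
move=> /= e; case/forestsP: (ht) => ft nt; case/forestsP: (ht') => ft' nt'.
have [|||-> ->] := graft_inj _ _ ft ft' _ e => //.
- by rewrite (leaves_trees hs) ltnS.
- by rewrite (leaves_trees hs') ltnS.
- by rewrite nt nt'.
Qed.

(** Graft into one tree both subtrees: the classes of two slots that are far enough apart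
    share a product of three sets of trees. *)
Lemma grafts_disjoint n u a v b : slot n (u, a) -> slot n (v, b) -> u + (q * a).+1 <= v ->
  exists I : seq bitseq, [/\ uniq I, {subset I <= grafts n u a}, {subset I <= grafts n v b}
    & size I = ntrees q a * (ntrees q b * ntrees q (n - a - b))].
Proof.
move=> sa sb huv.
case/andP: (sa) => /= ha hu; case/andP: (sb) => /= hb hv.
pose v' := v - q * a.
have hab : a + b <= n by nia.
have sb' : slot (n - a) (v', b) by apply/andP; rewrite /v' /=; split; nia.
exists [seq graft s u t | s <- grafts (n - a) v' b, t <- trees q a]; split.
- apply: allpairs_uniq; rewrite ?uniq_forests ?uniq_grafts //.
  move=> [s t] [s' t'] /allpairsP[[? ?] [/= hs ht [-> ->]]] /allpairsP[[? ?] [/= hs' ht' [-> ->]]].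
  move=> /= e; case/forestsP: (ht) => ft nt; case/forestsP: (ht') => ft' nt'.
  move/(sub_grafts sb') in hs; move/(sub_grafts sb') in hs'.
  have [|||-> ->] := graft_inj _ _ ft ft' _ e => //.
  + by rewrite (leaves_trees hs) ltnS.
  + by rewrite (leaves_trees hs') ltnS.
  + by rewrite nt nt'.
- move=> w /allpairsP[[s t] [/= hs ht ->]]; apply/allpairsP; exists (s, t); split=> //.
  exact: sub_grafts hs.
- move=> w /allpairsP[[s t] [/= /allpairsP[[r t'] [/= hr ht' ->]] ht ->]].
  have hlr := leaves_trees hr; have hlt := leaves_trees ht.
  rewrite graft_comm ?hlr; last by rewrite /v'; apply/andP; split; nia.
  apply/allpairsP; exists (graft r u t, t'); split=> //=.
    have -> : n - b = a + (n - a - b) by lia.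
    by apply: graft_tree => //; rewrite hlr; move: huv hv; nia.
  by rewrite hlt /v'; congr graft; lia.
- by rewrite size_allpairs size_grafts mulnC.
Qed.

(** As [grafts_disjoint], with the subtree of the second slot grafted into that of the
    first. *)
Lemma grafts_nested n u a v b : slot n (u, a) -> slot a (v, b) ->
  exists I : seq bitseq, [/\ uniq I, {subset I <= grafts n u a}, {subset I <= grafts n (u + v) b}
    & size I = ntrees q b * ntrees q (a - b) * ntrees q (n - a)].
Proof.
move=> sa sb; case/andP: (sa) => /= ha hu; case/andP: (sb) => /= hb hv.
exists [seq graft s u t | s <- trees q (n - a), t <- grafts a v b]; split.
- apply: allpairs_uniq; rewrite ?uniq_forests ?uniq_grafts //.
  move=> [s t] [s' t'] /allpairsP[[? ?] [/= hs ht [-> ->]]] /allpairsP[[? ?] [/= hs' ht' [-> ->]]].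
  move=> /= e; move/(sub_grafts sb) in ht; move/(sub_grafts sb) in ht'.
  case/forestsP: (ht) => ft nt; case/forestsP: (ht') => ft' nt'.
  have [|||-> ->] := graft_inj _ _ ft ft' _ e => //.
  + by rewrite (leaves_trees hs) ltnS.
  + by rewrite (leaves_trees hs') ltnS.
  + by rewrite nt nt'.
- move=> w /allpairsP[[s t] [/= hs ht ->]]; apply/allpairsP; exists (s, t); split=> //.
  exact: sub_grafts ht.
- move=> w /allpairsP[[s t] [/= hs /allpairsP[[r t'] [/= hr ht' ->]] ->]].
  have hls := leaves_trees hs; have hlr := leaves_trees hr.
  rewrite graft_nest; [|by rewrite hls; lia|by rewrite hlr; lia].
  apply/allpairsP; exists (graft s u r, t'); split=> //=.
  have -> : n - b = a - b + (n - a) by lia.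
  by apply: graft_tree => //; rewrite hls ltnS.
- by rewrite size_allpairs size_grafts mulnC.
Qed.

(** A minimal subtree with at least [tau] internal nodes has children smaller than
    [tau], hence at most (q + 1) (tau - 1) + 1 internal nodes. *)
Lemma medium_subtree tau j w : 0 < tau -> forest q j w ->
  nodes w <= j * tau.-1 \/
  exists x t y, [/\ w = x ++ t ++ y, forest q 1 t &
                 tau <= nodes t <= (q.+1 * tau.-1).+1].
Proof.
move=> tau0; move: j w; apply: forest_ind => [|j w hw IH|j u v hu IHu hv IHv].
- by left.
- case: IH => [IH|[x [t [y [-> ht hn]]]]]; [left|right]; first by rewrite lnE; nia.
  by exists (false :: x), t, y.
- case: IHu => [IHu|[x [t [y [-> ht hn]]]]]; last first.
    by right; exists (true :: x), t, (y ++ v); rewrite /= -!catA.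
  case: (leqP tau (nodes (true :: u))) => hn.
    right; exists [::], (true :: u), v; split=> //; first by rewrite forest_node addn0.
    by move: hn; rewrite lnE => ->; rewrite add1n ltnS.
  case: IHv => [IHv|[x [t [y [-> ht hn']]]]]; [left|right].
    by move: hn; rewrite -cat_cons !lnE; nia.
  by exists (true :: u ++ x), t, y; rewrite /= -!catA.
Qed.

Definition balanced n a := (n <= 2 * q.+2 * a) && (2 * q.+2 * a <= (2 * q.+2 - 1) * n).

Lemma balanced_subtree n w : 2 <= n -> w \in trees q n ->
  exists u a, [/\ slot n (u, a), balanced n a & w \in grafts n u a].
Proof.
move=> hn hw; case/forestsP: (hw) => fw nw.
(* the least integer that is at least n / (2 (q + 2)) *)
pose tau := ((n - 1) %/ (2 * q.+2)).+1.
have htau : 2 * q.+2 * tau.-1 <= n - 1 by rewrite /tau /= mulnC leq_trunc_div.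
have htau2 : n <= 2 * q.+2 * tau.
  have := ltn_ceil (n - 1) (isT : 0 < 2 * q.+2); rewrite -/tau mulnC; lia.
have [h|[x [t [y [ew ft /andP[h1 h2]]]]]] := medium_subtree (isT : 0 < tau) fw.
  by exfalso; move: h htau; rewrite nw mul1n; nia.
have hsl : slot n (leaves x, nodes t).
  have := leaves_trees hw; move: nw; rewrite ew !lnE (leaves_forest ft) => nw hl.
  apply/andP; split=> /=; first by lia.
  by rewrite mulnBr; lia.
exists (leaves x), (nodes t); split=> //; last by apply/mem_grafts => //; exists x, t, y.
apply/andP; split; first by nia.
by move: htau h2; set T := tau.-1; move: (nodes t) => a; nia.
Qed.

End Graft.

(** * Rotations of trees *)

Section Rotation.
Variable q : nat.
Implicit Types (j i n : nat) (w s t x y A B : bitseq).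

(** Contracting the edge between two internal nodes leaves one node with 2q + 1 subtrees,
    whose word is [A ++ B].  The lower node can be put back so as to take over q + 1
    consecutive ones, and [i] is its position among the children of the upper node.  The
    letter [true] in front of [B] is the lower node.  A rotation is allowed to do
    nothing. *)
Variant rotation w w' : Prop :=
  Rotation x y A B A' B' i i' of
    w = x ++ (true :: A ++ true :: B) ++ y &
    w' = x ++ (true :: A' ++ true :: B') ++ y &
    A ++ B = A' ++ B' &
    forest q i A & forest q i' A' & i <= q & i' <= q &
    forest q (q + q.+1) (A ++ B).

Lemma rotation_sym w w' : rotation w w' -> rotation w' w.
Proof.
case=> x y A B A' B' i i' e e' eAB hA hA' hi hi' hAB.
by apply: (Rotation e' e (esym eAB) hA' hA hi' hi); rewrite -eAB.
Qed.

Lemma forest_rotation_node A B i : forest q i A -> i <= q -> forest q (q + q.+1) (A ++ B) ->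
  forest q q.+1 (A ++ true :: B).
Proof.
move=> hA hi; have -> : q + q.+1 = i + (q.+1 + (q - i)) by lia.
move=> /(forest_cat_r hA) hB; have -> : q.+1 = i + (q - i).+1 by lia.
exact: forest_cat.
Qed.

Lemma rotation_trees n w w' : rotation w w' -> w \in trees q n -> w' \in trees q n.
Proof.
case=> x y A B A' B' i i' -> -> eAB hA hA' hi hi' hAB /forestsP[fw nw].
have nAB : nodes A + nodes B = nodes A' + nodes B' by rewrite -!nodes_cat eAB.
apply/forestsP; split; last by rewrite -nw !lnE; lia.
have h1 : forest q 1 (true :: A ++ true :: B).
  by rewrite forest_node addn0; apply: (forest_rotation_node hA).
have h2 : forest q 1 (true :: A' ++ true :: B').
  by rewrite forest_node addn0; apply: (forest_rotation_node hA'); rewrite -?eAB.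
move: fw h1 h2; rewrite /forest !(run_cat _ _ x).
case: (run q 1 x) => [l|//]; set T := true :: _; set T' := true :: _.
rewrite -![obind _ (Some l)]/(run q l (_ ++ y)) !run_cat => + h1 h2.
case: l => [//|l]; rewrite -addn1.
by move/eqP: h1 => /(run_addl l) ->; move/eqP: h2 => /(run_addl l) ->.
Qed.

Lemma rotation_context x y w w' : rotation w w' -> rotation (x ++ w ++ y) (x ++ w' ++ y).
Proof.
case=> x0 y0 A B A' B' i i' -> -> eAB hA hA' hi hi' hAB.
by apply: (@Rotation _ _ (x ++ x0) (y0 ++ y) A B A' B' i i') => //; rewrite -!catA.
Qed.

Lemma rotation_graft_r s u t t' : u < leaves s -> rotation t t' ->
  rotation (graft s u t) (graft s u t').
Proof.
move=> /leaf_split[x [y [-> <-]]]; rewrite !graft_mid; exact: rotation_context.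
Qed.

Lemma rotation_graft_l s s' u t : forest q 1 t -> rotation s s' ->
  rotation (graft s u t) (graft s' u t).
Proof.
move=> ht [x y A B A' B' i i' -> -> eAB hA hA' hi hi' hAB].
have eqn := congr1 leaves eAB; rewrite !lnE in eqn.
rewrite !(graft_cat x); case: ifP => _.
  by apply: (@Rotation _ _ (graft x u t) y A B A' B' i i').
move: (u - leaves x) => {}u.
have eln : leaves (true :: A ++ true :: B) = leaves (true :: A' ++ true :: B').
  by rewrite !lnE; lia.
rewrite !(graft_cat _ y) eln; case: ifP => _; last exact: (@Rotation _ _ x _ A B A' B' i i').
pose f D := if u < leaves D then graft D u t else D.
pose g D E := if u < leaves D then E else graft E (u - leaves D) t.
have fg D E : f D ++ g D E = graft (D ++ E) u t.
  by rewrite /f /g graft_cat; case: ifP.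
have fg' D E : f D ++ true :: g D E = graft (D ++ true :: E) u t.
  by rewrite /f /g graft_cat; case: ifP.
have hf j D : forest q j D -> forest q j (f D).
  by move=> hD; rewrite /f; case: ifP => // _; apply: forest_graft.
apply: (@Rotation _ _ x y (f A) (g A B) (f A') (g A' B') i i') => //.
- by rewrite fg'.
- by rewrite fg'.
- by rewrite !fg eAB.
- exact: hf.
- exact: hf.
- by rewrite fg; apply: forest_graft.
Qed.

(** Every internal node but the root is the first child of its parent. *)
Definition comb n : bitseq := nseq n true ++ nseq (q * n).+1 false.

(** The number of pairs of a leaf and a later internal node. *)
Fixpoint inversions w :=
  if w is b :: w' then (if b then 0 else nodes w') + inversions w' else 0.

Lemma inversions_cat u v :
  inversions (u ++ v) = inversions u + inversions v + leaves u * nodes v.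
Proof.
elim: u => [|b u IH] /=; first by rewrite /leaves /= mul0n addn0.
by case: b; rewrite IH !lnE; lia.
Qed.

Lemma forest_no_nodes j r : forest q j r -> nodes r = 0 -> r = nseq j false.
Proof.
elim: r j => [|b r IH] [|j] //.
by case: b => //; rewrite forest_leaf lnE /= => /IH h /h ->.
Qed.

Lemma first_node j r : forest q j r -> nodes r <> 0 ->
  exists i r', [/\ r = nseq i false ++ true :: r', i < j & forest q (q.+1 + (j - i.+1)) r'].
Proof.
elim: r j => [|b r IH] [|j] //; case: b.
  by rewrite forest_node => hr _; exists 0, r; split=> //; rewrite subn1.
by rewrite forest_leaf lnE /= => /IH h /h [i [r' [-> hi hr]]]; exists i.+1, r'.
Qed.

(** Turning an internal child into the first child moves leaves behind it, so it removes
    inversions; only the comb offers no such move. *)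
Lemma comb_or_rotation w : forest q 1 w ->
  w = comb (nodes w) \/ exists2 w', rotation w w' & inversions w' < inversions w.
Proof.
move: {2}(size w) (leqnn (size w)) => l; elim: l w => [|l IH] w.
  by rewrite leqn0 => /nilP ->.
move=> hl /tree_cases[->|[u ew hu]]; first by left; rewrite /comb muln0.
have [t [r [eu ht hr]]] := tree_split hu; subst u.
have [r0|rn0] := eqVneq (nodes r) 0.
  have er := forest_no_nodes hr r0.
  have hlt : size t <= l by move: hl; rewrite ew /= size_cat; lia.
  have [et|[t' ht' hi]] := IH t hlt ht.
    left; rewrite ew lnE nodes_cat r0 addn0 {1}et er /comb.
    by rewrite add1n mulnS -addnS addnC nseqD catA.
  right; exists ([:: true] ++ t' ++ r); first by rewrite ew -cat1s; apply: rotation_context.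
  rewrite ew /= !inversions_cat.
  have [hn hlv] : nodes t' = nodes t /\ leaves t' = leaves t.
    case: ht' => x y A B A' B' i i' -> -> eAB *.
    have := congr1 leaves eAB; have := congr1 nodes eAB.
    by rewrite !lnE; lia.
  by rewrite hlv; lia.
have [i [r' [er hi hr']]] := first_node hr (elimN eqP rn0).
have hA : forest q i.+1 (t ++ nseq i false).
  rewrite -add1n; apply: forest_cat => //.
  by elim: (i) => //= k IHk; rewrite forest_leaf.
(* the first internal node among the later children moves to the first position *)
right; exists (true :: true :: (t ++ nseq i false) ++ r').
  apply: (@Rotation _ _ [::] [::] (t ++ nseq i false) r' [::] ((t ++ nseq i false) ++ r') i.+1 0) => //.
  - by rewrite ew er cats0 -!catA.
  - by rewrite cats0.
  - have -> : q + q.+1 = i.+1 + (q.+1 + (q - i.+1)) by lia.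
    exact: forest_cat.
have hD := leaves_forest hA; rewrite ew er catA /=; move: (t ++ _) hD => D hD.
by rewrite !inversions_cat /= !lnE hD; nia.
Qed.

End Rotation.

(** * The leaf intervals of a tree *)

Section Spans.
Variable q : nat.
Implicit Types (a c d i j n : nat) (w s t u v x y A B : bitseq).

(** Some node of [w] has below it exactly the leaves c, ..., d - 1, when the leaves of [w]
    are numbered from [a] on.  With leaf number i placed on the polygon side from i to
    i + 1, this interval is the chord from c to d. *)
Variant spans a w c d : Prop :=
  Spans x t y of w = x ++ t ++ y & forest q 1 t & c = a + leaves x & d = c + leaves t.

Lemma leaves_tree_gt0 j t : forest q j.+1 t -> 0 < leaves t.
Proof. by move/leaves_forest => ->. Qed.

Lemma spans_range a w c d : spans a w c d -> [/\ a <= c, c < d & d <= a + leaves w].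
Proof.
by case=> x t y -> ht -> ->; have := leaves_tree_gt0 ht; rewrite !lnE; split; lia.
Qed.

Lemma spans_whole a t : forest q 1 t -> spans a t a (a + leaves t).
Proof.
by move=> ht; apply: (@Spans _ _ _ _ [::] t [::]); rewrite ?cats0 // /leaves addn0.
Qed.

Lemma spans_context a x w y c d : spans (a + leaves x) w c d -> spans a (x ++ w ++ y) c d.
Proof.
case=> x1 t y1 -> ht ec ed; apply: (@Spans _ _ _ _ (x ++ x1) t (y1 ++ y)) => //.
  by rewrite -!catA.
by rewrite ec lnE addnA.
Qed.

Lemma spans_cat i a A B c d : forest q i A ->
  spans a (A ++ B) c d <-> spans a A c d \/ spans (a + leaves A) B c d.
Proof.
move=> hA; split; last first.
  case=> h; first by apply: (@spans_context a [::] A B); rewrite /leaves addn0.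
  by have := @spans_context a A B [::] c d h; rewrite cats0.
case=> x t y e ht ec ed.
case: (leqP (size A) (size x)) => hs.
  right; have ex : x = A ++ drop (size A) x.
    rewrite -{1}(cat_take_drop (size A) x); congr (_ ++ _).
    by have := congr1 (take (size A)) e; rewrite take_size_cat // takel_cat.
  move: e; rewrite ex -catA => /eqP; rewrite eqseq_cat // eqxx => /eqP e.
  by apply: Spans e ht _ ed; rewrite ec {1}ex lnE addnA.
left; have eA : A = x ++ drop (size x) A.
  rewrite -{1}(cat_take_drop (size x) A); congr (_ ++ _).
  by have := congr1 (take (size x)) e; rewrite takel_cat ?(ltnW hs) // take_size_cat.
move: hA; rewrite eA => /forest_suffix[[|j] _ hr].
  by move: (congr1 size eA); rewrite (forest0 hr) cats0 => e1; rewrite e1 ltnn in hs.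
have [t2 [z [er ht2 hz]]] := tree_split hr.
move: e; rewrite eA -catA => /eqP; rewrite eqseq_cat // eqxx er -catA => /eqP e.
have [e1 e2] := forest_prefix ht2 ht e; subst t2.
by apply: (@Spans _ _ _ _ x t z) => //; rewrite -er -eA.
Qed.

Lemma spans_leaf a c d : spans a [:: false] c d <-> c = a /\ d = a.+1.
Proof.
split=> [|[-> ->]]; last first.
  have h : forest q 1 [:: false] by [].
  by have := spans_whole a h; rewrite /leaves /= addn0 addn1.
by case/spans_range; rewrite /leaves /=; lia.
Qed.

Lemma spans_node a u c d : forest q q.+1 u ->
  spans a (true :: u) c d <-> (c = a /\ d = a + leaves u) \/ spans a u c d.
Proof.
move=> hu; have ht : forest q 1 (true :: u) by rewrite forest_node addn0.
split.
  case=> -[|b x] t y /= e ht' ec ed.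
    left; have [e1 _] : true :: u = t /\ [::] = y.
      by apply: (forest_prefix ht ht'); rewrite cats0.
    by move: ed; rewrite ec -e1 !lnE /leaves /=; lia.
  by right; case: e ec => <- e; rewrite lnE => ec; apply: (@Spans _ _ _ _ x t y).
case=> [[-> ->]|h]; first exact: (spans_whole a ht).
have := @spans_context a [:: true] u [::] c d; rewrite cats0; apply.
have -> : leaves [:: true] = 0 by [].
by rewrite addn0.
Qed.

Lemma spans_not_full j a u : 2 <= j -> forest q j u -> ~ spans a u a (a + leaves u).
Proof.
move=> hj hu [x t y e ht ec ed].
have := leaves_forest hu; have := leaves_forest ht.
have : nodes t <= nodes u by rewrite e !lnE; lia.
rewrite -(leq_pmul2l (isT : 0 < 1)) !mul1n => h; have := leq_mul (leqnn q) h; lia.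
Qed.

(** The intervals of nested or disjoint subtrees do not cross. *)
Lemma spans_laminar a w c d c' d' : spans a w c d -> spans a w c' d' ->
  c < c' -> c' < d -> d' <= d.
Proof.
case=> x t y e ht ec ed [x' t' y' e' ht' ec' ed'] h1 h2.
case: (leqP (size x) (size x')) => hs.
  have [[z [ex ey]]|[z [z' [ex et ey]]]] := subtree_nested (etrans (esym e) e') ht ht' hs.
    by move: ec'; rewrite ex !lnE; lia.
  by move: ec' ed ed'; rewrite ex et !lnE; lia.
have [[z [ex ey]]|[z [z' [ex et ey]]]] := subtree_nested (etrans (esym e') e) ht' ht (ltnW hs).
  by move: ec; rewrite ex !lnE; lia.
by move: ec; rewrite ex !lnE; lia.
Qed.

(** For positive q an internal node has more leaves than each of its children, so an
    interval within that of [t] belongs to a node of [t]. *)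
Lemma spans_local a x t y c d : 0 < q -> forest q 1 t -> spans a (x ++ t ++ y) c d ->
  a + leaves x <= c -> d <= a + leaves x + leaves t -> spans (a + leaves x) t c d.
Proof.
move=> q0 ht [x' t' y' e ht' ec ed] h1 h2.
have l0 := leaves_tree_gt0 ht'; have l1 := leaves_tree_gt0 ht.
case: (leqP (size x) (size x')) => hs.
  have [[z [ex ey]]|[z [z' [ex et ey]]]] := subtree_nested e ht ht' hs.
    by move: ec; rewrite ex !lnE; lia.
  by apply: (Spans et ht' _ ed); rewrite ec ex lnE addnA.
have [[z [ex ey]]|[z [z' [ex et ey]]]] := subtree_nested (esym e) ht' ht (ltnW hs).
  by exfalso; move: h1; rewrite ec ex !lnE; lia.
exfalso; have := leaves_forest ht; have := leaves_forest ht'.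
have : 0 < size z.
  by move: hs; rewrite ex size_cat; lia.
have lz : leaves z = 0 by move: h1; rewrite ec ex lnE; lia.
rewrite size_leaves_nodes lz => nz; move: h2; rewrite ed ec ex et !lnE lz.
nia.
Qed.

(** The longest interval that starts at the first leaf belongs to the first tree.  Take
    off its root, whose interval is longer than those of the children as q is positive,
    and continue. *)
Lemma spans_inj j j' a s s' : 0 < q -> forest q j s -> forest q j' s' ->
  leaves s = leaves s' -> (forall c d, spans a s c d <-> spans a s' c d) -> s = s'.
Proof.
move=> q0; move: {2}(size s) (leqnn (size s)) => l.
elim: l j j' a s s' => [|l IH] j j' a s s'.
  rewrite leqn0 => /nilP -> _ hs' hl _; case: j' hs' => [/forest0 //|j' hs'].
  by have := leaves_tree_gt0 hs'; rewrite -hl.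
case: j => [_ /forest0 -> hs' hl _|j].
  case: j' hs' => [/forest0 //|j' hs'].
  by have := leaves_tree_gt0 hs'; rewrite -hl.
case: j' => [_ hs /forest0 -> hl _|j'].
  by have := leaves_tree_gt0 hs; rewrite hl.
move=> hsz /tree_split[t [r [es ht hr]]] /tree_split[t' [r' [es' ht' hr']]] hl hsp.
subst s s'; have l1 := leaves_tree_gt0 ht; have l1' := leaves_tree_gt0 ht'.
have elt : leaves t = leaves t'.
  apply/eqP; rewrite eqn_leq; apply/andP; split.
    have /(spans_cat _ _ _ _ ht')[/spans_range[]|/spans_range[]] : spans a (t' ++ r') a (a + leaves t).
    - by apply/hsp/(spans_cat _ _ _ _ ht); left; apply: spans_whole.
    - lia.
    - lia.
  have /(spans_cat _ _ _ _ ht)[/spans_range[]|/spans_range[]] : spans a (t ++ r) a (a + leaves t').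
  - by apply/hsp/(spans_cat _ _ _ _ ht'); left; apply: spans_whole.
  - lia.
  - lia.
have hspt c d : spans a t c d <-> spans a t' c d.
  split=> h; have [_ _ hd] := spans_range h.
    have /hsp/(spans_cat _ _ _ _ ht')[//|] : spans a (t ++ r) c d.
      by apply/(spans_cat _ _ _ _ ht); left.
    by move/spans_range=> []; lia.
  have /hsp/(spans_cat _ _ _ _ ht)[//|] : spans a (t' ++ r') c d.
    by apply/(spans_cat _ _ _ _ ht'); left.
  by move/spans_range=> []; lia.
have hspr c d : spans (a + leaves t) r c d <-> spans (a + leaves t) r' c d.
  split=> h; have [hc hcd _] := spans_range h.
    have /hsp/(spans_cat _ _ _ _ ht')[|] : spans a (t ++ r) c d.
    - by apply/(spans_cat _ _ _ _ ht); right.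
    - by move/spans_range=> []; lia.
    - by rewrite elt.
  have /hsp/(spans_cat _ _ _ _ ht)[|//] : spans a (t' ++ r') c d.
    by apply/(spans_cat _ _ _ _ ht'); right; rewrite -elt.
  by move/spans_range=> []; lia.
move: hsz; rewrite size_cat => hsz.
have hts : 0 < size t by rewrite size_leaves_nodes; lia.
congr (_ ++ _); last first.
  by apply: (IH _ _ _ _ _ _ hr hr') hspr; [lia | move: hl; rewrite !lnE; lia].
case: (tree_cases ht) => [et|[u et hu]]; case: (tree_cases ht') => [et'|[u' et' hu']].
- by rewrite et et'.
- by move: elt; rewrite et et' !lnE (leaves_forest hu') /leaves /=; lia.
- by move: elt; rewrite et et' !lnE (leaves_forest hu) /leaves /=; lia.
subst t t'; congr cons; move: elt; rewrite !lnE !add0n => elt.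
apply: (IH _ _ a _ _ _ hu hu' elt); first by move: hsz => /=; lia.
move=> c d; split=> h.
  have /hspt/(spans_node _ _ _ hu')[[e1 e2]|//] : spans a (true :: u) c d.
    by apply/(spans_node _ _ _ hu); right.
  by case: (@spans_not_full q.+1 a u _ hu) => //; move: h; rewrite e1 e2 elt.
have /hspt/(spans_node _ _ _ hu)[[e1 e2]|//] : spans a (true :: u') c d.
  by apply/(spans_node _ _ _ hu'); right.
by case: (@spans_not_full q.+1 a u' _ hu') => //; move: h; rewrite e1 e2 elt.
Qed.

(** Replacing a subtree by another one with equally many leaves affects only intervals
    of nodes in that subtree. *)
Lemma spans_swap a x t t' y c d : forest q 1 t -> forest q 1 t' -> leaves t = leaves t' ->
  spans a (x ++ t ++ y) c d -> spans (a + leaves x) t c d \/ spans a (x ++ t' ++ y) c d.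
Proof.
move=> ht ht' el [x' t1 y' e ht1 ec ed].
case: (leqP (size x) (size x')) => hs.
  have [[z [ex ey]]|[z [z' [ex et ey]]]] := subtree_nested e ht ht1 hs.
    right; apply: (@Spans _ _ _ _ (x ++ t' ++ z) t1 y') => //.
      by rewrite ey -!catA.
    by rewrite ec ex !lnE el.
  by left; apply: (Spans et ht1 _ ed); rewrite ec ex lnE addnA.
have [[z [ex ey]]|[z [z' [ex et ey]]]] := subtree_nested (esym e) ht1 ht (ltnW hs).
  right; apply: (@Spans _ _ _ _ x' t1 (z ++ t' ++ y)) => //.
  by rewrite ex -!catA.
right; apply: (@Spans _ _ _ _ x' (z ++ t' ++ z') y') => //.
- by rewrite ex ey -!catA.
- move: ht1; rewrite et /forest !run_cat; case: (run q 1 z) => [m|] //=; rewrite !run_cat.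
  case: m => [|m]; first by case: (t) ht.
  by rewrite -addn1; move/eqP: ht => /(run_addl m) ->; move/eqP: ht' => /(run_addl m) ->.
- by rewrite ed et !lnE el.
Qed.

(** The intervals in a rotated subtree are that of the upper node, that of the lower node,
    and those of the 2q + 1 subtrees, which no rotation changes. *)
Lemma spans_rotation_node o A B i : forest q i A -> i <= q -> forest q (q + q.+1) (A ++ B) ->
  exists c0 d0, forall c d, spans o (true :: A ++ true :: B) c d <->
    [\/ c = o /\ d = o + leaves (A ++ B), c = c0 /\ d = d0 | spans o (A ++ B) c d].
Proof.
move=> hA hi hAB; have hu := forest_rotation_node hA hi hAB.
have : forest q (q.+1 + (q - i)) B.
  by apply: (forest_cat_r hA); have -> : i + (q.+1 + (q - i)) = q + q.+1 by lia.
move/forest_split => [B1 [B2 [eB hB1 hB2]]].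
have ht : forest q 1 (true :: B1) by rewrite forest_node addn0.
exists (o + leaves A), (o + leaves A + leaves B1) => c d.
have e1 := spans_node o c d hu; have e2 := spans_cat o (true :: B) c d hA.
have e3 := spans_cat (o + leaves A) B2 c d ht; have e4 := spans_cat o B c d hA.
have e5 := spans_cat (o + leaves A) B2 c d hB1; have e6 := spans_node (o + leaves A) c d hB1.
rewrite -eB in e5; rewrite cat_cons -eB lnE add0n in e3.
have el : leaves (A ++ true :: B) = leaves (A ++ B) by rewrite !lnE.
rewrite el in e1; split.
  move/e1 => [|/e2[|/e3[/e6[|]|]]]; by [constructor 1|constructor 2|constructor 3; tauto].
case; tauto.
Qed.

(** The upper node keeps its leaves in a rotation, so the only interval that can get lost
    is that of the lower node. *)
Lemma rotation_spans a w w' : rotation q w w' -> exists c0 d0, forall c d,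
  spans a w c d -> (c = c0 /\ d = d0) \/ spans a w' c d.
Proof.
case=> x y A B A' B' i i' -> -> eAB hA hA' hi hi' hAB.
have hAB' := hAB; rewrite eAB in hAB'.
have h1 : forest q 1 (true :: A ++ true :: B).
  by rewrite forest_node addn0; apply: (forest_rotation_node hA).
have h2 : forest q 1 (true :: A' ++ true :: B').
  by rewrite forest_node addn0; apply: (forest_rotation_node hA').
have el : leaves (true :: A ++ true :: B) = leaves (true :: A' ++ true :: B').
  by have := congr1 leaves eAB; rewrite !lnE; lia.
have [c0 [d0 h]] := spans_rotation_node (a + leaves x) hA hi hAB.
have [c1 [d1 h']] := spans_rotation_node (a + leaves x) hA' hi' hAB'.
exists c0, d0 => c d /(spans_swap h1 h2 el)[/h[h3|h3|h3]|]; [right|by left|right|by right].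
  by apply/spans_context/h'; constructor 1; rewrite -eAB.
by apply/spans_context/h'; constructor 3; rewrite -eAB.
Qed.

End Spans.

(** * Cells of a planar set of diagonals *)

Section Geometry.
Variable m : nat.
Implicit Types (p e : chord m) (F : {set 'I_m}) (T Q : {set chord m}) (a b c d x y z : 'I_m).

Lemma inner0P F x y :
  reflect (forall v, v \in F -> x < v -> v < y -> False) (inner_count F (x, y) == 0).
Proof.
rewrite cards_eq0; apply: (iffP eqP) => [h v vF h1 h2|h].
  by move/setP/(_ v): h; rewrite !inE vF /= h1 h2.
by apply/setP => v; rewrite !inE /=; apply/negP => /and3P[vF h1 h2]; apply: (h v).
Qed.

Lemma outer0P F x y :
  reflect (forall v, v \in F -> x <= v <= y) (outer_count F (x, y) == 0).
Proof.
rewrite cards_eq0; apply: (iffP eqP) => [h v vF|h].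
  by move/setP/(_ v): h; rewrite !inE vF /= => /negbT; lia.
apply/setP => v; rewrite !inE /=; apply/negP => /andP[vF].
by have := h v vF; lia.
Qed.

Definition drawn T x y := (x < y) && (polygon_side (x, y) || ((x, y) \in T)).

Definition planar T :=
  (forall p, p \in T -> diagonal p) /\ (forall p e, p \in T -> e \in T -> ~~ crossing p e).

Lemma cellP T F : reflect
  (2 < #|F| /\ forall x y, x \in F -> y \in F -> x < y ->
     ((inner_count F (x, y) == 0) || (outer_count F (x, y) == 0)) = drawn T x y)
  (cell T F).
Proof.
apply: (iffP andP) => [[h1 /forallP h]|[h1 h]]; split=> //.
  move=> x y xF yF xy; have := h (x, y); rewrite /side_of /drawn /= xF yF xy /=.
  by move/eqP.
by apply/forallP => -[x y] /=; apply/implyP => /and3P[/= xF yF xy];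
  rewrite /side_of /= xF yF xy /= h // /drawn xy.
Qed.

End Geometry.

(* The hypotheses cleared here are not arithmetic, and [lia] is slow to discard them. *)
Ltac nlia := repeat match goal with
  | H : is_true (_ \in _) |- _ => clear H
  | H : is_true (_ \notin _) |- _ => clear H
  | H : is_true (cell _ _) |- _ => clear H
  | H : is_true (_ != _) |- _ => clear H
  | H : is_true (~~ drawn _ _ _) |- _ => clear H
  | H : is_true (drawn _ _ _) |- _ => clear H
  | H : _ <> _ :> prod _ _ |- _ => clear H
  | H : _ = _ :> Finite.sort _ |- _ => clear H
  | H : forall _, _ |- _ => clear H
  end; lia.


Section Planar.
Variable m : nat.
Implicit Types (p e : chord m) (F : {set 'I_m}) (a b c d x y z : 'I_m).
Variable T : {set chord m}.
Hypothesis pT : planar T.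

Lemma diagonal_planar x y : (x, y) \in T -> x.+1 < y /\ ~ (x = 0 :> nat /\ y.+1 = m).
Proof. by move/pT.1; rewrite /diagonal /polygon_side /=; nlia. Qed.

Lemma drawn_in x y z : drawn T x y -> x < z < y ->
  ((x, y) \in T) || ((x == 0 :> nat) && (y.+1 == m)).
Proof. by rewrite /drawn /polygon_side /=; case: (_ \in T); nlia. Qed.

(** Polygon sides cross nothing, so this needs no case distinction between sides and
    diagonals. *)
Lemma drawn_cross x y c d : drawn T x y -> drawn T c d -> x < c -> c < y -> y < d -> False.
Proof.
move=> h1 h2 xc cy yd.
have := drawn_in h1 (introT andP (conj xc cy)).
have := drawn_in h2 (introT andP (conj cy yd)).
have := ltn_ord d.
case H1: (_ \in T); case H2: (_ \in T) => /=; try nlia.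
by have := pT.2 _ _ H2 H1; rewrite /crossing /= xc cy yd.
Qed.

Lemma drawn_T x y : (x, y) \in T -> drawn T x y.
Proof. by move=> h; rewrite /drawn h orbT andbT; have := diagonal_planar h; nlia. Qed.

Definition covered a b z :=
  [exists p in T, [&& p != (a, b), a <= p.1, p.1 < z, z < p.2 & p.2 <= b]].

Lemma coveredP a b z : reflect
  (exists c d, [/\ (c, d) \in T, (c, d) <> (a, b) & [/\ a <= c, c < z, z < d & d <= b]])
  (covered a b z).
Proof.
apply: (iffP existsP) => [[[c d]]|[c [d [h1 h2 [h3 h4 h5 h6]]]]].
  by case/andP=> h /and5P[/eqP h1 h2 h3 h4 h5]; exists c, d.
exists (c, d); rewrite h1 /=; apply/and5P; split=> //; exact/eqP.
Qed.

(** The cell below the chord from [a] to [b] consists of the points that no chord inside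
    separates from it. *)
Definition cell_below a b := [set z : 'I_m | (a <= z <= b) && ~~ covered a b z].

Lemma cell_below_l a b : a < b -> a \in cell_below a b.
Proof.
move=> ab; rewrite inE leqnn (ltnW ab); apply/coveredP => -[c [d [_ _ []]]]; nlia.
Qed.

Lemma cell_below_r a b : a < b -> b \in cell_below a b.
Proof.
move=> ab; rewrite inE leqnn (ltnW ab); apply/coveredP => -[c [d [_ _ []]]]; nlia.
Qed.

Lemma cell_below_range a b z : z \in cell_below a b -> a <= z <= b.
Proof. by rewrite inE => /andP[]. Qed.

Lemma cell_below_visible a b z c d : z \in cell_below a b -> (c, d) \in T ->
  (c, d) <> (a, b) -> a <= c -> d <= b -> c < z -> z < d -> False.
Proof.
by rewrite inE => /andP[_ /coveredP h] *; apply: h; exists c, d.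
Qed.

(** If [y] is not the successor of [x], the point x + 1 is hidden by a chord, which leaves
    from [x] because [x] is visible.  The longest chord leaving [x] ends at a visible
    point, and this point is [y]. *)
Lemma cell_below_gap a b x y : x \in cell_below a b -> y \in cell_below a b -> x < y ->
  (forall z, z \in cell_below a b -> x < z -> z < y -> False) ->
  x.+1 = y :> nat \/ ((x, y) \in T /\ (x, y) <> (a, b)).
Proof.
move=> hx hy xy hgap; case: (ltngtP x.+1 y) => [h||->]; [|nlia|by left].
right; have hz : x.+1 < m by have := ltn_ord y; nlia.
pose z : 'I_m := Ordinal hz.
have rx := cell_below_range hx; have ry := cell_below_range hy.
have : covered a b z.
  have [//|hn] := boolP (covered a b z); case: (hgap z) => //=.
  by rewrite inE hn andbT /=; nlia.
case/coveredP => c [d [hcd ncd /= [h1 h2 h3 h4]]].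
have ecx : c = x.
  apply: val_inj; apply/eqP; rewrite eqn_leq -ltnS h2 /= leqNgt; apply/negP => hcx.
  by apply: (cell_below_visible hx hcd) => //; nlia.
subst c.
pose P (d : 'I_m) := [&& (x, d) \in T, (x, d) != (a, b), x.+1 < d & d <= b].
have Pd : P d by apply/and4P; split=> //; apply/eqP.
have [d' /and4P[hd' /eqP nd' xd' db'] hmax] := arg_maxnP (fun d : 'I_m => d : nat) Pd.
have vd' : d' \in cell_below a b.
  rewrite inE; apply/andP; split; first nlia.
  apply/coveredP => -[c1 [d1 [h11 h12 [h13 h14 h15 h16]]]].
  have : c1 <= x.
    rewrite leqNgt; apply/negP => hc.
    exact: (drawn_cross (drawn_T hd') (drawn_T h11) hc h14 h15).
  rewrite leq_eqVlt => /orP[/eqP/val_inj e|hlt].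
    subst c1; have : P d1 by apply/and4P; split=> //; [apply/eqP | nlia].
    by move/hmax; nlia.
  by apply: (cell_below_visible hx h11) => //; nlia.
have : y <= d' by rewrite leqNgt; apply/negP => hh; apply: (hgap d') => //; nlia.
rewrite leq_eqVlt => /orP[/eqP/val_inj -> //|hlt].
by exfalso; apply: (cell_below_visible hy hd') => //; nlia.
Qed.

Lemma third_vertex F a b : 2 < #|F| ->
  exists2 v, v \in F & v <> a :> nat /\ v <> b :> nat.
Proof.
move=> hF; have /subsetPn[v vF] : ~~ (F \subset [set a; b]).
  by apply/negP => /subset_leq_card; rewrite cards2; case: (a != b); lia.
rewrite !inE negb_or => /andP[na nb]; exists v => //.
by split=> /val_inj; apply/eqP.
Qed.

Lemma next_in F x y : y \in F -> x < y ->
  exists z, [/\ z \in F, x < z, z <= y & forall v, v \in F -> x < v -> v < z -> False].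
Proof.
move=> yF xy; pose P (z : 'I_m) := (z \in F) && (x < z).
have Py : P y by rewrite /P yF.
have [z /andP[zF xz] hmin] := arg_minnP (fun d : 'I_m => d : nat) Py.
exists z; split=> //; first exact: hmin.
move=> v vF xv vz; have : P v by rewrite /P vF.
by move/hmin; nlia.
Qed.

Lemma cell_cell_below a b : drawn T a b -> a.+1 < b -> cell T (cell_below a b).
Proof.
move=> hab ab2; have ab : a < b by nlia.
have al := cell_below_l ab; have br := cell_below_r ab.
apply/cellP; split.
  have [y [hy ay yb hgap]] := next_in br ab.
  have nyb : y <> b.
    move=> e; subst y; have := cell_below_gap al br ab hgap.
    by case=> [e|[_ //]]; rewrite e ltnn in ab2.
  have : [set a; y; b] \subset cell_below a b.
    by apply/subsetP => z; rewrite !inE => /orP[/orP[]|] /eqP->; rewrite -[_ && _](in_set (fun z => (a <= z <= b) && ~~ covered a b z)).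
  move/subset_leq_card; apply: leq_trans.
  rewrite cardsU cardsU !cards1.
  have -> : [set a] :&: [set y] = set0 by apply/setP => z; rewrite !inE; apply/negP => /andP[/eqP-> /eqP e]; rewrite e ltnn in ay.
  have -> : [set a; y] :&: [set b] = set0.
    apply/setP => z; rewrite !inE; apply/negP => /andP[/orP[]/eqP-> /eqP e] //.
    by rewrite e ltnn in ab.
  by rewrite !cards0.
move=> x y hx hy xy.
have rx := cell_below_range hx; have ry := cell_below_range hy.
apply/orP/idP => [[]|].
- move/inner0P => h; rewrite /drawn xy /=.
  case: (cell_below_gap hx hy xy h) => [e|[-> _]]; last by rewrite orbT.
  by rewrite /polygon_side /= e eqxx.
- move/outer0P => h; have [-> ->] : x = a /\ y = b; last exact: hab.
  by split; apply: val_inj => /=; have := h _ al; have := h _ br; nlia.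
- case/andP=> _ /orP[|hT].
    rewrite /polygon_side /= => /orP[/eqP e|/andP[/eqP e1 /eqP e2]]; [left|right].
      by apply/inner0P => v _; nlia.
    by apply/outer0P => v _; have := ltn_ord v; nlia.
  have [e|ne] := eqVneq (x, y) (a, b); [right|left].
    by case: e => -> ->; apply/outer0P => v /cell_below_range.
  apply/inner0P => v hv xv vy; apply: (cell_below_visible hv hT) => //; try nlia.
  exact/eqP.
Qed.

Lemma cell_side F x y : cell T F -> x \in F -> y \in F -> x < y ->
  (forall v, v \in F -> x < v -> v < y -> False) -> drawn T x y.
Proof.
by move=> /cellP[_ h] xF yF xy /inner0P h2; rewrite -h // h2.
Qed.

(** [a] and [b] are the extreme vertices of [F].  A chord covering a vertex of [F] would
    cross a side of [F] unless both its ends are vertices of [F], and then it would be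
    drawn without being a side.  Conversely a visible point outside [F] would be hidden by
    the side of [F] that passes over it. *)
Lemma cell_eq_below F : cell T F ->
  exists a b, [/\ drawn T a b, a.+1 < b, a \in F, b \in F & F = cell_below a b].
Proof.
move=> hF; case/cellP: (hF) => hcard hs.
have [x0 x0F] : exists x, x \in F by apply/card_gt0P; apply: leq_trans hcard.
have [a aF amin] := arg_minnP (P := fun x => x \in F) (fun d : 'I_m => d : nat) x0F.
have [b bF bmax] := arg_maxnP (P := fun x => x \in F) (fun d : 'I_m => d : nat) x0F.
have rng v : v \in F -> a <= v <= b by move=> vF; apply/andP; split; [apply: amin | apply: bmax].
have ab2 : a.+1 < b.
  have [v vF [nva nvb]] := third_vertex a b hcard.
  by have := rng v vF; nlia.
have ab : a < b by nlia.
have hab : drawn T a b by rewrite -hs //; apply/orP; right; apply/outer0P.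
exists a, b; split=> //; apply/eqP; rewrite eqEsubset.
have sub : F \subset cell_below a b.
  apply/subsetP => v vF; rewrite inE rng //=.
  apply/coveredP => -[c [d [hcd ncd [h1 h2 h3 h4]]]].
  have cF : c \in F.
    pose P (z : 'I_m) := (z \in F) && (z <= c).
    have Pa : P a by rewrite /P aF.
    have [y /andP[yF yc] ymax] := arg_maxnP (fun d : 'I_m => d : nat) Pa.
    have [z [zF yz zv hgap]] := next_in vF (leq_ltn_trans yc h2).
    have cz : c < z.
      by rewrite ltnNge; apply/negP => hzc; have : P z by [rewrite /P zF]; move/ymax; nlia.
    have dyz := cell_side hF yF zF yz hgap.
    move: yc; rewrite leq_eqVlt => /orP[/eqP/val_inj <- //|yc].
    by case: (drawn_cross dyz (drawn_T hcd)) => //; nlia.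
  have dF : d \in F.
    pose P (z : 'I_m) := (z \in F) && (z < d).
    have Pv : P v by rewrite /P vF.
    have [y /andP[yF yd] ymax] := arg_maxnP (fun d : 'I_m => d : nat) Pv.
    have vy : v <= y by apply: ymax.
    have [z [zF yz zb hgap]] := next_in bF (leq_trans yd h4).
    have dz : d <= z.
      by rewrite leqNgt; apply/negP => hzc; have : P z by [rewrite /P zF]; move/ymax; nlia.
    have dyz := cell_side hF yF zF yz hgap.
    move: dz; rewrite leq_eqVlt => /orP[/eqP/val_inj -> //|dz].
    by case: (drawn_cross (drawn_T hcd) dyz) => //; nlia.
  have := hs c d cF dF (ltn_trans h2 h3); rewrite (drawn_T hcd) => /orP[/inner0P h|/outer0P h].
    exact: (h v).
  apply: ncd; congr pair; apply: val_inj => /=.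
    by have := h _ aF; nlia.
  by have := h _ bF; nlia.
rewrite sub /=; apply/subsetP => z hz; have rz := cell_below_range hz.
apply/negPn/negP => nzF.
have nza : a <> z :> nat by move/val_inj => e; rewrite -e aF in nzF.
have nzb : b <> z :> nat by move/val_inj => e; rewrite -e bF in nzF.
pose P (x : 'I_m) := (x \in F) && (x < z).
have Pa : P a by rewrite /P aF; nlia.
have [x /andP[xF xz] xmax] := arg_maxnP (fun d : 'I_m => d : nat) Pa.
have xb : x < b by nlia.
have [y [yF xy yb hgap]] := next_in bF xb.
have zy : z < y.
  have nzy : z <> y :> nat by move/val_inj => e; rewrite e yF in nzF.
  by rewrite ltnNge; apply/negP => hzc; have : P y by [rewrite /P yF; nlia]; move/xmax; nlia.
have nab : x = a -> y = b -> False.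
  move=> ex ey; move: hgap; rewrite ex ey => hgap.
  have [v vF [nva nvb]] := third_vertex a b hcard.
  by case: (hgap v vF); have := rng v vF; nlia.
have dxy := cell_side hF xF yF xy hgap.
have := drawn_in dxy (introT andP (conj xz zy)) => /orP[hT|]; last first.
  move=> h0; have [ex ey] : x = a /\ y = b; last exact: nab.
    by split; apply: val_inj => /=; have := rng _ xF; have := rng _ yF; have := ltn_ord b; nlia.
have [e|ne] := eqVneq (x, y) (a, b).
  by case: e; apply: nab.
apply: (cell_below_visible hz hT) => //; try by have := rng _ xF; have := rng _ yF; nlia.
exact/eqP.
Qed.

End Planar.

Section Cells.
Variable m : nat.
Implicit Types (p e : chord m) (F R : {set 'I_m}) (T Q S : {set chord m}) (a b c d x y z : 'I_m).

Lemma drawn_in_below T a b x y z : planar T -> drawn T a b -> a <= x -> y <= b ->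
  drawn T x y -> x < z < y -> (x, y) <> (a, b) -> (x, y) \in T.
Proof.
move=> pT hab ax yb hxy hz ne; have := drawn_in hxy hz => /orP[//|h0].
case: ne; congr pair; apply: val_inj => /=; have := ltn_ord b; nlia.
Qed.

Lemma cell_chord_no_cross T F x y c d : planar T -> cell T F -> x \in F -> y \in F ->
  (c, d) \in T -> c < x -> x < d -> d < y -> False.
Proof.
move=> pT /(cell_eq_below pT)[a [b [hab ab2 aF bF eF]]] xF yF hcd cx xd dy.
move: (xF) (yF); rewrite eF => xv yv.
have rx := cell_below_range xv; have ry := cell_below_range yv.
case: (leqP a c) => ac.
  apply: (cell_below_visible xv hcd) => //; try nlia.
  by move=> [_ e]; move: dy ry; rewrite e; nlia.
by apply: (drawn_cross pT (drawn_T pT hcd) hab ac) => //; nlia.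
Qed.

Lemma cell_chord_no_cross' T F x y c d : planar T -> cell T F -> x \in F -> y \in F ->
  (c, d) \in T -> x < c -> c < y -> y < d -> False.
Proof.
move=> pT /(cell_eq_below pT)[a [b [hab ab2 aF bF eF]]] xF yF hcd cx xd dy.
move: (xF) (yF); rewrite eF => xv yv.
have rx := cell_below_range xv; have ry := cell_below_range yv.
case: (leqP d b) => ac.
  apply: (cell_below_visible yv hcd) => //; try nlia.
  by move=> [e _]; move: cx rx; rewrite e; nlia.
by apply: (drawn_cross pT hab (drawn_T pT hcd)) => //; nlia.
Qed.

Lemma planar_add T F x y : planar T -> cell T F -> x \in F -> y \in F -> x < y ->
  ~~ drawn T x y -> planar ((x, y) |: T).
Proof.
move=> pT hF xF yF xy nd; split=> [p|[a b] [c d]]; rewrite !inE.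
  case/orP => [/eqP->|]; last exact: pT.1.
  by move: nd; rewrite /drawn /diagonal xy /= negb_or => /andP[].
case/orP => [/eqP[-> ->]|h1] /orP[/eqP[-> ->]|h2].
- by rewrite /crossing /=; nlia.
- apply/negP => /orP[] /= /and3P[h3 h4 h5].
    exact: (cell_chord_no_cross' pT hF xF yF h2).
  exact: (cell_chord_no_cross pT hF xF yF h2).
- apply/negP => /orP[] /= /and3P[h3 h4 h5].
    exact: (cell_chord_no_cross pT hF xF yF h1).
  exact: (cell_chord_no_cross' pT hF xF yF h1).
- exact: pT.2.
Qed.

(** The top chords of the two cells do not cross, so one lies inside the other and would
    hide [x] or [y] from it. *)
Lemma cell_below_unique T a b a' b' x y : planar T -> drawn T a b -> drawn T a' b' ->
  x \in cell_below T a b -> y \in cell_below T a b ->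
  x \in cell_below T a' b' -> y \in cell_below T a' b' ->
  x < y -> (x, y) <> (a, b) -> (x, y) <> (a', b') -> (a, b) = (a', b').
Proof.
wlog h : a b a' b' / (a' <= a) && (b <= b') => [IH|].
  move=> pT hab hab' xF yF xF' yF' xy n n'.
  have rx := cell_below_range xF; have ry := cell_below_range yF.
  have rx' := cell_below_range xF'; have ry' := cell_below_range yF'.
  have h1 : ~ (a < a' /\ b < b').
    by case=> h1 h2; apply: (drawn_cross pT hab hab') => //; nlia.
  have h2 : ~ (a' < a /\ b' < b).
    by case=> h3 h2; apply: (drawn_cross pT hab' hab) => //; nlia.
  case: (boolP ((a' <= a) && (b <= b'))) => h3; first exact: IH.
  by apply/esym; apply: IH => //; nlia.
move=> pT hab hab' xF yF xF' yF' xy n n'; case/andP: h => h1 h2.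
have rx := cell_below_range xF; have ry := cell_below_range yF.
have [//|/eqP ne] := eqVneq (a, b) (a', b'); exfalso.
have {}n : ~ (a = x :> nat /\ b = y :> nat).
  by move=> [/val_inj e1 /val_inj e2]; apply: n; rewrite e1 e2.
have hz : exists z : 'I_m, a < z < b.
  case: (ltnP a x) => hax; [exists x | exists y]; nlia.
have [z hz'] := hz.
have hT := drawn_in_below pT hab' h1 h2 hab hz' ne.
case: (ltnP a x) => hax.
  by apply: (cell_below_visible xF' hT) => //; nlia.
by apply: (cell_below_visible yF' hT) => //; nlia.
Qed.

Lemma cell_unique T F F' x y : planar T -> cell T F -> cell T F' ->
  x \in F -> y \in F -> x \in F' -> y \in F' -> x < y -> ~~ drawn T x y -> F = F'.
Proof.
move=> pT /(cell_eq_below pT)[a [b [hab _ _ _ ->]]] /(cell_eq_below pT)[a' [b' [hab' _ _ _ ->]]].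
move=> xF yF xF' yF' xy nd.
have n : (x, y) <> (a, b) by move=> [e1 e2]; rewrite e1 e2 hab in nd.
have n' : (x, y) <> (a', b') by move=> [e1 e2]; rewrite e1 e2 hab' in nd.
by have [-> ->] := cell_below_unique pT hab hab' xF yF xF' yF' xy n n'.
Qed.

(** The innermost drawn chord around [x] and [y] sees both: a chord that hides one of them
    would cross the new diagonal or be a chord around both that lies further inside. *)
Lemma chord_in_cell T x y : planar T -> planar ((x, y) |: T) -> (x, y) \notin T ->
  exists F, [/\ cell T F, x \in F, y \in F & ~~ drawn T x y].
Proof.
move=> pT pT' nT.
have hin : (x, y) \in (x, y) |: T by rewrite setU11.
have dxy := diagonal_planar pT' hin.
have nd : ~~ drawn T x y.
  by rewrite /drawn (negbTE nT) orbF; move/pT'.1: hin; rewrite /diagonal /= => /andP[-> /negbTE ->].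
have m0 : 0 < m by have := ltn_ord x; nlia.
have m1 : m.-1 < m by nlia.
pose P (p : chord m) := [&& drawn T p.1 p.2, p.1 <= x & y <= p.2].
have P0 : P (Ordinal m0, Ordinal m1).
  have hy := ltn_ord y; apply/and3P; split=> //=; last by nlia.
  apply/andP; split=> /=; first by nlia.
  by rewrite /polygon_side /= prednK // eqxx orbT.
have [[a b] /and3P[/= hab ax yb] hmin] := arg_minnP (fun p : chord m => p.2 - p.1) P0.
have ab2 : a.+1 < b by nlia.
exists (cell_below T a b); split=> //; first exact: cell_cell_below.
all: rewrite inE; apply/andP; split; first nlia.
all: apply/coveredP => -[c [d [hcd ncd [h1 h2 h3 h4]]]].
all: have hd := drawn_T pT hcd; have hin' : (c, d) \in (x, y) |: T by rewrite setU1r.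
all: have nP : ~ P (c, d).
1,3: move/hmin => /=; have : ~ (c = a :> nat /\ d = b :> nat);
  [by move=> [/val_inj e1 /val_inj e2]; apply: ncd; rewrite e1 e2 | nlia].
- have hdy : d < y by rewrite ltnNge; apply/negP => h; apply: nP; apply/and3P; split=> //=; nlia.
  by apply: (drawn_cross pT' (drawn_T pT' hin') (drawn_T pT' hin)).
- have hdy : x < c by rewrite ltnNge; apply/negP => h; apply: nP; apply/and3P; split=> //=; nlia.
  by apply: (drawn_cross pT' (drawn_T pT' hin) (drawn_T pT' hin')).
Qed.

(** * Splitting a cell by a diagonal, and flips *)

Definition lower R x y := [set v in R | x <= v <= y].
Definition upper R x y := [set v in R | (v <= x) || (y <= v)].

(** Drawing the diagonal x y in a cell [R] replaces [R] by its two halves and keeps all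
    other cells. *)
Section Split.
Variables (Q : {set chord m}) (R : {set 'I_m}) (x y : 'I_m).
Hypotheses (pQ : planar Q) (hR : cell Q R) (xR : x \in R) (yR : y \in R) (xy : x < y).
Hypothesis nd : ~~ drawn Q x y.
Let T := (x, y) |: Q.

Lemma drawn_add u v : (u, v) <> (x, y) -> drawn T u v = drawn Q u v.
Proof. by move=> /eqP ne; rewrite /drawn !inE (negbTE ne). Qed.

Lemma drawn_new : drawn T x y.
Proof. by rewrite /drawn !inE eqxx xy !orbT. Qed.

Lemma split_inner : exists2 v, v \in R & x < v < y.
Proof.
case/cellP: hR => _ /(_ x y xR yR xy); rewrite (negbTE nd) => /negbT; rewrite negb_or.
case/andP; rewrite -lt0n => /card_gt0P[v]; rewrite !inE => /and3P[vR h1 h2] _.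
by exists v; rewrite ?h1.
Qed.

Lemma split_outer : exists2 v, v \in R & (v < x) || (y < v).
Proof.
case/cellP: hR => _ /(_ x y xR yR xy); rewrite (negbTE nd) => /negbT; rewrite negb_or.
by case/andP=> _; rewrite -lt0n => /card_gt0P[v]; rewrite !inE => /andP[vR h]; exists v.
Qed.

Lemma mem_lower v : (v \in lower R x y) = (v \in R) && (x <= v <= y).
Proof. by rewrite inE. Qed.
Lemma mem_upper v : (v \in upper R x y) = (v \in R) && ((v <= x) || (y <= v)).
Proof. by rewrite inE. Qed.

Lemma card3 F a b c : a \in F -> b \in F -> c \in F -> a < b -> b < c -> 2 < #|F|.
Proof.
move=> aF bF cF ab bc; apply: leq_trans (_ : #|[set a; b; c]| <= _).
  rewrite cardsU cards2 cards1.
  have -> : [set a; b] :&: [set c] = set0.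
    by apply/setP => z; rewrite !inE; apply/negP => /andP[/orP[]/eqP-> /eqP e]; move: ab bc; rewrite e; nlia.
  by rewrite cards0; case: eqP ab => // ->; rewrite ltnn.
by apply/subset_leq_card/subsetP => z; rewrite !inE => /orP[/orP[]|] /eqP->.
Qed.

Lemma cell_lower : cell T (lower R x y).
Proof.
have [z zR hz] := split_inner; have [far farR ho] := split_outer.
case/cellP: hR => _ hs; apply/cellP; split.
  apply: (@card3 _ x z y); rewrite ?mem_lower ?xR ?yR ?zR ?leqnn //=; nlia.
move=> u v; rewrite !mem_lower => /andP[uR hu] /andP[vR hv] uv.
have [[-> ->]|/eqP ne] := eqVneq (u, v) (x, y).
  rewrite drawn_new; apply/orP; right; apply/outer0P => w; rewrite mem_lower => /andP[_ //].
rewrite drawn_add // -hs //.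
have -> : (outer_count (lower R x y) (u, v) == 0) = false.
  apply/negP => /outer0P h; apply: ne; congr pair; apply: val_inj => /=.
    have := h x; rewrite mem_lower xR leqnn => /(_ _); nlia.
  have := h y; rewrite mem_lower yR leqnn => /(_ _); nlia.
have -> : (outer_count R (u, v) == 0) = false.
  by apply/negP => /outer0P /(_ _ farR); nlia.
rewrite !orbF; apply/inner0P/inner0P => h w.
  by move=> wR uw wv; apply: (h w) => //; rewrite mem_lower wR; nlia.
by rewrite mem_lower => /andP[wR _]; apply: h.
Qed.

Lemma cell_upper : cell T (upper R x y).
Proof.
have [z zR hz] := split_inner; have [far farR ho] := split_outer.
have wU0 : far \in upper R x y by rewrite mem_upper farR; nlia.
have xU : x \in upper R x y by rewrite mem_upper xR leqnn.
have yU : y \in upper R x y by rewrite mem_upper yR leqnn orbT.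
case/cellP: hR => _ hs; apply/cellP; split.
  by case/orP: ho => ho; [apply: (@card3 _ far x y) | apply: (@card3 _ x y far)].
move=> u v uU vU uv.
move: (uU) (vU); rewrite !mem_upper => /andP[uR hu] /andP[vR hv].
have [[-> ->]|/eqP ne] := eqVneq (u, v) (x, y).
  rewrite drawn_new; apply/orP; left; apply/inner0P => w; rewrite mem_upper => /andP[_ hw]; nlia.
rewrite drawn_add // -hs //; congr orb.
  apply/inner0P/inner0P => h w; last by rewrite mem_upper => /andP[wR _]; apply: h.
  move=> wR uw wv; case: (boolP (w \in upper R x y)) => [wU|]; first exact: (h w).
  rewrite mem_upper wR /= negb_or -!ltnNge => /andP[xw wy].
  apply: ne; congr pair; apply: val_inj => /=.
    case: (ltngtP u x) => // hux; last by nlia.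
    by case: (h x) => //; nlia.
  case: (ltngtP v y) => // hux; first by nlia.
  by case: (h y) => //; nlia.
apply/outer0P/outer0P => h w; last by rewrite mem_upper => /andP[wR _]; apply: h.
move=> wR; case: (boolP (w \in upper R x y)) => [wU|]; first exact: h.
rewrite mem_upper wR /= negb_or -!ltnNge => /andP[xw wy].
by have := h _ xU; have := h _ yU; nlia.
Qed.

Lemma cell_split_far F : ~~ ((x \in F) && (y \in F)) -> cell T F = cell Q F.
Proof.
move=> n; apply/cellP/cellP => -[h1 h2]; split=> // u v uF vF uv; rewrite h2 //;
  [|symmetry]; apply: drawn_add => -[eu ev]; by move: n; rewrite -eu -ev uF vF.
Qed.

(** On either side of x y there is one cell, by [cell_below_unique]. *)
Lemma cell_split_near F : x \in F -> y \in F -> cell T F -> F = lower R x y \/ F = upper R x y.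
Proof.
move=> xF yF hF.
have pT : planar T by apply: (planar_add pQ hR).
case/cellP: (hF) => _ /(_ x y xF yF xy); rewrite drawn_new => /orP[h|h]; [right|left].
  have hU := cell_upper.
  have xU : x \in upper R x y by rewrite mem_upper xR leqnn.
  have yU : y \in upper R x y by rewrite mem_upper yR leqnn orbT.
  have hUi : inner_count (upper R x y) (x, y) == 0.
    by apply/inner0P => w; rewrite mem_upper => /andP[_ hw]; nlia.
  have key F' : cell T F' -> x \in F' -> y \in F' -> inner_count F' (x, y) == 0 ->
      exists a b, [/\ drawn T a b, F' = cell_below T a b & (x, y) <> (a, b)].
    move=> /[dup] /cellP[hc _] /(cell_eq_below pT)[a [b [hab _ aF bF eF]]] xF' yF' /inner0P hi.
    exists a, b; split=> // -[ea eb]; subst a b.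
    have [v vF [nvx nvy]] := third_vertex x y hc.
    by move: (vF); rewrite {1}eF => /cell_below_range hr; case: (hi v vF); nlia.
  have [a [b [hab eF n]]] := key _ hF xF yF h.
  have [a' [b' [hab' eU n']]] := key _ hU xU yU hUi.
  rewrite eF eU; rewrite eF in xF yF; rewrite eU in xU yU.
  by have [-> ->] := cell_below_unique pT hab hab' xF yF xU yU xy n n'.
have hL := cell_lower.
have key F' : cell T F' -> x \in F' -> y \in F' -> outer_count F' (x, y) == 0 ->
    F' = cell_below T x y.
  move=> /(cell_eq_below pT)[a [b [hab _ aF bF eF]]] xF' yF' /outer0P ho.
  rewrite {1}eF; have -> : a = x.
    by apply: val_inj => /=; have := ho _ aF; move: xF'; rewrite eF => /cell_below_range; nlia.
  have -> // : b = y.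
  by apply: val_inj => /=; have := ho _ bF; move: yF'; rewrite eF => /cell_below_range; nlia.
rewrite (key _ hF xF yF h) (key _ hL) //.
- by rewrite mem_lower xR leqnn ltnW.
- by rewrite mem_lower yR leqnn andbT ltnW.
- by apply/outer0P => w; rewrite mem_lower => /andP[].
Qed.

Lemma lower_upperU : lower R x y :|: upper R x y = R.
Proof.
by apply/setP => v; rewrite inE mem_lower mem_upper; case: (v \in R) => //=; nlia.
Qed.

Lemma card_lower : #|lower R x y| = inner_count R (x, y) + 2.
Proof.
rewrite /inner_count; set I := [set v in R | _].
have -> : lower R x y = [set x; y] :|: I.
  apply/setP => v; rewrite mem_lower !inE /=.
  case: (eqVneq v x) => [->|nx]; first by rewrite xR leqnn ltnW.
  case: (eqVneq v y) => [->|ny]; first by rewrite yR leqnn ltnW.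
  have : v <> x :> nat /\ v <> y :> nat by split=> /val_inj; apply/eqP.
  by move=> ?; case: (v \in R) => //=; nlia.
rewrite cardsU cards2 (_ : [set x; y] :&: I = set0); last first.
  by apply/setP => v; rewrite !inE /=; apply/negP => /andP[/orP[]/eqP->]; nlia.
by rewrite cards0; case: eqP xy => [->|]; [rewrite ltnn | nlia].
Qed.

Lemma card_upper : #|upper R x y| = outer_count R (x, y) + 2.
Proof.
rewrite /outer_count; set I := [set v in R | _].
have -> : upper R x y = [set x; y] :|: I.
  apply/setP => v; rewrite mem_upper !inE /=.
  case: (eqVneq v x) => [->|nx]; first by rewrite xR leqnn.
  case: (eqVneq v y) => [->|ny]; first by rewrite yR leqnn orbT.
  have : v <> x :> nat /\ v <> y :> nat by split=> /val_inj; apply/eqP.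
  by move=> ?; case: (v \in R) => //=; nlia.
rewrite cardsU cards2 (_ : [set x; y] :&: I = set0); last first.
  by apply/setP => v; rewrite !inE /=; apply/negP => /andP[/orP[]/eqP->]; nlia.
by rewrite cards0; case: eqP xy => [->|]; [rewrite ltnn | nlia].
Qed.

Lemma split_region : flip_region T (x, y) = R.
Proof.
apply/eqP; rewrite eqEsubset; apply/andP; split.
  apply/bigcupsP => F /andP[hF /and4P[/= xF yF _ _]].
  case: (cell_split_near xF yF hF) => ->; apply/subsetP => v; rewrite inE => /andP[] //.
rewrite -{1}lower_upperU; apply/subUsetP; split.
  apply: (bigcup_max (lower R x y)) => //; rewrite cell_lower /side_of /= xy.
  rewrite !mem_lower xR yR !leqnn (ltnW xy) /=; apply/orP; right.
  by apply/outer0P => w; rewrite mem_lower => /andP[].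
apply: (bigcup_max (upper R x y)) => //; rewrite cell_upper /side_of /= xy.
rewrite !mem_upper xR yR !leqnn !orbT /=; apply/orP; left.
by apply/inner0P => w; rewrite mem_upper => /andP[_ hw]; nlia.
Qed.

End Split.

Lemma card_sides F x y : x \in F -> y \in F -> x < y ->
  inner_count F (x, y) + outer_count F (x, y) + 2 = #|F|.
Proof.
move=> xF yF xy; pose I := [set w : 'I_m | x <= w <= y].
rewrite -(cardsID I F); have -> : F :&: I = lower F x y by apply/setP => w; rewrite !inE.
rewrite (card_lower xF yF xy); have -> : #|F :\: I| = outer_count F (x, y); last by rewrite addnAC.
apply: eq_card => w; rewrite !inE; case: (w \in F) => /=; rewrite ?andbF //= andbT.
by rewrite negb_and -!ltnNge.
Qed.

Lemma planarP T : reflect (planar T)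
  ([forall p in T, diagonal p] && [forall p in T, forall p' in T, ~~ crossing p p']).
Proof.
apply: (iffP andP) => -[h1 h2]; split.
- by move=> p pT; move/forall_inP: h1; apply.
- by move=> p p' pT p'T; move/forall_inP: h2 => /(_ p pT) /forall_inP /(_ p' p'T).
- exact/forall_inP.
- by apply/forall_inP => p pT; apply/forall_inP => p' p'T; apply: h2.
Qed.

Lemma kangP k T : reflect (planar T /\ forall F, cell T F -> #|F| = k) (is_kangulation k T).
Proof.
rewrite /is_kangulation andbA; apply: (iffP andP) => -[h1 h2].
  split; first exact/planarP.
  by move=> F hF; move/forallP/(_ F)/implyP/(_ hF)/eqP: h2.
split; first exact/planarP.
by apply/forallP => F; apply/implyP => /h2 ->.
Qed.

Lemma planar_sub T Q : Q \subset T -> planar T -> planar Q.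
Proof.
move=> /subsetP sQ [h1 h2]; split=> [p /sQ|p p' /sQ hp /sQ hp']; [exact: h1|exact: h2].
Qed.

(** Removing a diagonal of a k-angulation merges two cells into the flip region, the
    only cell of the rest that is not a k-gon. *)
Lemma flip_regionP k T e : is_kangulation k T -> e \in T ->
  let Q := T :\ e in let R := flip_region T e in
  [/\ planar Q, cell Q R, [/\ e.1 \in R, e.2 \in R & e.1 < e.2],
      ~~ drawn Q e.1 e.2 &
      [/\ inner_count R e = k - 2, outer_count R e = k - 2 & 2 < k]].
Proof.
case: e => x y /kangP[pT hk] eT Q R /=.
have pQ : planar Q by apply: planar_sub pT; apply: subsetDl.
have eQ : (x, y) |: Q = T by rewrite setD1K.
have nQ : (x, y) \notin Q by rewrite !inE eqxx.
have pT' : planar ((x, y) |: Q) by rewrite eQ.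
have [F [hF xF yF nd]] := chord_in_cell pQ pT' nQ.
have xy : x < y by have := diagonal_planar pT eT; nlia.
have eR : R = F by rewrite /R -eQ; apply: split_region.
have hL := cell_lower hF xF yF xy nd; rewrite eQ in hL.
have hU := cell_upper hF xF yF xy nd; rewrite eQ in hU.
have := hk _ hL; have := hk _ hU.
have hc : 2 < k by case/cellP: (hL); rewrite (hk _ hL).
rewrite (card_lower xF yF xy) (card_upper xF yF xy) eR => h1 h2.
split=> //; split=> //; nlia.
Qed.

(** The new diagonal halves the same region, so its two new cells are k-gons again. *)
Lemma flip_kangulation k T e e' : is_kangulation k T -> e \in T ->
  e' \in replacements T e ->
  [/\ is_kangulation k (flip T e e'), flip_region (flip T e e') e' = flip_region T e,
      e' \notin T :\ e & flip T e e' :\ e' = T :\ e].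
Proof.
move=> kT eT; have [pQ hR [xR yR xy] nd [hi ho hk]] := flip_regionP kT eT.
rewrite inE => /andP[/and4P[x'R y'R xy' /eqP hop] ne].
case/kangP: (kT) => pT hcell.
case: e e' => [x y] [x' y'] /= in eT pQ hR xR yR xy nd hi ho x'R y'R xy' hop ne *.
set Q := T :\ _ in pQ hR nd *; set R := flip_region _ _ in hR xR yR hi ho x'R y'R hop *.
clearbody R.
have cR : inner_count R (x, y) + outer_count R (x, y) =
          inner_count R (x', y') + outer_count R (x', y').
  by apply: (@addIn 2); rewrite (card_sides xR yR xy) (card_sides x'R y'R xy').
have hi' : inner_count R (x', y') = k - 2 by nlia.
have ho' : outer_count R (x', y') = k - 2 by nlia.
have nd' : ~~ drawn Q x' y'.
  case/cellP: hR => _ /(_ x' y' x'R y'R xy'); rewrite hi' -hop hi' => <-; nlia.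
have nQ' : (x', y') \notin Q by move: nd'; rewrite /drawn xy' /= negb_or => /andP[].
split=> //.
- apply/kangP; split; first exact: (planar_add pQ hR).
  move=> F hF; case: (boolP ((x' \in F) && (y' \in F))) => [/andP[x'F y'F]|nF].
    case: (cell_split_near pQ hR x'R y'R xy' nd' x'F y'F hF) => ->.
      by rewrite (card_lower x'R y'R xy'); nlia.
    by rewrite (card_upper x'R y'R xy'); nlia.
  have hFQ : cell Q F by rewrite -(cell_split_far Q nF).
  apply: hcell; rewrite -(setD1K eT) cell_split_far //; apply/negP => /andP[xF yF].
  by move: nF; rewrite (cell_unique pQ hFQ hR xF yF xR yR xy nd) x'R y'R.
- exact: (split_region pQ hR x'R y'R xy').
- by rewrite /flip setU1K.
Qed.

(** The only cell of [Q] that is not a k-gon is the region of [e], and it is also the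
    region of [e'].  So the two regions coincide, and both diagonals halve it. *)
Lemma flip_of_common k Q e e' : e \notin Q -> e' \notin Q -> e != e' ->
  is_kangulation k (e |: Q) -> is_kangulation k (e' |: Q) ->
  e' \in replacements (e |: Q) e /\ e' |: Q = flip (e |: Q) e e'.
Proof.
move=> nQ nQ' ne kT kT'; rewrite /flip setU1K //; split=> //.
have eT : e \in e |: Q by rewrite !inE eqxx.
have eT' : e' \in e' |: Q by rewrite !inE eqxx.
have := flip_regionP kT eT; have := flip_regionP kT' eT'; rewrite !setU1K //=.
set R := flip_region (e |: Q) e; set R' := flip_region (e' |: Q) e'.
move=> [pQ hR' [xR' yR' xy'] nd' [hi' ho' hk]] [_ hR [xR yR xy] nd [hi ho _]].
case/kangP: (kT) => pT hcell.
have eRR : R' = R.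
  case: (boolP ((e.1 \in R') && (e.2 \in R'))) => [/andP[h1 h2]|n].
    exact: (cell_unique pQ hR' hR h1 h2 xR yR xy nd).
  have hc : #|R'| = k.
    by apply: hcell; rewrite (surjective_pairing e) (cell_split_far Q n).
  exfalso; case: e' {kT' eT' nQ' ne} @R' hR' xR' yR' xy' nd' hi' ho' n hc {hcell} => x' y' R' /=.
  move=> hR' xR' yR' xy' nd' hi' ho' n hc.
  have := card_lower xR' yR' xy'; have := card_upper xR' yR' xy'; rewrite hi' ho' => h1 h2.
  have : lower R' x' y' \proper R'.
    rewrite properE; apply/andP; split.
      by apply/subsetP => v; rewrite inE => /andP[].
    have [far farR ho2] := split_outer hR' xR' yR' xy' nd'.
    by apply/negP => /subsetP /(_ far farR); rewrite inE; nlia.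
  by move/proper_card; rewrite h2 hc; clear -hk; lia.
rewrite inE eq_sym ne andbT /opposite_in -/R -eRR xR' yR' xy' /=.
by rewrite (surjective_pairing e') /= in hi' ho' *; rewrite hi' ho'.
Qed.

End Cells.

(** * Trees and k-angulations *)

Section Visible.
Variable q : nat.

(** The counterpart of [covered] for the intervals of a forest. *)
Definition hides a u z := exists c d, [/\ spans q a u c d, c < z & z < d].

(** Each of the [j] trees hides the inner points of its interval, and the j + 1 end points
    remain.  Thus a node of arity q + 1 gives a cell with q + 2 vertices. *)
Lemma count_visible j a u : forest q j u ->
  count (fun z => ~~ `[< hides a u z >]) (iota a (leaves u).+1) = j.+1.
Proof.
elim: j a u => [|j IH] a u.
  move/forest0 ->; rewrite /= addn0; case: asboolP => // -[c [d [/spans_range[]]]].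
  by rewrite /leaves /=; lia.
move=> /tree_split[t [v [-> ht hv]]].
have l1 := leaves_tree_gt0 ht.
rewrite lnE -addnS iotaD count_cat.
have -> : count (fun z => ~~ `[< hides a (t ++ v) z >]) (iota a (leaves t)) = 1.
  rewrite -(prednK l1) /= ; case: asboolP => [[c [d [/spans_range[] *]]]|_]; first lia.
  rewrite add1n; congr _.+1; apply/eqP; rewrite -leqn0 leqNgt -has_count; apply/hasPn => z.
  rewrite mem_iota negbK => hz; apply/asboolP; exists a, (a + leaves t); split; try lia.
  by apply/(spans_cat _ _ _ _ ht); left; apply: spans_whole.
rewrite -(IH (a + leaves t) v hv) add1n; congr _.+1; apply: eq_in_count => z.
rewrite mem_iota => hz; congr (~~ _); apply: asbool_equiv_eq; split=> -[c [d [h h1 h2]]].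
  case/(spans_cat _ _ _ _ ht): h => h; last by exists c, d.
  by case: (spans_range h); lia.
by exists c, d; split=> //; apply/(spans_cat _ _ _ _ ht); right.
Qed.

End Visible.

Lemma card_ord_count m (P : pred nat) : #|[set z : 'I_m | P z]| = count P (iota 0 m).
Proof.
by rewrite cardE size_filter -val_enum_ord count_map enumT; apply: eq_count => z; rewrite /= inE.
Qed.

Section Bridge.
Variables (q n m : nat).
Hypotheses (q0 : 0 < q) (n0 : 0 < n) (hm : m = q * n + 2).
Implicit Types (w : bitseq) (S : {set chord m}) (x y a b c d : 'I_m).

(** The intervals of the leaves and of the root are sides of the polygon, so [diagonal]
    takes them out. *)
Definition dissection w : {set chord m} :=
  [set p : chord m | diagonal p && `[< spans q 0 w p.1 p.2 >]].

Lemma leaves_trees_m w : w \in trees q n -> (leaves w).+1 = m.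
Proof. by move/leaves_trees ->; rewrite hm; lia. Qed.

Lemma drawn_dissection w x y : w \in trees q n ->
  drawn (dissection w) x y <-> spans q 0 w x y.
Proof.
move=> hw; have hl := leaves_trees_m hw; case/forestsP: (hw) => fw nw.
rewrite /drawn inE /diagonal /=; split; last first.
  by move=> h; have [_ hr _] := spans_range h; rewrite hr asboolT // andbT; case: polygon_side.
case/andP=> xy /orP[|/andP[_ /asboolP //]].
rewrite /polygon_side /= => /orP[/eqP e|/andP[/eqP e1 /eqP e2]].
  have hx : x < leaves w by have := ltn_ord y; lia.
  have [u [v [ew hu]]] := leaf_split hx.
  by apply: (@Spans _ _ _ _ _ u [:: false] v); rewrite // ?ew ?hu -?e // /leaves /= ; lia.
have := spans_whole 0 fw; rewrite e1 add0n; have -> // : leaves w = y.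
by apply: eq_add_S; rewrite hl e2.
Qed.

Lemma planar_dissection w : w \in trees q n -> planar (dissection w).
Proof.
move=> hw; split=> [p|[a b] [c d]]; first by rewrite inE => /andP[].
rewrite !inE /= => /andP[_ /asboolP h1] /andP[_ /asboolP h2].
apply/negP; rewrite /crossing /= => /orP[] /and3P[h3 h4 h5].
  by have := spans_laminar h1 h2 h3 h4; lia.
by have := spans_laminar h2 h1 h3 h4; lia.
Qed.

Lemma card_cell_below w a b : w \in trees q n -> drawn (dissection w) a b -> a.+1 < b ->
  #|cell_below (dissection w) a b| = q.+2.
Proof.
move=> hw hab ab2; have pT := planar_dissection hw; have hl := leaves_trees_m hw.
have [x t y ew ht ea eb] := (drawn_dissection a b hw).1 hab.
case: (tree_cases ht) => [et|[u et hu]].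
  by move: eb ab2; rewrite et /leaves /=; lia.
rewrite -(count_visible a hu).
pose P z := [&& a <= z, z <= b & ~~ `[< hides q a u z >]].
have hlu : leaves u = b - a by rewrite eb et lnE /=; lia.
have -> : cell_below (dissection w) a b = [set z : 'I_m | P z].
  apply/setP => z; rewrite !inE /P -andbA; congr [&& _, _ & ~~ _].
  apply/coveredP/asboolP.
    case=> c [d [hcd ncd [h1 h2 h3 h4]]]; exists c, d; split=> //.
    have h := (drawn_dissection c d hw).1 (drawn_T pT hcd).
    have : spans q (0 + leaves x) t c d by apply: (spans_local q0 ht (y := y)); rewrite -?ew //; lia.
    rewrite et -ea => /(spans_node _ _ _ hu)[[e1 e2]|//].
    case: ncd; congr pair; apply: val_inj => //=.
    by rewrite e2 hlu; lia.
  case=> c [d [h h1 h2]]; have [h3 h4 h5] := spans_range h.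
  have hc : c < m by have := ltn_ord b; lia.
  have hd : d < m by have := ltn_ord b; lia.
  have nf : ~ (c = a /\ d = b :> nat).
    move=> [e1 e2]; apply: (@spans_not_full q q.+1 a u _ hu); rewrite // hlu.
    by move: h; rewrite e1 e2 subnKC //; lia.
  have hw' : spans q 0 w c d.
    rewrite ew; apply: spans_context; rewrite -ea et.
    by apply/(spans_node _ _ _ hu); right.
  exists (Ordinal hc), (Ordinal hd); split=> /=; last by split=> //; lia.
    rewrite inE /= asboolT // andbT /diagonal /polygon_side /=.
    by have := ltn_ord b; lia.
  by move=> [e1 e2]; apply: nf; split; [rewrite -e1 | rewrite -e2].
rewrite card_ord_count.
have -> : iota 0 m = iota 0 a ++ iota a (leaves u).+1 ++ iota b.+1 (m - b.+1).
  transitivity (iota 0 (a + ((leaves u).+1 + (m - b.+1)))).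
    by congr iota; have := ltn_ord b; lia.
  by rewrite !iotaD add0n; congr (_ ++ (_ ++ iota _ _)); lia.
rewrite !count_cat.
have -> : count P (iota 0 a) = 0.
  by apply/eqP; rewrite -leqn0 leqNgt -has_count; apply/hasPn => z; rewrite mem_iota /P; lia.
have -> : count P (iota b.+1 (m - b.+1)) = 0.
  by apply/eqP; rewrite -leqn0 leqNgt -has_count; apply/hasPn => z; rewrite mem_iota /P; lia.
rewrite add0n addn0; apply: eq_in_count => z; rewrite mem_iota hlu /P => hz.
by have -> : a <= z; [lia|]; have -> : z <= b; [lia|].
Qed.

Lemma kang_dissection w : w \in trees q n -> is_kangulation q.+2 (dissection w).
Proof.
move=> hw; have pT := planar_dissection hw; apply/kangP; split=> // F.
by case/(cell_eq_below pT) => a [b [hab ab2 _ _ ->]]; apply: card_cell_below.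
Qed.

Lemma dissection_inj w w' : w \in trees q n -> w' \in trees q n ->
  dissection w = dissection w' -> w = w'.
Proof.
move=> hw hw' e; case/forestsP: (hw) => fw _; case/forestsP: (hw') => fw' _.
have hl := leaves_trees_m hw; have hl' := leaves_trees_m hw'.
have key v v' : v \in trees q n -> v' \in trees q n -> dissection v = dissection v' ->
    forall c d : nat, spans q 0 v c d -> spans q 0 v' c d.
  move=> hv hv' ev c d h; have [h1 h2 h3] := spans_range h; have hlv := leaves_trees_m hv.
  have hc : c < m by lia.
  have hd : d < m by lia.
  apply: (drawn_dissection (Ordinal hc) (Ordinal hd) hv').1; rewrite -ev.
  exact/(drawn_dissection _ _ hv).
apply: (spans_inj q0 fw fw'); first by apply: eq_add_S; rewrite hl.
by move=> c d; split; apply: key.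
Qed.

(** The node of a chord has one child for each other side of the cell below it; the inner
    induction collects these children from right to left. *)
Lemma subtree_of_chord S a b : is_kangulation q.+2 S -> drawn S a b ->
  exists t, [/\ forest q 1 t, leaves t = b - a &
    forall c d, spans q a t c d <-> [/\ a <= c, d <= b & drawn S c d]].
Proof.
case/kangP=> pS hS.
move: {2}(b - a) (leqnn (b - a)) => l; elim: l a b => [|l IH] a b hl hab.
  by case/andP: (hab); lia.
case: (ltngtP a.+1 b) => ab2; last first.
- exists [:: false]; split=> //; first by rewrite -ab2 /leaves /=; lia.
  move=> c d; rewrite spans_leaf; split.
    case=> /val_inj -> ed; have -> : d = b by apply: val_inj; rewrite /= ed.
    by rewrite !leqnn.
  by case=> h1 h2 /andP[h3 _]; lia.
- by case/andP: hab; lia.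
pose F := cell_below S a b.
have hF : #|F| = q.+2 by apply: hS; apply: cell_cell_below.
have ab : a < b by lia.
have aF : a \in F := cell_below_l S ab. have bF : b \in F := cell_below_r S ab.
suff h : forall i x, x \in F -> b - x <= i -> exists s j,
    [/\ forest q j s, leaves s = b - x, #|[set z in F | x <= z]| = j.+1 &
     forall c d, spans q x s c d <-> [/\ x <= c, d <= b, drawn S c d & (c, d) <> (a, b)]].
  have [s [j [hs ls hj hsp]]] := h _ a aF (leqnn _).
  have ej : j = q.+1.
    apply: eq_add_S; rewrite -hj -hF; apply: eq_card => z; rewrite !inE.
    by case: (a <= z); rewrite ?andbF ?andbT.
  subst j; exists (true :: s); split; rewrite ?forest_node ?addn0 //.
  move=> c d; rewrite spans_node // hsp ls; split.
    case=> [[/val_inj -> ed]|[]//]; have -> : d = b by apply: val_inj => /=; nlia.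
    by rewrite !leqnn.
  move=> [h1 h2 h3]; case: (eqVneq (c, d) (a, b)) => [[-> ->]|/eqP ne]; [left|by right].
  by split=> //; nlia.
elim=> [|i IHi] x xF hi.
  have ex : x = b by apply: val_inj => /=; have := cell_below_range xF; nlia.
  subst x; exists [::], 0; split=> //; first by rewrite subnn.
    rewrite -[1](cards1 b); apply: eq_card => z; rewrite !inE.
    apply/andP/eqP => [[/andP[h1 _] h2]|->]; first by apply: val_inj => /=; nlia.
    by split; [move: bF; rewrite inE | rewrite leqnn].
  by move=> c d; split=> [/spans_range[] | [h1 h2 /andP[h3 _] _]]; rewrite /leaves /=; nlia.
have rx := cell_below_range xF.
case: (eqVneq x b) => [ex|nxb]; first by apply: IHi => //; rewrite ex subnn.
have xb : x < b.
  have : x <> b :> nat by move/val_inj; apply/eqP.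
  by nlia.
have [y [yF xy yb hgap]] := next_in bF xb.
have ry := cell_below_range yF.
have hd : drawn S x y /\ (x, y) <> (a, b).
  case: (cell_below_gap pS xF yF xy hgap) => [e|[hxy ne]]; last by split; [apply: drawn_T|].
  split; first by rewrite /drawn xy /polygon_side /= e eqxx.
  by move=> [e1 e2]; move: ab2; rewrite -e1 -e2 e ltnn.
case: hd => hxy nxy.
have {}nxy : ~ (x = a :> nat /\ y = b :> nat) by move=> [/val_inj e1 /val_inj e2]; apply: nxy; rewrite e1 e2.
have [|t [ht lt hsp]] := IH x y _ hxy; first nlia.
have [|s [j [hs ls hj hsps]]] := IHi y yF; first nlia.
exists (t ++ s), j.+1; split.
- by rewrite -add1n; apply: forest_cat.
- by rewrite lnE lt ls; nlia.
- rewrite -hj -[in RHS]add1n -(cards1 x) -cardsUI.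
  rewrite (_ : [set x] :&: _ = set0) ?cards0 ?addn0; last first.
    by apply/setP => z; rewrite !inE; apply/negP => /and3P[/eqP->]; nlia.
  apply: eq_card => z; rewrite [in LHS]inE in_setU in_set1 [in RHS]inE.
  case: (eqVneq z x) => [->|nzx] /=; first by rewrite xF leqnn.
  case zF: (z \in F) => //=; have nz : z <> x :> nat by move/val_inj; apply/eqP.
  case: (leqP y z) => h; first by nlia.
  by apply/negP => h2; apply: (hgap z) => //; nlia.
- move=> c d; rewrite (spans_cat _ _ _ _ ht) hsp.
  have -> : x + leaves t = y by rewrite lt; nlia.
  rewrite hsps; split.
    case=> [[h1 h2 h3]|[h1 h2 h3 h4]]; split=> //; try nlia.
    by move=> [e1 e2]; apply: nxy; rewrite -e1 -e2 in h1 h2 rx ry *; nlia.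
  move=> [h1 h2 h3 h4]; case: (leqP d y) => hdy; first by left.
  case: (leqP y c) => hcy; first by right.
  exfalso; have hz : c < y < d by rewrite hcy.
  have hT : (c, d) \in S by apply: (drawn_in_below pS hab _ h2 h3 hz h4); nlia.
  by apply: (cell_below_visible yF hT h4) => //; nlia.
Qed.

Lemma dissection_surj S : is_kangulation q.+2 S -> exists2 w, w \in trees q n & dissection w = S.
Proof.
move=> hS; have h0 : 0 < m by rewrite hm; lia.
have h1 : m.-1 < m by lia.
have hd : drawn S (Ordinal h0) (Ordinal h1).
  by rewrite /drawn /polygon_side /= prednK // eqxx orbT andbT hm; lia.
have [t [ht lt hsp]] := subtree_of_chord hS hd; rewrite /= in lt hsp.
have hw : t \in trees q n.
  apply/forestsP; split=> //; have := leaves_forest ht; rewrite lt hm => h.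
  by apply/eqP; rewrite -(eqn_pmul2l q0); apply/eqP; lia.
exists t => //; apply/setP => -[c d]; rewrite inE /=; case/kangP: (hS) => pS _.
apply/andP/idP => [[hdg /asboolP/hsp[_ _]]|hcd].
  by move: hdg; rewrite /drawn /diagonal /= => /andP[-> /negbTE ->].
split; first exact: pS.1.
apply/asboolP/hsp; split=> //; last exact: drawn_T.
by have := ltn_ord d; lia.
Qed.

(** If one k-angulation contained the other, an additional diagonal would halve a cell of
    the smaller one, which would then be larger than a k-gon.  So each contains a diagonal
    that the other lacks, and [flip_of_common] applies to the intersection. *)
Lemma kang_near S S' (p p' : nat * nat) :
  is_kangulation q.+2 S -> is_kangulation q.+2 S' -> S <> S' ->
  (forall c d, (c, d) \in S -> (c, d) \in S' \/ (c : nat, d : nat) = p) ->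
  (forall c d, (c, d) \in S' -> (c, d) \in S \/ (c : nat, d : nat) = p') ->
  exists e e', [/\ e \in S, e' \in replacements S e & S' = flip S e e'].
Proof.
have nest S1 S2 (p0 : nat * nat) : is_kangulation q.+2 S1 -> is_kangulation q.+2 S2 ->
    (forall c d, (c, d) \in S2 -> (c, d) \in S1 \/ (c : nat, d : nat) = p0) ->
    S1 \subset S2 -> S1 = S2.
  move=> k1 k2 h12 sub; apply/eqP; rewrite eqEsubset sub /=.
  apply/subsetP => -[x y] e2; apply/negPn/negP => ne.
  have e1 : S2 :\ (x, y) = S1.
    apply/setP => -[c d]; rewrite in_setD1; apply/andP/idP => [[ncd /h12[//|e]]|h]; last first.
      by split; [apply: contraNneq ne => <- | move/subsetP: sub; apply].
    have [//|e3] := h12 _ _ e2; [by rewrite (negbTE ne) | move: ncd; rewrite xpair_eqE].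
    by move: e3; rewrite -e => -[e4 e5]; rewrite -!val_eqE /= e4 e5 !eqxx.
  have [_ hR [xR yR xy] nd [hi ho _]] := flip_regionP k2 e2.
  rewrite e1 in hR; case/kangP: (k1) => p1 /(_ _ hR) hc.
  have := card_lower xR yR xy; rewrite /= in hi *; rewrite hi => hL.
  rewrite e1 in nd; have [far farR ho2] := split_outer hR xR yR xy nd.
  have : lower (flip_region S2 (x, y)) x y \proper flip_region S2 (x, y).
    rewrite properE; apply/andP; split; first by apply/subsetP => v; rewrite inE => /andP[].
    by apply/negP => /subsetP /(_ far farR); rewrite inE /=; move: ho2; clear; case: (_ \in _) => //=; lia.
  by move/proper_card; rewrite hL hc; clear; lia.
move=> kS kS' ne h1 h2.
have [e eS eS'] : exists2 e, e \in S & e \notin S'.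
  apply/subsetPn/negP => sub; apply: ne; exact: (nest _ _ _ kS kS' h2).
have [e' e'S' e'S] : exists2 e', e' \in S' & e' \notin S.
  apply/subsetPn/negP => sub; apply: ne; apply/esym; exact: (nest _ _ _ kS' kS h1).
have eq1 (c : chord m) : c \in S -> c \in S' \/ c = e.
  case: c e eS eS' => [c d] [x y] eS eS' /h1[|e1]; [by left|right].
  have [h|e2] := h1 _ _ eS; first by rewrite h in eS'.
  by move: e2; rewrite -e1 => -[/val_inj -> /val_inj ->].
have eq2 (c : chord m) : c \in S' -> c \in S \/ c = e'.
  case: c e' e'S e'S' => [c d] [x y] e'S e'S' /h2[|e1]; [by left|right].
  have [h|e2] := h2 _ _ e'S'; first by rewrite h in e'S.
  by move: e2; rewrite -e1 => -[/val_inj -> /val_inj ->].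
pose Q := S :&: S'.
have nQ : e \notin Q by rewrite inE negb_and eS' orbT.
have nQ' : e' \notin Q by rewrite inE negb_and e'S.
have eSQ : e |: Q = S.
  apply/setP => c; rewrite in_setU1 in_setI; apply/orP/idP => [[/eqP->//|/andP[]//]|cS].
  by have [h|->] := eq1 _ cS; [right; rewrite cS | left].
have eSQ' : e' |: Q = S'.
  apply/setP => c; rewrite in_setU1 in_setI; apply/orP/idP => [[/eqP->//|/andP[]//]|cS].
  by have [h|->] := eq2 _ cS; [right; rewrite cS h | left].
have nee : e != e' by apply: contraNneq eS' => ->.
have kS1 := kS; have kS1' := kS'; rewrite -eSQ in kS1; rewrite -eSQ' in kS1'.
have [h3 h4] := flip_of_common nQ nQ' nee kS1 kS1'.
by exists e, e'; rewrite eSQ in h3 h4; split=> //; rewrite -h4 eSQ'.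
Qed.

Lemma rotation_flip w w' : w \in trees q n -> rotation q w w' -> w <> w' ->
  exists e e', [/\ e \in dissection w, e' \in replacements (dissection w) e &
                   dissection w' = flip (dissection w) e e'].
Proof.
move=> hw hr ne; have hw' := rotation_trees hr hw.
have [c0 [d0 h]] := rotation_spans 0 hr; have [c1 [d1 h']] := rotation_spans 0 (rotation_sym hr).
apply: (@kang_near _ _ (c0, d0) (c1, d1)).
- exact: kang_dissection.
- exact: kang_dissection.
- by move/(dissection_inj hw hw').
- move=> c d; rewrite !inE /= => /andP[-> /asboolP /h[[-> ->]|h3]]; [by right|left].
  exact/asboolP.
- move=> c d; rewrite !inE /= => /andP[-> /asboolP /h'[[-> ->]|h3]]; [by right|left].
  exact/asboolP.
Qed.

End Bridge.

Import Order.TTheory GRing.Theory Num.Theory.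
Local Open Scope ring_scope.

Lemma eq_ler (R : realFieldType) (x y : R) : x = y -> x <= y.
Proof. by move->. Qed.

(** * Mean square distances *)

Section MeanSquareDistance.
Variables (R : realFieldType) (T : eqType) (f : T -> R).
Implicit Types (X Y Z : seq T).

Lemma ler_sum_seq (s : seq T) (F G : T -> R) :
  (forall x, x \in s -> F x <= G x) -> \sum_(x <- s) F x <= \sum_(x <- s) G x.
Proof. by move=> h; rewrite big_seq [leRHS]big_seq; apply: ler_sum. Qed.

Lemma ler_sum_sub (s1 s2 : seq T) (F : T -> R) : (forall x, 0 <= F x) ->
  uniq s1 -> {subset s1 <= s2} -> \sum_(x <- s1) F x <= \sum_(x <- s2) F x.
Proof.
move=> F0; elim: s1 s2 => [|x s1 IH] s2; first by rewrite big_nil sumr_ge0.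
case/andP=> xs1 us1 sub; rewrite big_cons.
have xs2 : x \in s2 by apply: sub; rewrite mem_head.
rewrite (perm_big _ (perm_to_rem xs2)) big_cons lerD2l; apply: IH => // y ys1.
have : y \in s2 by apply: sub; rewrite inE ys1 orbT.
rewrite (perm_mem (perm_to_rem xs2)) inE => /orP[/eqP yx|//].
by move: xs1; rewrite -yx ys1.
Qed.

Definition sq_sum X Y := \sum_(x <- X) \sum_(y <- Y) (f x - f y) ^+ 2.
(** The mean of (f x - f y)^2 for independent uniform x in [X] and y in [Y]; twice the
    variance of f when X = Y. *)
Definition msd X Y := sq_sum X Y / (size X * size Y)%:R.

Lemma sq_sum_ge0 X Y : 0 <= sq_sum X Y.
Proof. by apply: sumr_ge0 => x _; apply: sumr_ge0 => y _; apply: sqr_ge0. Qed.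

Lemma msd_ge0 X Y : 0 <= msd X Y.
Proof. by rewrite divr_ge0 ?sq_sum_ge0. Qed.

Lemma msdC X Y : msd X Y = msd Y X.
Proof.
rewrite /msd mulnC; congr (_ / _); rewrite /sq_sum exchange_big /=.
by apply: eq_bigr => x _; apply: eq_bigr => y _; rewrite -opprB sqrrN.
Qed.

Lemma sqr_dist_triangle (a b c : R) : (a - c) ^+ 2 <= 2 * (a - b) ^+ 2 + 2 * (b - c) ^+ 2.
Proof.
rewrite -subr_ge0; have -> : 2 * (a - b) ^+ 2 + 2 * (b - c) ^+ 2 - (a - c) ^+ 2 = (a - b - (b - c)) ^+ 2.
  by ring.
exact: sqr_ge0.
Qed.

Lemma sumr_cst (c : R) X : \sum_(x <- X) c = (size X)%:R * c.
Proof. by rewrite big_const_seq count_predT iter_addr_0 mulr_natl. Qed.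

Lemma sq_sum_triangle X Y Z : (size Y)%:R * sq_sum X Z <=
  2 * (size Z)%:R * sq_sum X Y + 2 * (size X)%:R * sq_sum Y Z.
Proof.
have -> : (size Y)%:R * sq_sum X Z = \sum_(x <- X) \sum_(z <- Z) \sum_(y <- Y) (f x - f z) ^+ 2.
  rewrite mulr_sumr; apply: eq_bigr => x _; rewrite mulr_sumr; apply: eq_bigr => z _.
  by rewrite sumr_cst.
apply: le_trans (_ : \sum_(x <- X) \sum_(z <- Z) \sum_(y <- Y)
   (2 * (f x - f y) ^+ 2 + 2 * (f y - f z) ^+ 2) <= _).
  by do 3!apply: ler_sum => ? _; apply: sqr_dist_triangle.
apply: eq_ler; under eq_bigr do under eq_bigr do rewrite big_split /=.
under eq_bigr do rewrite big_split /=.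
rewrite big_split /=; congr (_ + _).
  rewrite /sq_sum mulr_sumr; apply: eq_bigr => x _.
  by rewrite sumr_cst -mulr_sumr; ring.
rewrite sumr_cst exchange_big /=.
rewrite (_ : \sum_(y <- Y) _ = 2 * sq_sum Y Z); first by ring.
by rewrite /sq_sum mulr_sumr; apply: eq_bigr => y _; rewrite mulr_sumr.
Qed.

Lemma msd_triangle X Y Z : (0 < size X)%N -> (0 < size Y)%N -> (0 < size Z)%N ->
  msd X Z <= 2 * msd X Y + 2 * msd Y Z.
Proof.
move=> hX hY hZ; rewrite /msd !natrM.
have := sq_sum_triangle X Y Z.
have hx : (0 : R) < (size X)%:R by rewrite ltr0n.
have hy : (0 : R) < (size Y)%:R by rewrite ltr0n.
have hz : (0 : R) < (size Z)%:R by rewrite ltr0n.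
move: hx hy hz; set x := (size X)%:R; set y := (size Y)%:R; set z := (size Z)%:R.
move=> hx hy hz h.
rewrite -(ler_pM2l (mulr_gt0 hy (mulr_gt0 hx hz))).
have -> : y * (x * z) * (sq_sum X Z / (x * z)) = y * sq_sum X Z.
  by field; rewrite !gt_eqF.
apply: le_trans h _; apply: eq_ler; field; by rewrite !gt_eqF.
Qed.

Lemma size_msd X Y : (0 < size X)%N -> (size X)%:R * msd X Y = sq_sum X Y / (size Y)%:R.
Proof. by move=> hX; rewrite /msd natrM invfM mulrCA mulVKf // pnatr_eq0 -lt0n. Qed.

Lemma msd_sub X X' Y Y' (L : R) : uniq X' -> uniq Y' ->
  {subset X' <= X} -> {subset Y' <= Y} -> (0 < size X')%N -> (0 < size Y')%N ->
  (size X * size Y)%:R <= L * (size X' * size Y')%:R -> msd X' Y' <= L * msd X Y.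
Proof.
move=> uX uY sX sY hX hY hL.
have hX0 := leq_trans hX (uniq_leq_size uX sX).
have hY0 := leq_trans hY (uniq_leq_size uY sY).
have h1 : (0 : R) < (size X * size Y)%:R by rewrite ltr0n muln_gt0 hX0.
have h2 : (0 : R) < (size X' * size Y')%:R by rewrite ltr0n muln_gt0 hX.
rewrite /msd mulrA ler_pdivlMr // mulrAC ler_pdivrMr //.
apply: le_trans (_ : sq_sum X Y * (size X * size Y)%:R <= _).
  rewrite ler_pM2r //; apply: le_trans (_ : \sum_(x <- X') \sum_(y <- Y) (f x - f y) ^+ 2 <= _).
    by apply: ler_sum => x _; apply: ler_sum_sub => // y; apply: sqr_ge0.
  by apply: ler_sum_sub => // x; apply: sumr_ge0 => y _; apply: sqr_ge0.
rewrite [leRHS](_ : _ = sq_sum X Y * (L * (size X' * size Y')%:R)); last by ring.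
by rewrite ler_wpM2l ?sq_sum_ge0.
Qed.

(** Go from [X] to [Y] through [I].  As [I] is a part 1/L of [X], the distance from [X] to
    [I] is at most L times that of [X] to itself; likewise for [Y]. *)
Lemma msd_overlap X Y (I : seq T) (L : R) : uniq X -> uniq Y -> uniq I -> (0 < size I)%N ->
  {subset I <= X} -> {subset I <= Y} ->
  (size X)%:R <= L * (size I)%:R -> (size Y)%:R <= L * (size I)%:R ->
  msd X Y <= 2 * L * (msd X X + msd Y Y).
Proof.
move=> uX uY uI hI sX sY hX hY.
have hX0 := leq_trans hI (uniq_leq_size uI sX).
have hY0 := leq_trans hI (uniq_leq_size uI sY).
apply: le_trans (msd_triangle hX0 hI hY0) _.
rewrite mulrDr -!mulrA; apply: lerD; rewrite ler_pM2l ?ltr0n //.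
- by rewrite msdC; apply: msd_sub => //; rewrite !natrM mulrA ler_wpM2r.
- by apply: msd_sub => //; rewrite !natrM mulrA ler_wpM2r.
Qed.

End MeanSquareDistance.

(** * The recursion for the Poincare constant *)

Section Poincare.
Variables (q : nat) (R : realFieldType).
Implicit Types (f : bitseq -> R) (n a b u v : nat) (d g : nat * nat).

Definition energy n f : R :=
  \sum_(w <- trees q n) \sum_(w' <- trees q n) `[< rotation q w w' >]%:R * (f w - f w') ^+ 2.

(** The factor [ntrees q n] makes [A] the inverse spectral gap of the walk that performs
    each rotation at rate 1, up to a constant factor. *)
Definition poincare n (A : R) :=
  0 <= A /\ forall f, sq_sum f (trees q n) (trees q n) <= A * (ntrees q n)%:R * energy n f.

Lemma energy_term_ge0 f w w' : 0 <= `[< rotation q w w' >]%:R * (f w - f w') ^+ 2.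
Proof. by rewrite mulr_ge0 ?ler0n ?sqr_ge0. Qed.

Lemma energy_ge0 n f : 0 <= energy n f.
Proof. by apply: sumr_ge0 => w _; apply: sumr_ge0 => w' _; apply: energy_term_ge0. Qed.

Lemma rotation_energy n f w w' : w \in trees q n -> rotation q w w' -> (f w - f w') ^+ 2 <= energy n f.
Proof.
move=> hw hr; have hw' := rotation_trees hr hw.
rewrite /energy (big_rem _ hw) /= (big_rem _ hw') /= asboolT // mul1r -addrA lerDl addr_ge0 //.
  by apply: sumr_ge0 => ? _; apply: energy_term_ge0.
by apply: sumr_ge0 => ? _; apply: sumr_ge0 => ? _; apply: energy_term_ge0.
Qed.

Lemma dist_to_comb n w : w \in trees q n ->
  exists2 K : R, 0 <= K & forall f, (f w - f (comb q n)) ^+ 2 <= K * energy n f.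
Proof.
move: {2}(inversions w) (leqnn (inversions w)) => l.
elim: l w => [|l IH] w hl hw.
all: case/forestsP: (hw) => fw nw; have := comb_or_rotation fw; rewrite nw => -[-> | [w' hr hi]].
- by exists 0 => // f; rewrite subrr expr0n mul0r.
- by lia.
- by exists 0 => // f; rewrite subrr expr0n mul0r.
have [|K K0 hK] := IH w' _ (rotation_trees hr hw); first by lia.
exists (2 + 2 * K) => [|f]; first by lra.
apply: le_trans (sqr_dist_triangle _ (f w') _) _.
by have := rotation_energy f hw hr; have := hK f; lra.
Qed.

(** Every tree can be rotated into the comb, so some constant serves any single [n].  It
    is used for the bottom of the recursion only. *)
Lemma poincare_exists n : exists A : R, poincare n A.
Proof.
suff [K K0 hK] : exists2 K : R, 0 <= K &
    forall f, \sum_(w <- trees q n) (f w - f (comb q n)) ^+ 2 <= K * energy n f.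
  exists (4 * K); split=> [|f]; first lra.
  have hC : (size (trees q n))%:R = (ntrees q n)%:R :> R by [].
  have := sq_sum_triangle f (trees q n) [:: comb q n] (trees q n).
  have e : sq_sum f (trees q n) [:: comb q n] = \sum_(w <- trees q n) (f w - f (comb q n)) ^+ 2.
    by apply: eq_bigr => w _; rewrite big_seq1.
  have -> : sq_sum f [:: comb q n] (trees q n) = sq_sum f (trees q n) [:: comb q n].
    by rewrite e /sq_sum big_seq1; apply: eq_bigr => w _; rewrite -opprB sqrrN.
  rewrite mul1r e hC => /le_trans; apply.
  have := ler_wpM2l (ler0n R (ntrees q n)) (hK f); lra.
have : {subset trees q n <= trees q n} by [].
elim: {1 3}(trees q n) => [|w s IH] sub.
  by exists 0 => // f; rewrite big_nil mul0r.
have [K K0 hK] := IH (fun x xs => sub x (@mem_behead _ (w :: s) x xs)).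
have [K' K'0 hK'] := dist_to_comb (sub w (mem_head _ _)).
exists (K' + K) => [|f]; first exact: addr_ge0.
by rewrite big_cons mulrDl lerD.
Qed.

Lemma poincare_le n (A A' : R) : A <= A' -> poincare n A -> poincare n A'.
Proof.
move=> hA [A0 h]; split=> [|f]; first exact: le_trans hA.
apply: le_trans (h f) _; rewrite -!mulrA ler_wpM2r //.
by rewrite mulr_ge0 ?ler0n ?energy_ge0.
Qed.

Lemma slot_leaf n u a s : slot q n (u, a) -> s \in trees q (n - a) -> (u < leaves s)%N.
Proof. by case/andP => /= _ hu /leaves_trees ->; rewrite ltnS. Qed.

Lemma graft_in_trees n u a s t : slot q n (u, a) -> s \in trees q (n - a) -> t \in trees q a ->
  graft s u t \in trees q n.
Proof.
move=> hsl hs ht; case/andP: (hsl) => /= ha _; rewrite -(subnKC ha).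
by apply: graft_tree => //; apply: (slot_leaf hsl hs).
Qed.

(** Rotations of the grafted tree are rotations of the whole tree, and different pairs of a
    host and a rotation give different rotations. *)
Lemma energy_inner n u a f : slot q n (u, a) ->
  \sum_(s <- trees q (n - a)) energy a (fun t => f (graft s u t)) <= energy n f.
Proof.
move=> hsl.
pose G w := \sum_(w' <- trees q n) `[< rotation q w w' >]%:R * (f w - f w') ^+ 2.
have G0 w : 0 <= G w by apply: sumr_ge0 => w' _; apply: energy_term_ge0.
apply: le_trans (ler_sum_sub G0 (uniq_grafts hsl) (sub_grafts hsl)); rewrite big_allpairs_dep.
apply: ler_sum_seq => s hs; apply: ler_sum_seq => t ht.
pose H w' := `[< rotation q (graft s u t) w' >]%:R * (f (graft s u t) - f w') ^+ 2.
apply: le_trans (_ : \sum_(w' <- [seq graft s u t' | t' <- trees q a]) H w' <= _).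
  rewrite big_map; apply: ler_sum => t' _; rewrite /H ler_wpM2r ?sqr_ge0 // ler_nat.
  case: (asboolP (rotation q t t')) => // hr; rewrite asboolT //.
  by apply: rotation_graft_r => //; apply: (slot_leaf hsl hs).
apply: ler_sum_sub.
- by move=> w'; apply: energy_term_ge0.
- rewrite map_inj_in_uniq ?uniq_forests // => t1 t2 /forestsP[f1 n1] /forestsP[f2 n2] e.
  by have [|_] := graft_inj (slot_leaf hsl hs) (slot_leaf hsl hs) f1 f2 _ e; rewrite ?n1.
- by move=> w' /mapP[t' ht' ->]; apply: (graft_in_trees hsl).
Qed.

Lemma energy_outer n u a f : slot q n (u, a) ->
  \sum_(t <- trees q a) energy (n - a) (fun s => f (graft s u t)) <= energy n f.
Proof.
move=> hsl.
pose G w := \sum_(w' <- trees q n) `[< rotation q w w' >]%:R * (f w - f w') ^+ 2.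
have G0 w : 0 <= G w by apply: sumr_ge0 => w' _; apply: energy_term_ge0.
apply: le_trans (ler_sum_sub G0 (uniq_grafts hsl) (sub_grafts hsl)); rewrite big_allpairs_dep.
rewrite [leRHS]exchange_big /=.
apply: ler_sum_seq => t ht; apply: ler_sum_seq => s hs.
pose H w' := `[< rotation q (graft s u t) w' >]%:R * (f (graft s u t) - f w') ^+ 2.
case/forestsP: (ht) => ft nt.
apply: le_trans (_ : \sum_(w' <- [seq graft s' u t | s' <- trees q (n - a)]) H w' <= _).
  rewrite big_map; apply: ler_sum => s' _; rewrite /H ler_wpM2r ?sqr_ge0 // ler_nat.
  by case: (asboolP (rotation q s s')) => // hr; rewrite asboolT //; apply: rotation_graft_l.
apply: ler_sum_sub.
- by move=> w'; apply: energy_term_ge0.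
- rewrite map_inj_in_uniq ?uniq_forests // => s1 s2 h1 h2 e.
  by have [] := graft_inj (slot_leaf hsl h1) (slot_leaf hsl h2) ft ft _ e.
- by move=> w' /mapP[s' hs' ->]; apply: (graft_in_trees hsl).
Qed.

Lemma size_trees n : size (trees q n) = ntrees q n. Proof. by []. Qed.

(** The class of a slot is a product.  Change the two factors one after the other; each
    change is controlled by the Poincare inequality of its factor. *)
Lemma msd_grafts n u a f (A : R) : slot q n (u, a) -> poincare a A -> poincare (n - a) A ->
  (size (grafts q n u a))%:R * msd f (grafts q n u a) (grafts q n u a) <= 4 * A * energy n f.
Proof.
move=> hsl [A0 ha] [_ hb].
set X := grafts q n u a.
have hX : (0 : R) < (size X)%:R by rewrite ltr0n size_grafts muln_gt0 !ntrees_gt0.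
suff h : sq_sum f X X <= 4 * A * energy n f * (size X)%:R.
  by rewrite size_msd ?ler_pdivrMr // -(ltr0n R).
pose x : R := (ntrees q a)%:R; pose y : R := (ntrees q (n - a))%:R.
have x0 : 0 <= x by apply: ler0n. have y0 : 0 <= y by apply: ler0n.
have -> : (size X)%:R = x * y by rewrite size_grafts natrM.
pose S1 := \sum_(s <- trees q (n - a)) sq_sum (fun t => f (graft s u t)) (trees q a) (trees q a).
pose S2 := \sum_(t <- trees q a) sq_sum (fun s => f (graft s u t)) (trees q (n - a)) (trees q (n - a)).
have h1 : S1 <= A * x * energy n f.
  apply: le_trans (_ : \sum_(s <- trees q (n - a)) A * x * energy a (fun t => f (graft s u t)) <= _).
    by apply: ler_sum => s _; apply: ha.
  by rewrite -mulr_sumr ler_wpM2l ?mulr_ge0 // energy_inner.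
have h2 : S2 <= A * y * energy n f.
  apply: le_trans (_ : \sum_(t <- trees q a) A * y * energy (n - a) (fun s => f (graft s u t)) <= _).
    by apply: ler_sum => s _; apply: hb.
  by rewrite -mulr_sumr ler_wpM2l ?mulr_ge0 // energy_outer.
suff h : sq_sum f X X <= 2 * y * S1 + 2 * x * S2.
  apply: le_trans h _.
  have := ler_wpM2l y0 h1; have := ler_wpM2l x0 h2; lra.
apply: le_trans (_ : \sum_(s <- trees q (n - a)) \sum_(t <- trees q a)
    \sum_(s' <- trees q (n - a)) \sum_(t' <- trees q a)
     (2 * (f (graft s u t) - f (graft s u t')) ^+ 2 +
      2 * (f (graft s u t') - f (graft s' u t')) ^+ 2) <= _).
  rewrite /sq_sum /X big_allpairs_dep; apply: ler_sum => s _; apply: ler_sum => t _.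
  rewrite big_allpairs_dep; apply: ler_sum => s' _; apply: ler_sum => t' _.
  exact: sqr_dist_triangle.
apply: eq_ler.
under eq_bigr do under eq_bigr do under eq_bigr do rewrite big_split /=.
under eq_bigr do under eq_bigr do rewrite big_split /=.
under eq_bigr do rewrite big_split /=.
rewrite big_split /=; congr (_ + _).
- rewrite /S1 mulr_sumr; apply: eq_bigr => s _.
  rewrite /sq_sum mulr_sumr; apply: eq_bigr => t _.
  by rewrite sumr_cst size_trees -mulr_sumr /y; ring.
- under eq_bigr do rewrite sumr_cst.
  rewrite -mulr_sumr size_trees -/x.
  rewrite (_ : \sum_(s <- trees q (n - a)) _ = 2 * S2); first by ring.
  rewrite /S2 [in RHS]mulr_sumr.
  under [RHS]eq_bigr do rewrite /sq_sum mulr_sumr.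
  rewrite [RHS]exchange_big /=; apply: eq_bigr => s _.
  under [RHS]eq_bigr do rewrite mulr_sumr.
  by rewrite [RHS]exchange_big.
Qed.

(** The length of the word of a tree, which bounds all polynomial losses. *)
Definition wordlen n : nat := (q.+1 * n).+1.

(** The classes of two slots overlap in a polynomial fraction of each, so that
    [msd_overlap] bounds their distance. *)
Definition compat n d g := exists I : seq bitseq,
  [/\ uniq I, (0 < size I)%N, {subset I <= grafts q n d.1 d.2}, {subset I <= grafts q n g.1 g.2} &
   (size (grafts q n d.1 d.2) <= wordlen n ^ 4 * size I)%N /\
   (size (grafts q n g.1 g.2) <= wordlen n ^ 4 * size I)%N].

Lemma compat_sym n d g : compat n d g -> compat n g d.
Proof. by case=> I [uI I0 h1 h2 [h3 h4]]; exists I. Qed.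

Lemma ntrees_submult_le n m b : (0 < q)%N -> (b <= m)%N -> (m <= n)%N ->
  (ntrees q m <= wordlen n ^ 4 * (ntrees q b * ntrees q (m - b)))%N.
Proof.
move=> q0 hb hm; apply: leq_trans (ntrees_submult q0 hb) _.
by rewrite leq_mul2r leq_exp2r // ltnS leq_mul2l hm !orbT.
Qed.

Lemma compat_disjoint n u a v b : (0 < q)%N -> slot q n (u, a) -> slot q n (v, b) ->
  (u + (q * a).+1 <= v)%N -> compat n (u, a) (v, b).
Proof.
move=> q0 sa sb huv; have [I [uI sI sJ hI]] := grafts_disjoint sa sb huv.
case/andP: (sa) => /= ha hu; case/andP: (sb) => /= hb hv.
have hab : (a + b <= n)%N by nia.
exists I; split=> //=; first by rewrite hI !muln_gt0 !ntrees_gt0.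
rewrite hI !size_grafts; split.
  rewrite mulnCA leq_mul2l; apply/orP; right.
  by apply: ntrees_submult_le => //; lia.
rewrite [(ntrees q a * _)%N]mulnCA [(_ * (ntrees q b * _))%N]mulnCA leq_mul2l; apply/orP; right.
have -> : (n - a - b = n - b - a)%N by lia.
by apply: ntrees_submult_le => //; lia.
Qed.

Lemma compat_nested n u a v b : (0 < q)%N -> slot q n (u, a) -> slot q a (v, b) ->
  compat n (u, a) (u + v, b)%N.
Proof.
move=> q0 sa sb; have [I [uI sI sJ hI]] := grafts_nested sa sb.
case/andP: (sa) => /= ha hu; case/andP: (sb) => /= hb hv.
exists I; split=> //=; first by rewrite hI !muln_gt0 !ntrees_gt0.
rewrite hI !size_grafts; split.
  by rewrite mulnA leq_mul2r ntrees_submult_le ?orbT.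
rewrite -(mulnA (ntrees q b)) [(_ * (ntrees q b * _))%N]mulnCA leq_mul2l; apply/orP; right.
have -> : (n - a = n - b - (a - b))%N by lia.
by apply: ntrees_submult_le => //; lia.
Qed.

(** Three slots of size about n / 3: at the far left, immediately to the right of this
    one, and at the far right.  A slot that is disjoint from neither the first nor the
    last reaches from the first third to the last and so contains the middle one. *)
Lemma hubs n : (0 < q)%N -> (4 <= n)%N -> exists2 g0, slot q n g0 && balanced q n g0.2 &
  forall d, slot q n d ->
    exists2 g, slot q n g && balanced q n g.2 & compat n d g /\ (g = g0 \/ compat n g g0).
Proof.
move=> q0 hn; pose b := ((n - 1) %/ 3)%N.
have hb1 : (3 * b <= n - 1)%N by rewrite mulnC leq_trunc_div.
have hb2 : (n <= 3 * b + 3)%N by have := ltn_ceil (n - 1) (isT : (0 < 3)%N); rewrite -/b; lia.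
have hb : balanced q n b by apply/andP; split; nia.
have hqb : (q * (3 * b + 1) <= q * n)%N by rewrite leq_mul2l; lia.
pose g0 := (0, b)%N; pose g1 := ((q * b).+1, b)%N; pose g2 := (q * (n - b), b)%N.
have s0 : slot q n g0 by apply/andP; split=> //=; lia.
have s1 : slot q n g1 by apply/andP; split=> /=; [lia | rewrite mulnBr; nia].
have s2 : slot q n g2 by apply/andP; split=> //=; lia.
have c1 : compat n g1 g0 by apply/compat_sym/compat_disjoint.
have c2 : compat n g2 g0.
  by apply/compat_sym/compat_disjoint => //; rewrite mulnBr; nia.
exists g0 => [|[u a] sd]; first by rewrite s0.
case: (leqP (q * b).+1 u) => h1.
  by exists g0; rewrite ?s0 //; split; [apply/compat_sym/compat_disjoint | left].
case: (leqP (u + (q * a).+1) (q * (n - b))) => h2.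
  by exists g2; rewrite ?s2 //; split; [apply/compat_disjoint | right].
exists g1; rewrite ?s1 //; split; last by right.
have -> : g1 = (u + ((q * b).+1 - u), b)%N by rewrite /g1; congr pair; lia.
move: h2; rewrite mulnBr => h2.
apply: compat_nested => //; apply/andP; split=> /=; first by nia.
by rewrite mulnBr; nia.
Qed.

Definition slots n := [seq d <- [seq (u, a) | u <- iota 0 (wordlen n), a <- iota 0 (wordlen n)]
                      | slot q n d && balanced q n d.2].

Lemma mem_slots n d : (d \in slots n) = slot q n d && balanced q n d.2.
Proof.
rewrite mem_filter andb_idr // => /andP[/andP[h1 h2] _].
rewrite (surjective_pairing d) allpairs_f // mem_iota /= add0n ltnS /wordlen; nia.
Qed.

Lemma size_slots n : (size (slots n) <= wordlen n ^ 2)%N.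
Proof.
rewrite size_filter (leq_trans (count_size _ _)) //.
by rewrite size_allpairs size_iota.
Qed.

Lemma msd_compat n f d g : slot q n d -> slot q n g -> compat n d g ->
  msd f (grafts q n d.1 d.2) (grafts q n g.1 g.2) <= 2 * (wordlen n ^ 4)%:R *
    (msd f (grafts q n d.1 d.2) (grafts q n d.1 d.2) + msd f (grafts q n g.1 g.2) (grafts q n g.1 g.2)).
Proof.
case: d g => [u a] [v b] sd sg [I [uI I0 h1 h2 [h3 h4]]]; apply: (msd_overlap _ _ _ uI) => //.
- exact: uniq_grafts.
- exact: uniq_grafts.
- by rewrite -natrM ler_nat.
- by rewrite -natrM ler_nat.
Qed.

(** Every tree belongs to the class of a balanced slot, every such class is compatible
    with a hub, and the other hubs are compatible with the first.  So the mean square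
    distance from any of these classes to the first hub is polynomially bounded by
    distances inside classes, which [msd_grafts] controls.  Summing over the at most
    [wordlen n ^ 2] balanced slots bounds the distance from the set of all trees to the
    first hub, and the triangle inequality through that hub does the rest. *)
Lemma poincare_step n (A : R) : (0 < q)%N -> (4 <= n)%N ->
  (forall a, (a <= n)%N -> balanced q n a -> poincare a A /\ poincare (n - a) A) ->
  poincare n (256 * (wordlen n ^ 10)%:R * A).
Proof.
move=> q0 hn hA.
have [g0 hg0 hub] := hubs q0 hn; case/andP: (hg0) => s0 b0.
have A0 : 0 <= A.
  by have [||[]] := hA g0.2; case/andP: s0.
pose M : R := (wordlen n)%:R; have M1 : 1 <= M by rewrite /M ler1n.
have eL : (wordlen n ^ 4)%:R = M ^+ 4 by rewrite natrX.
have L1 : 1 <= M ^+ 4 by apply: exprn_ege1.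
split=> [|f]; first by rewrite !mulr_ge0 ?ler0n.
set E := energy n f; have E0 : 0 <= E by apply: energy_ge0.
pose X := 4 * A * E; have X0 : 0 <= X by rewrite !mulr_ge0 // ler0n.
pose N d : R := (size (grafts q n d.1 d.2))%:R; pose B d g := msd f (grafts q n d.1 d.2) (grafts q n g.1 g.2).
have N0 d : 0 < N d by rewrite ltr0n size_grafts muln_gt0 !ntrees_gt0.
have B0 d g : 0 <= B d g by apply: msd_ge0.
have hX d : slot q n d && balanced q n d.2 -> N d * B d d <= X.
  case: d => u a /andP[sd bd]; apply: msd_grafts => //.
    by apply: (hA _ _ bd).1; case/andP: sd.
  by apply: (hA _ _ bd).2; case/andP: sd.
have hN d : slot q n d -> N d <= (ntrees q n)%:R.
  by case: d => u a sd; rewrite ler_nat uniq_leq_size ?uniq_grafts //; apply: sub_grafts.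
have hL d : slot q n d -> (ntrees q n)%:R <= M ^+ 4 * N d.
  case: d => u a /andP[/= ha _]; rewrite -eL -natrM ler_nat size_grafts; apply: ntrees_submult_le => //.
have hXd d g : slot q n d -> slot q n g && balanced q n g.2 -> N d * B g g <= M ^+ 4 * X.
  move=> sd /[dup] /hX h /andP[sg _].
  apply: le_trans (_ : M ^+ 4 * N g * B g g <= _).
    by rewrite ler_wpM2r //; apply: le_trans (hN _ sd) (hL _ sg).
  by rewrite -mulrA ler_wpM2l // (le_trans _ L1).
have hd d : slot q n d && balanced q n d.2 -> N d * B d g0 <= 16 * M ^+ 8 * X.
  move=> /[dup] hd /andP[sd _].
  have [g hg [cdg cgg0]] := hub d sd; case/andP: (hg) => sg _.
  have k1 : B d g <= 2 * M ^+ 4 * (B d d + B g g) by rewrite -eL; apply: msd_compat.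
  have k2 : B d g0 <= 2 * B d g + 4 * M ^+ 4 * (B g g + B g0 g0).
    case: cgg0 => [e|cg].
      have : 0 <= M ^+ 4 * (B g g + B g0 g0).
        by rewrite mulr_ge0 ?addr_ge0 // (le_trans _ L1).
      by move: (B0 d g); rewrite e; lra.
    have k3 : B g g0 <= 2 * M ^+ 4 * (B g g + B g0 g0) by rewrite -eL; apply: msd_compat.
    apply: le_trans (msd_triangle f _ (_ : (0 < size (grafts q n g.1 g.2))%N) _) _.
    - by have := N0 d; rewrite ltr0n.
    - by have := N0 g; rewrite ltr0n.
    - by have := N0 g0; rewrite ltr0n.
    by rewrite -/(B d g) -/(B g g0); lra.
  have k4 := hX _ hd; have k5 := hXd _ _ sd hg; have k6 := hXd _ _ sd hg0.
  have k7 : B d g0 <= 4 * M ^+ 4 * (B d d + B g g + B g g + B g0 g0) by lra.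
  apply: le_trans (ler_wpM2l (ltW (N0 d)) k7) _.
  apply: le_trans (_ : 4 * M ^+ 4 * (X + M ^+ 4 * X + M ^+ 4 * X + M ^+ 4 * X) <= _).
    rewrite mulrCA ler_wpM2l ?mulr_ge0 // ?(le_trans _ L1) // !mulrDr.
    by rewrite !lerD.
  have -> : M ^+ 8 = M ^+ 4 * M ^+ 4 by rewrite -exprD.
  have : X <= M ^+ 4 * X by rewrite ler_peMl.
  by move/(ler_wpM2l (le_trans ler01 L1)); lra.
pose c : R := (ntrees q n)%:R; have c0 : 0 < c by rewrite ltr0n ntrees_gt0.
pose G w := msd f [:: w] (grafts q n g0.1 g0.2).
have G0 w : 0 <= G w by apply: msd_ge0.
have eG Y : \sum_(w <- Y) G w = sq_sum f Y (grafts q n g0.1 g0.2) / N g0.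
  rewrite /sq_sum mulr_suml; apply: eq_bigr => w _.
  by rewrite /G /msd mul1n /sq_sum big_seq1.
have hW : c * msd f (trees q n) (grafts q n g0.1 g0.2) <= 16 * M ^+ 10 * X.
  have -> : c * msd f (trees q n) (grafts q n g0.1 g0.2) = \sum_(w <- trees q n) G w.
    by rewrite eG /c -size_trees size_msd // size_trees ntrees_gt0.
  (* the classes overlap, but the terms are nonnegative *)
  apply: le_trans (_ : \sum_(w <- flatten [seq grafts q n d.1 d.2 | d <- slots n]) G w <= _).
    apply: ler_sum_sub => //; first exact: uniq_forests.
    move=> w hw; have [|u [a [su bu hu]]] := balanced_subtree _ hw; first by apply: leq_trans hn.
    apply/flattenP; exists (grafts q n u a) => //; apply/mapP; exists (u, a) => //.
    by rewrite mem_slots su.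
  rewrite big_flatten big_map.
  apply: le_trans (_ : \sum_(d <- slots n) 16 * M ^+ 8 * X <= _).
    apply: ler_sum_seq => d; rewrite mem_slots => /hd; rewrite eG.
    by rewrite size_msd // -(ltr0n R) N0.
  rewrite sumr_cst; apply: le_trans (_ : M ^+ 2 * (16 * M ^+ 8 * X) <= _).
    rewrite ler_wpM2r //; last by rewrite -natrX ler_nat size_slots.
    by rewrite !mulr_ge0 // exprn_ge0 // (le_trans _ M1).
  by rewrite (_ : M ^+ 10 = M ^+ 2 * M ^+ 8) -?exprD //; apply: eq_ler; ring.
have hWW : msd f (trees q n) (trees q n) <= 4 * msd f (trees q n) (grafts q n g0.1 g0.2).
  apply: le_trans (msd_triangle f _ (_ : (0 < size (grafts q n g0.1 g0.2))%N) _) _.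
  - by rewrite size_trees ntrees_gt0.
  - by have := N0 g0; rewrite ltr0n.
  - by rewrite size_trees ntrees_gt0.
  by rewrite [msd f (grafts _ _ _ _) _]msdC; lra.
have -> : sq_sum f (trees q n) (trees q n) = c * (c * msd f (trees q n) (trees q n)).
  by rewrite /msd size_trees natrM -/c; field; rewrite gt_eqF.
have -> : 256 * (wordlen n ^ 10)%:R * A * c * E = c * (4 * (16 * M ^+ 10 * X)).
  by rewrite natrX -/M /X; ring.
rewrite ler_pM2l //; apply: le_trans (ler_wpM2l (ltW c0) hWW) _.
by rewrite mulrCA ler_pM2l ?ltr0n.
Qed.

End Poincare.

(** * Lazy symmetric chains *)

Section LazyChain.
Variables (R : realFieldType) (Omega : finType) (K P : Omega -> Omega -> R).
Implicit Types (g : Omega -> R) (x y : Omega).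
Hypotheses (K0 : forall x y, 0 <= K x y) (Ksym : forall x y, K x y = K y x)
  (K1 : forall x, \sum_y K x y = 1) (PK : forall x y, P x y = 2^-1 * (y == x)%:R + 2^-1 * K x y).

Lemma sum_delta g y : \sum_x g x * (y == x)%:R = g y.
Proof.
rewrite (bigD1 y) //= eqxx mulr1 big1 ?addr0 // => x /negbTE xy.
by rewrite eq_sym xy mulr0.
Qed.

Lemma chain_stepE g y : chain_step P g y = 2^-1 * g y + 2^-1 * \sum_x g x * K x y.
Proof.
rewrite /chain_step -[in 2^-1 * g y](sum_delta g y) !mulr_sumr -big_split /=.
by apply: eq_bigr => x _; rewrite PK; ring.
Qed.

Lemma jensen_sq g y : (\sum_x g x * K x y) ^+ 2 <= \sum_x K x y * g x ^+ 2.
Proof.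
set u := \sum_x _; have h : 0 <= \sum_x K x y * (g x - u) ^+ 2.
  by apply: sumr_ge0 => x _; rewrite mulr_ge0 ?sqr_ge0.
suff -> : \sum_x K x y * g x ^+ 2 = \sum_x K x y * (g x - u) ^+ 2 + u ^+ 2 by lra.
have e : \sum_x K x y * (g x - u) ^+ 2 =
    \sum_x K x y * g x ^+ 2 + (\sum_x g x * K x y) * (- 2 * u) + (\sum_x K x y) * u ^+ 2.
  by rewrite !mulr_suml -!big_split /=; apply: eq_bigr => x _; ring.
rewrite e -/u; under [X in _ + X * u ^+ 2]eq_bigr do rewrite Ksym.
by rewrite K1; ring.
Qed.

Lemma sum_K g : \sum_y \sum_x K x y * g x ^+ 2 = \sum_x g x ^+ 2.
Proof. by rewrite exchange_big /=; apply: eq_bigr => x _; rewrite -mulr_suml K1 mul1r. Qed.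

(** With V the sum of the g^2 and I the inner product of g and gK, the left side is at most
    (V + 2 I + V) / 4 by Jensen, that is, V - (V - I) / 2, and V - I is the sum on the
    right.  Laziness is what makes the mixed term 2 I appear. *)
Lemma lazy_contraction g : \sum_y chain_step P g y ^+ 2 <=
  \sum_y g y ^+ 2 - 2^-1 * \sum_x \sum_y P x y * (g x - g y) ^+ 2.
Proof.
set V := \sum_y g y ^+ 2; pose I := \sum_y g y * \sum_x g x * K x y.
have -> : \sum_x \sum_y P x y * (g x - g y) ^+ 2 = V - I.
  have -> : \sum_x \sum_y P x y * (g x - g y) ^+ 2 =
      2^-1 * (\sum_x \sum_y (K x y * g x ^+ 2) + \sum_x \sum_y (K x y * g y ^+ 2)
       - 2 * \sum_x \sum_y (g y * (g x * K x y))).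
    rewrite [2 * _]mulr_sumr -big_split -sumrB /= mulr_sumr; apply: eq_bigr => x _.
    rewrite [2 * _]mulr_sumr -big_split -sumrB /= mulr_sumr; apply: eq_bigr => y _.
    rewrite PK; case: eqP => [->|_] /=; last by rewrite mulr0n; field.
    by rewrite subrr; field.
  rewrite [X in X + _ - _](_ : _ = V); last first.
    by apply: eq_bigr => x _; rewrite -mulr_suml K1 mul1r.
  rewrite [X in _ + X - _](_ : _ = V); last first.
    by rewrite /V -sum_K; apply: eq_bigr => x _; apply: eq_bigr => y _; rewrite Ksym.
  rewrite [X in _ - 2 * X](_ : _ = I); last first.
    by rewrite exchange_big /=; apply: eq_bigr => y _; rewrite mulr_sumr.
  by field.
have -> : \sum_y chain_step P g y ^+ 2 =
    4^-1 * (V + 2 * I + \sum_y (\sum_x g x * K x y) ^+ 2).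
  rewrite mulr_sumr -!big_split /= mulr_sumr; apply: eq_bigr => y _.
  by rewrite chain_stepE; field.
have : \sum_y (\sum_x g x * K x y) ^+ 2 <= V.
  by rewrite /V -[leRHS]sum_K; apply: ler_sum => y _; apply: jensen_sq.
lra.
Qed.

Lemma P_col_sum y : \sum_x P x y = 1.
Proof.
have := chain_stepE (fun=> 1) y; rewrite /chain_step.
under eq_bigr do rewrite mul1r; move=> ->.
under eq_bigr do rewrite mul1r Ksym.
by rewrite K1; field.
Qed.

Variable A : R.
Hypotheses (A0 : 0 < A) (hA : forall g,
  \sum_x \sum_y (g x - g y) ^+ 2 <= A * \sum_x \sum_y P x y * (g x - g y) ^+ 2).
Let N : R := #|Omega|%:R.

Lemma sum_sq_dist g : \sum_x g x = 0 ->
  \sum_x \sum_y (g x - g y) ^+ 2 = 2 * N * \sum_x g x ^+ 2.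
Proof.
move=> g0.
have -> : \sum_x \sum_y (g x - g y) ^+ 2 =
    \sum_x (N * g x ^+ 2 + \sum_y g y ^+ 2 - 2 * g x * \sum_y g y).
  apply: eq_bigr => x _; rewrite [2 * _ * _]mulr_sumr.
  have -> : N * g x ^+ 2 = \sum_(y : Omega) g x ^+ 2 by rewrite sumr_const -mulr_natl.
  by rewrite -big_split -sumrB /=; apply: eq_bigr => y _; ring.
rewrite g0; under eq_bigr do rewrite mulr0 subr0.
by rewrite big_split /= -mulr_sumr sumr_const -[_ *+ _]mulr_natl -/N; ring.
Qed.

Lemma step_contraction g : \sum_x g x = 0 ->
  \sum_y chain_step P g y ^+ 2 <= (1 - N / A) * \sum_y g y ^+ 2.
Proof.
move=> g0; apply: le_trans (lazy_contraction g) _.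
have h : 2 * N * (\sum_x g x ^+ 2) / A <= \sum_x \sum_y P x y * (g x - g y) ^+ 2.
  by rewrite ler_pdivrMr // [leRHS]mulrC -sum_sq_dist.
by move: h; set D := \sum_x _; set V := \sum_y _; lra.
Qed.

(** As the uniform distribution is stationary, the deviation evolves by the same linear
    map, and its sum stays zero. *)
Definition deviation S0 t S := dist_at P S0 t S - uniform_dist R S.

Lemma deviation_step S0 t S : deviation S0 t.+1 S = chain_step P (deviation S0 t) S.
Proof.
rewrite /deviation /dist_at iterS -/(dist_at P S0 t) /chain_step.
under [RHS]eq_bigr do rewrite mulrBl.
by rewrite sumrB /uniform_dist -mulr_sumr P_col_sum mulr1.
Qed.

Lemma sum_chain_step g : \sum_y chain_step P g y = \sum_x g x.
Proof.
rewrite exchange_big /=; apply: eq_bigr => x _; rewrite -mulr_sumr.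
under eq_bigr do rewrite PK eq_sym Ksym -PK.
by rewrite P_col_sum mulr1.
Qed.

Lemma deviation_sum0 S0 t : \sum_S deviation S0 t S = 0.
Proof.
elim: t => [|t IH]; last first.
  by under eq_bigr do rewrite deviation_step; rewrite sum_chain_step IH.
rewrite sumrB /uniform_dist sumr_const -[_ *+ _]mulr_natl divff; last first.
  by rewrite pnatr_eq0 -lt0n; apply/card_gt0P; exists S0.
rewrite (bigD1 S0) //= /point_mass eqxx big1 ?addr0 ?subrr // => x /negbTE xS.
by rewrite /point_mass xS.
Qed.

Lemma deviation0_le1 S0 : \sum_S deviation S0 0 S ^+ 2 <= 1.
Proof.
have N0 : 0 < N by rewrite ltr0n; apply/card_gt0P; exists S0.
have -> : \sum_S deviation S0 0 S ^+ 2 = \sum_S ((S == S0)%:R * (1 - 2 * N^-1) + N^-2).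
  by apply: eq_bigr => S _; rewrite /deviation /= /point_mass /uniform_dist -/N;
    case: (S == S0); rewrite ?mul1r ?mul0r -?exprVn /= ?mulr0n; ring.
rewrite big_split /= -mulr_suml sumr_const -[N^-2 *+ _]mulr_natl -/N.
rewrite (bigD1 S0) //= eqxx big1 ?addr0 ?mulr1n ?mul1r; last by move=> x /negbTE ->.
have -> : N * N^-2 = N^-1 by field; rewrite gt_eqF.
have : 0 < N^-1 by rewrite invr_gt0.
lra.
Qed.

(** Cauchy and Schwarz, in the form that the sum of (u x - u y)^2 is nonnegative. *)
Lemma tv_dist_le S0 t :
  tv_dist (dist_at P S0 t) (uniform_dist R (Omega:=Omega)) ^+ 2 <= 4^-1 * (N * \sum_S deviation S0 t S ^+ 2).
Proof.
rewrite /tv_dist exprMn; have -> : 2^-1 ^+ 2 = 4^-1 :> R by field.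
rewrite ler_pM2l ?invr_gt0 ?ltr0n //.
pose u S := `|deviation S0 t S|.
have -> : \sum_S deviation S0 t S ^+ 2 = \sum_S u S ^+ 2.
  by apply: eq_bigr => S _; rewrite /u real_normK // num_real.
have h : 0 <= \sum_x \sum_y (u x - u y) ^+ 2.
  by apply: sumr_ge0 => x _; apply: sumr_ge0 => y _; apply: sqr_ge0.
suff e : \sum_x \sum_y (u x - u y) ^+ 2 = 2 * (N * \sum_x u x ^+ 2) - 2 * (\sum_x u x) ^+ 2.
  by move: h; rewrite e /u /deviation; lra.
have -> : \sum_x \sum_y (u x - u y) ^+ 2 =
    \sum_x (N * u x ^+ 2 + \sum_y u y ^+ 2 - 2 * u x * \sum_y u y).
  apply: eq_bigr => x _; rewrite [2 * _ * _]mulr_sumr.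
  have -> : N * u x ^+ 2 = \sum_(y : Omega) u x ^+ 2 by rewrite sumr_const -mulr_natl.
  by rewrite -big_split -sumrB /=; apply: eq_bigr => y _; ring.
rewrite sumrB big_split /= -mulr_sumr -mulr_suml -mulr_sumr sumr_const.
by rewrite -[(\sum_y u y ^+ 2) *+ _]mulr_natl -/N; ring.
Qed.

End LazyChain.

(** * The flip walk *)

Section Rank.
Variables (m : nat) (F : {set 'I_m}).
Implicit Types (x y v : 'I_m).

Definition rank v := #|[set w in F | (w < v)%N]|.

Lemma rank_lt x y : x \in F -> (x < y)%N -> (rank x < rank y)%N.
Proof.
move=> xF xy; apply: proper_card; rewrite properE; apply/andP; split.
  by apply/subsetP => v; rewrite !inE => /andP[-> h] /=; apply: ltn_trans xy.
by apply/negP => /subsetP /(_ x); rewrite !inE xF xy ltnn /= => /(_ isT).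
Qed.

Lemma rank_inner x y : x \in F -> (x < y)%N -> rank y = (rank x + inner_count F (x, y)).+1.
Proof.
move=> xF xy; rewrite /inner_count /=.
have -> : rank y = #|x |: ([set w in F | (w < x)%N] :|: [set v in F | (x < v)%N && (v < y)%N])|.
  apply: eq_card => v; rewrite !inE; case: (eqVneq v x) => [->|nv]; first by rewrite xF xy.
  have {}nv : v <> x :> nat by move/val_inj; apply/eqP.
  by case: (v \in F) => //=; lia.
rewrite cardsU1 !inE ltnn /= !andbF /= add1n; congr _.+1.
rewrite cardsU (_ : _ :&: _ = set0) ?cards0 ?subn0 //.
by apply/setP => v; rewrite !inE; case: (v \in F) => //=; lia.
Qed.

Lemma rank_surj i : (i < #|F|)%N -> exists2 v, v \in F & rank v = i.
Proof.
move=> hi; have hr v : v \in F -> (rank v < #|F|)%N.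
  move=> vF; apply: proper_card; rewrite properE; apply/andP; split.
    by apply/subsetP => w; rewrite inE => /andP[].
  by apply/negP => /subsetP /(_ v vF); rewrite inE ltnn andbF.
pose f v : 'I_#|F|.+1 := inord (rank v).
have fE v : v \in F -> f v = rank v :> nat by move=> vF; rewrite inordK // ltnS ltnW ?hr.
have finj : {in F &, injective f}.
  move=> x y xF yF e; have {}e : rank x = rank y by rewrite -!fE // e.
  apply: val_inj; case: (ltngtP x y) => // h.
    by have := rank_lt xF h; rewrite e ltnn.
  by have := rank_lt yF h; rewrite e ltnn.
have sub : f @: F \subset [set~ ord_max].
  apply/subsetP => _ /imsetP[v vF ->]; rewrite !inE -val_eqE /= fE //.
  by rewrite neq_ltn hr.
have eq : f @: F = [set~ ord_max].
  by apply/eqP; rewrite eqEcard sub card_in_imset // cardsC1 card_ord /=.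
have : (inord i : 'I_#|F|.+1) \in f @: F.
  by rewrite eq !inE -val_eqE /= inordK ?neq_ltn ?hi // ltnS ltnW.
case/imsetP => v vF e; exists v => //; rewrite -fE // -e inordK //.
exact: ltnW.
Qed.

(** In a polygon with 2j + 2 vertices those of rank i and i + j + 1 are opposite.  The
    pairs for i = 0 and for i = 1 differ, and one of them is not p.  This is why each
    diagonal has a replacement, without which the walk would lose mass. *)
Lemma opposite_other p j : (0 < j)%N -> opposite_in F p -> inner_count F p = j ->
  exists p', opposite_in F p' && (p' != p).
Proof.
case: p => x y j0 /and4P[/= xF yF xy /eqP ho] hi.
have hF := card_sides xF yF xy; rewrite -ho hi in hF.
pose i := (rank x == 0%N) : nat.
have hi1 : (i <= 1)%N by rewrite /i; case: eqP.
have [|u uF hu] := @rank_surj i; first by rewrite -hF; lia.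
have [|v vF hv] := @rank_surj (i + j.+1)%N; first by rewrite -hF; lia.
have uv : (u < v)%N.
  rewrite ltnNge leq_eqVlt; apply/negP => /orP[/eqP/val_inj e|h].
    by move: hu; rewrite -e hv; lia.
  by have := rank_lt vF h; lia.
have := rank_inner uF uv; rewrite hu hv => e.
have := card_sides uF vF uv; rewrite -hF => e2.
exists (u, v); rewrite /opposite_in /= uF vF uv /=; apply/andP; split; first by apply/eqP; lia.
by rewrite xpair_eqE negb_and; apply/orP; left; apply/eqP => eu; move: hu; rewrite eu /i; case: eqP; lia.
Qed.

End Rank.

Section Walk.
Variables (R : realFieldType) (q n m : nat).
Hypotheses (q0 : (0 < q)%N) (n2 : (2 <= n)%N) (hm : m = (q * n + 2)%N).
Local Notation kang := (kangulation q.+2 m).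
Implicit Types (S : kang) (T : {set chord m}) (e : chord m).

Lemma diagonalsP S : is_kangulation q.+2 (diagonals S).
Proof. by case: S. Qed.

Lemma kang_gt0 T : is_kangulation q.+2 T -> (0 < #|T|)%N.
Proof.
move=> hT; rewrite lt0n cards_eq0; apply/eqP => T0.
case/kangP: (hT) => pT hc.
have h0 : (0 < m)%N by rewrite hm; lia.
have h1 : (m.-1 < m)%N by lia.
have hd : drawn T (Ordinal h0) (Ordinal h1).
  by rewrite /drawn /polygon_side /= prednK // eqxx orbT andbT hm; nia.
have /hc : cell T (cell_below T (Ordinal h0) (Ordinal h1)).
  by apply: cell_cell_below => //=; rewrite hm; nia.
have -> : cell_below T (Ordinal h0) (Ordinal h1) = setT.
  apply/setP => z; rewrite !inE /=; apply/andP; split; first by have := ltn_ord z; lia.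
  by apply/coveredP => -[c [d []]]; rewrite T0 inE.
by rewrite cardsT card_ord hm; nia.
Qed.

Lemma replacements_opposite T e : is_kangulation q.+2 T -> e \in T ->
  opposite_in (flip_region T e) e.
Proof.
move=> kT eT; have [_ _ [xR yR xy] _ [hi ho _]] := flip_regionP kT eT.
by rewrite /opposite_in xR yR xy hi ho eqxx.
Qed.

Lemma replacementsE T e :
  replacements T e = [set e' | opposite_in (flip_region T e) e'] :\ e.
Proof. by apply/setP => e'; rewrite !inE andbC. Qed.

Lemma replacements_gt0 T e : is_kangulation q.+2 T -> e \in T ->
  (0 < #|replacements T e|)%N.
Proof.
move=> kT eT; have [_ _ _ _ [hi _ _]] := flip_regionP kT eT.
have [|p' hp] := opposite_other _ (replacements_opposite kT eT) hi; first by lia.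
by apply/card_gt0P; exists p'; rewrite inE.
Qed.

(** The flip region is the same before and after, so the old diagonal is a replacement of
    the new one and both have equally many replacements. *)
Lemma flip_back T e e' : is_kangulation q.+2 T -> e \in T -> e' \in replacements T e ->
  [/\ e' \in flip T e e', e \in replacements (flip T e e') e',
      flip (flip T e e') e' e = T, #|flip T e e'| = #|T| &
      #|replacements (flip T e e') e'| = #|replacements T e|].
Proof.
move=> kT eT he; have [kT' hR nQ eQ] := flip_kangulation kT eT he.
have e'T : e' \in flip T e e' by rewrite !inE eqxx.
have ho := replacements_opposite kT eT.
move: (he); rewrite inE => /andP[ho' ne].
split=> //.
- by rewrite inE hR ho eq_sym ne.
- by rewrite {1}/flip eQ setD1K.
- by rewrite /flip cardsU1 nQ (cardsD1 e T) eT.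
- rewrite !replacementsE hR.
  have := cardsD1 e [set p | opposite_in (flip_region T e) p].
  have := cardsD1 e' [set p | opposite_in (flip_region T e) p].
  by rewrite !inE ho ho' => -> [].
Qed.

(** The non-lazy half of the walk. *)
Definition flip_kernel S S' : R :=
  \sum_(e in diagonals S) (#|diagonals S|%:R)^-1 *
     \sum_(e' in replacements (diagonals S) e)
       (#|replacements (diagonals S) e|%:R)^-1 *
       (diagonals S' == flip (diagonals S) e e')%:R.

(** The contribution of one flip, written as a product with a condition that can be read
    from either end of the flip. *)
Definition flip_rate S S' (e e' : chord m) : R :=
  [&& e \in diagonals S, e' \in replacements (diagonals S) e &
      diagonals S' == flip (diagonals S) e e']%:R *
  ((#|diagonals S|%:R)^-1 * (#|replacements (diagonals S) e|%:R)^-1).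

Lemma flip_kernelE S S' : flip_kernel S S' = \sum_e \sum_e' flip_rate S S' e e'.
Proof.
rewrite /flip_kernel big_mkcond; apply: eq_bigr => e _; rewrite /flip_rate.
case: (e \in _) => /=; last by rewrite big1 // => e' _; rewrite mul0r.
rewrite big_mkcond mulr_sumr; apply: eq_bigr => e' _.
by case: (e' \in _) => /=; rewrite ?mul0r ?mulr0 // mulrC -mulrA mulrC -!mulrA; congr (_ * _); rewrite mulrC.
Qed.

Lemma flip_rate_ge0 S S' e e' : 0 <= flip_rate S S' e e'.
Proof. by rewrite !mulr_ge0 ?invr_ge0 ?ler0n. Qed.

Lemma flip_rate_sym S S' e e' : flip_rate S S' e e' = flip_rate S' S e' e.
Proof.
suff h (S1 S2 : kang) e1 e2 : [&& e1 \in diagonals S1, e2 \in replacements (diagonals S1) e1 &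
      diagonals S2 == flip (diagonals S1) e1 e2] ->
    [&& e2 \in diagonals S2, e1 \in replacements (diagonals S2) e2 &
      diagonals S1 == flip (diagonals S2) e2 e1] /\
    ((#|diagonals S2| = #|diagonals S1|)%N *
     (#|replacements (diagonals S2) e2| = #|replacements (diagonals S1) e1|)%N)%type.
  rewrite /flip_rate; case: (boolP [&& _, _ & _]) => h1.
    by have [-> [-> ->]] := h _ _ _ _ h1.
  case: (boolP [&& _, _ & _]) => h2; last by rewrite !mul0r.
  by have [h3 _] := h _ _ _ _ h2; rewrite h3 in h1.
case/and3P=> h1 h2 /eqP e3; have [h4 h5 h6 h7 h8] := flip_back (diagonalsP S1) h1 h2.
by rewrite e3 h4 h5 h6 h7 h8 eqxx.
Qed.

Lemma flip_kernel_ge0 S S' : 0 <= flip_kernel S S'.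
Proof.
by rewrite flip_kernelE; apply: sumr_ge0 => e _; apply: sumr_ge0 => e' _; apply: flip_rate_ge0.
Qed.

Lemma flip_kernel_sym S S' : flip_kernel S S' = flip_kernel S' S.
Proof.
rewrite !flip_kernelE exchange_big /=; apply: eq_bigr => e' _.
by apply: eq_bigr => e _; apply: flip_rate_sym.
Qed.

Lemma sum_inv_card (T : finType) (X : {set T}) : (0 < #|X|)%N ->
  \sum_(x in X) (#|X|%:R)^-1 = 1 :> R.
Proof.
by move=> X0; rewrite sumr_const -[_ *+ _]mulr_natl mulfV // pnatr_eq0 -lt0n.
Qed.

Lemma flip_kernel_sum1 S : \sum_S' flip_kernel S S' = 1.
Proof.
rewrite exchange_big /= -[RHS](sum_inv_card (kang_gt0 (diagonalsP S))).
apply: eq_bigr => e eS; rewrite -mulr_sumr exchange_big /=.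
rewrite -[RHS]mulr1 -[X in _ = _ * X](sum_inv_card (replacements_gt0 (diagonalsP S) eS)); congr (_ * _).
apply: eq_bigr => e' he'; rewrite -mulr_sumr.
have [hk _ _ _] := flip_kangulation (diagonalsP S) eS he'.
rewrite -[RHS]mulr1; congr (_ * _).
rewrite (bigD1 (KAngulation hk)) //= eqxx big1 ?addr0 // => S' ne.
by case: eqP => // e0; case/eqP: ne; apply: val_inj.
Qed.

Lemma flip_walkE S S' :
  flip_walk R S S' = 2^-1 * (S' == S)%:R + 2^-1 * flip_kernel S S'.
Proof. by []. Qed.

(** There are at most m^2 diagonals and m^2 replacements. *)
Lemma flip_walk_ge S S' e e' : e \in diagonals S -> e' \in replacements (diagonals S) e ->
  diagonals S' = flip (diagonals S) e e' -> 1 <= 2 * (m ^ 4)%:R * flip_walk R S S'.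
Proof.
move=> eS he' eS'.
have a0 := kang_gt0 (diagonalsP S); have b0 := replacements_gt0 (diagonalsP S) eS.
have hr : flip_rate S S' e e' <= flip_kernel S S'.
  rewrite flip_kernelE (bigD1 e) //= (bigD1 e') //= -addrA lerDl addr_ge0 //.
    by apply: sumr_ge0 => ? _; apply: flip_rate_ge0.
  by apply: sumr_ge0 => ? _; apply: sumr_ge0 => ? _; apply: flip_rate_ge0.
have hc (X : {set chord m}) : (#|X| <= m ^ 2)%N.
  by apply: leq_trans (max_card _) _; rewrite card_prod card_ord.
have h1 : 1 <= (m ^ 4)%:R * flip_kernel S S'.
  apply: le_trans (_ : (m ^ 4)%:R * flip_rate S S' e e' <= _); last by rewrite ler_wpM2l ?ler0n.
  rewrite /flip_rate eS he' eS' eqxx mul1r -invfM -natrM ler_pdivlMr ?ltr0n ?muln_gt0 ?a0 //.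
  by rewrite mul1r ler_nat (expnD m 2 2) leq_mul ?hc.
rewrite flip_walkE; apply: le_trans h1 _; rewrite mulrDr.
have -> : 2 * (m ^ 4)%:R * (2^-1 * flip_kernel S S') = (m ^ 4)%:R * flip_kernel S S'.
  by rewrite mulrACA mulfV ?mul1r // pnatr_eq0.
by rewrite lerDr !mulr_ge0 ?ler0n ?invr_ge0.
Qed.

Lemma perm_kang : perm_eq (map (fun S : kang => diagonals S) (enum {: kang}))
  (map (dissection q m) (trees q n)).
Proof.
have n0 : (0 < n)%N by lia.
apply: uniq_perm.
- by rewrite map_inj_uniq ?enum_uniq //; apply: val_inj.
- by rewrite map_inj_in_uniq ?uniq_forests // => w w' hw hw'; apply: (dissection_inj q0 n0 hm).
move=> T; apply/mapP/mapP => [[S _ ->]|[w hw ->]].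
  by have [w hw <-] := dissection_surj q0 n0 hm (diagonalsP S); exists w.
by exists (KAngulation (kang_dissection q0 n0 hm hw)); rewrite ?mem_enum.
Qed.

Lemma card_kang : #|{: kang}| = ntrees q n.
Proof. by rewrite cardE; have := perm_size perm_kang; rewrite !size_map. Qed.

(** Along the bijection between trees and k-angulations every rotation is a flip, so it
    has rate at least 1 / (2 m^4). *)
Lemma poincare_walk (A : R) : poincare q n A -> forall f : kang -> R,
  \sum_S \sum_S' (f S - f S') ^+ 2 <=
  A * (ntrees q n)%:R * (2 * (m ^ 4)%:R) * \sum_S \sum_S' flip_walk R S S' * (f S - f S') ^+ 2.
Proof.
move=> [A0 hA] f.
have n0 : (0 < n)%N by lia.
have hsum (G : {set chord m} -> R) :
    \sum_(S : kang) G (diagonals S) = \sum_(w <- trees q n) G (dissection q m w).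
  transitivity (\sum_(T <- map (fun S : kang => diagonals S) (enum {: kang})) G T).
    by rewrite big_map big_enum.
  by rewrite (perm_big _ perm_kang) big_map.
pose F (T : {set chord m}) : R := if (insub T : option kang) is Some X then f X else 0.
have FE S : F (diagonals S) = f S by rewrite /F valK.
have eL : \sum_S \sum_S' (f S - f S') ^+ 2 = sq_sum (F \o dissection q m) (trees q n) (trees q n).
  rewrite /sq_sum /= -(hsum (fun T => \sum_(w' <- trees q n) (F T - F (dissection q m w')) ^+ 2)).
  apply: eq_bigr => S _; rewrite -(hsum (fun T => (F (diagonals S) - F T) ^+ 2)).
  by apply: eq_bigr => S' _; rewrite !FE.
rewrite eL; apply: le_trans (hA _) _; rewrite -[leRHS]mulrA ler_wpM2l //.
  by rewrite mulr_ge0 ?ler0n.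
pose pw (T T' : {set chord m}) : R :=
  if (insub T : option kang) is Some X then
    if (insub T' : option kang) is Some Y then flip_walk R X Y else 0 else 0.
have pwE S S' : pw (diagonals S) (diagonals S') = flip_walk R S S' by rewrite /pw !valK.
have -> : \sum_S \sum_S' flip_walk R S S' * (f S - f S') ^+ 2 =
   \sum_(w <- trees q n) \sum_(w' <- trees q n) pw (dissection q m w) (dissection q m w') *
     (F (dissection q m w) - F (dissection q m w')) ^+ 2.
  rewrite -(hsum (fun T => \sum_(w' <- trees q n) pw T (dissection q m w') *
     (F T - F (dissection q m w')) ^+ 2)).
  apply: eq_bigr => S _; rewrite -(hsum (fun T => pw (diagonals S) T * (F (diagonals S) - F T) ^+ 2)).
  by apply: eq_bigr => S' _; rewrite !FE pwE.
rewrite /energy mulr_sumr; apply: ler_sum_seq => w hw.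
rewrite mulr_sumr; apply: ler_sum_seq => w' hw'; rewrite /= mulrA.
pose S := KAngulation (kang_dissection q0 n0 hm hw).
pose S' := KAngulation (kang_dissection q0 n0 hm hw').
have -> : pw (dissection q m w) (dissection q m w') = flip_walk R S S'.
  by rewrite -pwE.
have [->|nw] := eqVneq w w'; first by rewrite subrr expr0n !mulr0.
rewrite ler_wpM2r ?sqr_ge0 //; case: (asboolP (rotation q w w')) => hr /=.
  have [e [e' [h1 h2 h3]]] := rotation_flip q0 n0 hm hw hr (elimN eqP nw).
  exact: (@flip_walk_ge S S' e e').
rewrite mulr0n flip_walkE mulr_ge0 ?mulr_ge0 ?ler0n // addr_ge0 ?mulr_ge0 ?invr_ge0 ?ler0n //.
exact: flip_kernel_ge0.
Qed.

End Walk.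

(** * The mixing time *)

Section Mixing.
Variables (R : realType) (Omega : finType) (K P : Omega -> Omega -> R) (A : R).
Hypotheses (K0 : forall x y, 0 <= K x y) (Ksym : forall x y, K x y = K y x)
  (K1 : forall x, \sum_y K x y = 1) (PK : forall x y, P x y = 2^-1 * (y == x)%:R + 2^-1 * K x y).
Hypotheses (A0 : 0 < A) (hA : forall g : Omega -> R,
  \sum_x \sum_y (g x - g y) ^+ 2 <= A * \sum_x \sum_y P x y * (g x - g y) ^+ 2).
Let N : R := #|Omega|%:R.

Lemma deviation_decay S0 t :
  \sum_S deviation P S0 t S ^+ 2 <= expR (- (N / A)) ^+ t.
Proof.
elim: t => [|t IH]; first by rewrite expr0; apply: deviation0_le1.
under eq_bigr do rewrite (deviation_step Ksym K1 PK).
have := step_contraction K0 Ksym K1 PK A0 hA (deviation_sum0 Ksym K1 PK S0 t).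
move=> /le_trans; apply; rewrite exprS.
have d0 : 0 <= \sum_S deviation P S0 t S ^+ 2 by apply: sumr_ge0 => S _; apply: sqr_ge0.
apply: le_trans (_ : expR (- (N / A)) * \sum_S deviation P S0 t S ^+ 2 <= _).
  by rewrite ler_wpM2r //; apply: expR_ge1Dx.
by rewrite ler_wpM2l ?expR_ge0.
Qed.

(** The first factor [N] is the loss of [tv_dist_le]. *)
Lemma mixed_after t : N * expR (- (N / A)) ^+ t < 4^-1 -> mixed_at P (uniform_dist R (Omega:=Omega)) t.
Proof.
move=> ht S0; rewrite -(@ltr_sqr _ _ 4^-1) ?nnegrE ?invr_ge0 //; last first.
  by rewrite /tv_dist mulr_ge0 ?invr_ge0 // sumr_ge0.
apply: le_lt_trans (tv_dist_le P S0 t) _.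
rewrite (_ : 4^-1 ^+ 2 = 4^-1 * 4^-1) ?expr2 // ltr_pM2l ?invr_gt0 //.
by apply: le_lt_trans ht; rewrite ler_wpM2l ?ler0n ?deviation_decay.
Qed.

Lemma mixing_time_exists (pi : Omega -> R) t : mixed_at P pi t ->
  exists t', is_mixing_time P pi t' /\ (t' <= t)%N.
Proof.
move=> ht; have hex : exists t, `[< mixed_at P pi t >] by exists t; apply/asboolP.
have [t' /asboolP h1 h2] := ex_minnP hex; exists t'; split; last by apply/h2/asboolP.
by split=> // s hs; apply/h2/asboolP.
Qed.

End Mixing.

Section Estimate.
Variables (R : realType) (q : nat).
Hypothesis q0 : (0 < q)%N.

(** Each step of the recursion shrinks n by the factor 1 - 1/(2(q + 2)), and [D] steps lead
    from [n] to at most 3, where [K0] serves.  The size [M] bounds all n met on the way. *)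
Lemma poincare_iter : exists2 K0 : R, 1 <= K0 & forall D n M,
  (n <= M)%N -> (n * (2 * q.+2 - 1) ^ D <= 3 * (2 * q.+2) ^ D)%N ->
  poincare q n (K0 * (256 * (wordlen q M ^ 10)%:R) ^+ D).
Proof.
have [A0 h0] := poincare_exists q R 0; have [A1 h1] := poincare_exists q R 1.
have [A2 h2] := poincare_exists q R 2; have [A3 h3] := poincare_exists q R 3.
pose K0 := 1 + A0 + A1 + A2 + A3.
have K1 : 1 <= K0 by have := h0.1; have := h1.1; have := h2.1; have := h3.1; rewrite /K0; lra.
exists K0; first exact: K1.
have small n : (n <= 3)%N -> poincare q n K0.
  have := h0.1; have := h1.1; have := h2.1; have := h3.1 => a3 a2 a1 a0.
  case: n => [_|[_|[_|[_|//]]]].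
  - by apply: poincare_le h0; rewrite /K0; lra.
  - by apply: poincare_le h1; rewrite /K0; lra.
  - by apply: poincare_le h2; rewrite /K0; lra.
  - by apply: poincare_le h3; rewrite /K0; lra.
have L1 M : (1 : R) <= 256 * (wordlen q M ^ 10)%:R.
  by rewrite -natrM ler1n muln_gt0 /= expn_gt0.
elim=> [|D IH] n M hM hn.
  by rewrite expr0 mulr1; apply: small; move: hn; rewrite !expn0 !muln1.
case: (leqP n 3) => n3.
  apply: poincare_le (small _ n3); rewrite ler_peMr ?exprn_ege1 //.
  exact: le_trans K1.
apply: (@poincare_le _ _ _ (256 * (wordlen q n ^ 10)%:R * (K0 * (256 * (wordlen q M ^ 10)%:R) ^+ D))).
  rewrite exprS mulrCA; apply: ler_wpM2l; first exact: le_trans K1.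
  apply: ler_wpM2r; first by apply: exprn_ge0; apply: le_trans ler01 (L1 M).
  by rewrite ler_wpM2l ?ler0n // ler_nat leq_exp2r // ltnS leq_mul2l hM orbT.
apply: (poincare_step q0 n3) => a han /andP[b1 b2].
have key x : (2 * q.+2 * x <= (2 * q.+2 - 1) * n)%N -> (x * (2 * q.+2 - 1) ^ D <= 3 * (2 * q.+2) ^ D)%N.
  move=> hx; rewrite -(@leq_pmul2l (2 * q.+2)) //.
  have -> : (2 * q.+2 * (3 * (2 * q.+2) ^ D) = 3 * (2 * q.+2) ^ D.+1)%N by rewrite expnS; ring.
  apply: leq_trans hn; rewrite mulnA expnS.
  have -> : (n * ((2 * q.+2 - 1) * (2 * q.+2 - 1) ^ D) = (2 * q.+2 - 1) * n * (2 * q.+2 - 1) ^ D)%N by ring.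
  by rewrite leq_mul2r hx orbT.
split; apply: IH; try (apply: leq_trans hM; lia); apply: key => //.
move: b1 b2; set k := (2 * q.+2)%N; have : (1 <= k)%N by rewrite /k; lia.
move=> k1 b1 b2; rewrite mulnBr mulnBl mul1n; lia.
Qed.

(** As (1 - 1/(2(q + 2)))^D <= exp (- D / (2(q + 2))), depth slightly above 2 (q + 2) ln n
    suffices. *)
Lemma recursion_depth n : (0 < n)%N -> 1 <= ln n%:R :> R -> exists2 D : nat,
  (n * (2 * q.+2 - 1) ^ D <= 3 * (2 * q.+2) ^ D)%N & D%:R <= 3 * q.+2%:R * ln n%:R :> R.
Proof.
move=> n1 ln1; have n0 : (0 : R) < n%:R by rewrite ltr0n.
pose k : R := q.+2%:R; have k3 : 3 <= k by rewrite ler_nat.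
pose x := 2 * k * ln n%:R.
have x0 : 0 <= x by rewrite !mulr_ge0 ?(le_trans ler01 ln1) //; lra.
exists (Num.truncn x).+1; last first.
  rewrite -addn1 natrD; have : (Num.truncn x)%:R <= x by rewrite truncn_le.
  have : 1 <= k * ln n%:R by rewrite -[leLHS]mulr1 ler_pM //; lra.
  rewrite -/k /x; lra.
set D := (Num.truncn x).+1; have hD : x < D%:R by rewrite /D -truncn_le_nat.
pose r : R := 1 - (2 * k)^-1.
have e1 : ((2 * q.+2 - 1)%N%:R : R) = 2 * k * r.
  rewrite natrB // natrM -/k /r mulrBr mulr1 mulfV //; apply: lt0r_neq0; lra.
have h1 : r ^+ D <= n%:R^-1.
  apply: le_trans (_ : expR (- (2 * k)^-1) ^+ D <= _).
    rewrite lerXn2r ?nnegrE ?expR_ge0 //; last exact: expR_ge1Dx.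
    by rewrite subr_ge0 invf_le1; lra.
  rewrite -expRM_natl -[n%:R]lnK // -expRN ler_expR mulrN lerN2.
  by rewrite ler_pdivlMr; [rewrite mulrC; apply: ltW | lra].
rewrite -(ler_nat R) !natrM !natrX e1 natrM -/k exprMn.
have h2 : 0 < (2 * k) ^+ D by apply: exprn_gt0; move: k3; clear; lra.
rewrite mulrCA [leRHS]mulrC ler_pM2l //; apply: le_trans (_ : n%:R * n%:R^-1 <= _).
  by rewrite ler_pM2l.
by rewrite mulfV ?gt_eqF // ler1n.
Qed.

End Estimate.

Section Mixed.
Variables (R : realType) (q n m : nat) (A : R).
Hypotheses (q0 : (0 < q)%N) (n2 : (2 <= n)%N) (hm : m = (q * n + 2)%N).
Hypotheses (A0 : 0 < A) (hA : poincare q n A).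

(** There are at most 2^((q+1)n+1) trees, and (q + 1) n + 4 relaxation times give a factor
    below 2^-((q+1)n+4), which beats this number by 8. *)
Lemma mixed_poincare t : (q.+1 * n + 4)%:R * (A * (2 * (m ^ 4)%:R)) <= t%:R ->
  mixed_at (@flip_walk R q.+2 m) (@uniform_dist R (kangulation q.+2 m)) t.
Proof.
set B := A * _ => ht.
have m0 : (0 < m)%N by rewrite hm; lia.
have B0 : 0 < B by rewrite !mulr_gt0 // ltr0n expn_gt0 m0.
have c0 : 0 < (ntrees q n)%:R :> R by rewrite ltr0n ntrees_gt0.
apply: (@mixed_after R _ (@flip_kernel R q m) _ (A * (ntrees q n)%:R * (2 * (m ^ 4)%:R))).
- exact: flip_kernel_ge0.
- exact: flip_kernel_sym.
- exact: (flip_kernel_sum1 R q0 n2 hm).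
- exact: flip_walkE.
- by rewrite -mulrA mulrCA mulr_gt0.
- exact: (poincare_walk q0 n2 hm hA).
rewrite (card_kang q0 n2 hm) -mulrA mulrCA -/B invfM mulrA mulfV ?gt_eqF // mul1r.
rewrite -expRM_natl mulrN expRN.
have hE : 2 ^+ (q.+1 * n + 4) <= expR (t%:R / B) :> R.
  apply: le_trans (_ : expR ((q.+1 * n + 4)%:R * 1) <= _).
    by rewrite expRM_natl lerXn2r ?nnegrE ?expR_ge0 //; have := expR_ge1Dx (1 : R); lra.
  by rewrite ler_expR mulr1 ler_pdivlMr.
have hC : (ntrees q n)%:R <= 2 ^+ (q.+1 * n).+1 :> R by rewrite -natrX ler_nat ntrees_le_exp.
have p0 : 0 < 2 ^+ (q.+1 * n).+1 :> R by rewrite exprn_gt0.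
rewrite ltr_pdivrMr ?expR_gt0 //.
have : 2 ^+ (q.+1 * n + 4) = 2 ^+ (q.+1 * n).+1 * 8 :> R.
  have -> : (q.+1 * n + 4 = (q.+1 * n).+1 + 3)%N by lia.
  by rewrite exprD; congr (_ * _); ring.
move: hE hC p0; set a := 2 ^+ _; set b := 2 ^+ _; set c := expR _; lra.
Qed.

End Mixed.

(** For large n the fixed factors are below n: the recursion contributes a factor n^21 per
    level and K0 <= n at the bottom, the flip rates n^9, and the number of relaxation
    times n^2.  With rounding this is n^(13 + 21 D), where D <= 3 k ln n and
    13 <= 13 k ln n; whence 76 = 13 + 3 * 21. *)
Lemma mixing_time_bound (R : realType) (q : nat) : (0 < q)%N ->
  exists N : nat, forall n m : nat, (N <= n)%N -> m = (q * n + 2)%N ->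
  exists t : nat,
    is_mixing_time (@flip_walk R q.+2 m) (@uniform_dist R (kangulation q.+2 m)) t /\
    t%:R <= (n%:R : R) `^ (76 * q.+2%:R * ln n%:R).
Proof.
move=> q0; have [K0 K1 hK] := poincare_iter R q0.
exists (q + 256 + (Num.truncn K0).+1 + (Num.truncn (expR 1 : R)).+1)%N => n m hn hm.
have n2 : (2 <= n)%N by lia.
have tb (x : R) : (Num.truncn x < n)%N -> x <= n%:R.
  by case: (n) => // k; rewrite ltnS truncn_le_nat => /ltW.
have nK : K0 <= n%:R by apply: tb; lia.
have ln1 : 1 <= ln n%:R :> R.
  have n0 : 0 < n%:R :> R by rewrite ltr0n; lia.
  rewrite -[leLHS]expRK ler_ln ?posrE ?expR_gt0 //; apply: tb; lia.
have [D hD1 hD2] := recursion_depth q0 (ltnW n2) ln1.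
have hA := hK D n n (leqnn n) hD1.
set A := K0 * _ in hA.
pose x : R := n%:R.
have x1 : 1 <= x by rewrite ler1n; lia.
have x0 : 0 <= x by apply: le_trans x1.
have x2 : 2 <= x by rewrite ler_nat.
have A0 : 0 < A.
  apply: mulr_gt0; first exact: lt_le_trans ltr01 K1.
  by apply: exprn_gt0; rewrite -natrM ltr0n muln_gt0 /= expn_gt0.
have nn : (q.+2 * n <= n ^ 2)%N by rewrite expnS expn1 leq_mul2r; move: hn; clear; lia.
have hL : 256 * (wordlen q n ^ 10)%:R <= x ^+ 21.
  rewrite -natrM -natrX ler_nat (expnS n 20); apply: leq_mul; first by move: hn; clear; lia.
  by rewrite -[(n ^ 20)%N]/(n ^ (2 * 10))%N expnM leq_exp2r // /wordlen; move: nn n2; clear; lia.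
have hAx : A <= x ^+ (1 + 21 * D).
  have hL0 : 0 <= 256 * (wordlen q n ^ 10)%:R :> R by rewrite mulr_ge0 ?ler0n.
  rewrite /A exprD expr1 exprM; apply: ler_pM; first exact: le_trans ler01 K1.
  - exact: exprn_ge0.
  - exact: nK.
  - by rewrite lerXn2r ?nnegrE ?exprn_ge0.
clearbody A.
have hm4 : 2 * (m ^ 4)%:R <= x ^+ 9.
  rewrite -natrM -natrX ler_nat (expnS n 8) leq_mul //.
  by rewrite -[(n ^ 8)%N]/(n ^ (2 * 4))%N expnM leq_exp2r // hm; move: nn n2; clear; lia.
have hE : (q.+1 * n + 4)%:R <= x ^+ 2.
  by rewrite -natrX ler_nat; move: nn hn; clear; lia.
pose T := (q.+1 * n + 4)%:R * (A * (2 * (m ^ 4)%:R)).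
have T0 : 0 <= T by rewrite /T !mulr_ge0 ?ler0n ?(ltW A0).
have hT : T <= x ^+ (12 + 21 * D).
  have -> : (12 + 21 * D = 2 + ((1 + 21 * D) + 9))%N by clear; lia.
  rewrite (exprD x 2) (exprD x (1 + 21 * D)); apply: ler_pM => //.
    by rewrite mulr_ge0 ?mulr_ge0 ?ler0n ?(ltW A0).
  by apply: ler_pM => //; apply: ltW.
have hmix : mixed_at (@flip_walk R q.+2 m) (@uniform_dist R (kangulation q.+2 m)) (Num.truncn T).+1.
  apply: (mixed_poincare q0 n2 hm A0 hA); rewrite -/T ltW //.
  by rewrite -truncn_le_nat.
have [t [ht1 ht2]] := mixing_time_exists hmix; exists t; split=> //.
have h13 : t%:R <= x ^+ (13 + 21 * D).
  have : t%:R <= T + 1.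
    apply: le_trans (_ : (Num.truncn T).+1%:R <= _); first by rewrite ler_nat.
    by rewrite -natr1 lerD2r truncn_le.
  have h1 : 1 <= x ^+ (12 + 21 * D) by apply: exprn_ege1.
  move=> h; apply: le_trans h _; rewrite [(13 + _)%N]addSn exprS.
  have : 2 * x ^+ (12 + 21 * D) <= x * x ^+ (12 + 21 * D) by rewrite ler_wpM2r // (le_trans ler01).
  lra.
apply: le_trans h13 _; rewrite -powR_mulrn //; apply: ler_powR => //.
rewrite natrD natrM; move: hD2; set y := ln _ in ln1 *.
have k1 : 1 <= q.+2%:R :> R by rewrite ler1n.
have : 1 <= q.+2%:R * y by rewrite -[leLHS]mulr1 ler_pM.
lra.
Qed.

Theorem theorem3 (R : realType) :
  exists C : R, forall k : nat, (3 <= k)%N ->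
  exists N : nat, forall n : nat, (N <= n)%N ->
  exists t : nat,
    is_mixing_time
      (@flip_walk R k ((k - 2) * n + 2))
      (@uniform_dist R (kangulation k ((k - 2) * n + 2))) t /\
    t%:R <= n%:R `^ (C * k%:R * ln n%:R).
Proof.
exists 76; case=> [|[|q]] // q0; have [N hN] := mixing_time_bound R (q0 : (0 < q)%N).
by exists N => n hn; apply: hN => //; rewrite subSS subSS subn0.
Qed.
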